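(* In $\mathsf{ZF}$, the following are equivalent: (1) $\mathsf{DC}$. (2) $\mathrm{Col}(\omega,\omega_1)$ is not proper. (3) There exists a notion of forcing which is not proper.
   Context: Base theory: $\mathsf{ZF}$. $\mathsf{DC}$ (Dependent Choice) is the statement that every $\aleph_0$-closed tree without maximal elements has a chain of order type $\omega$ (a tree is a well-founded partial order whose lower cones are chains; it is $\kappa$-closed if for every $\alpha<\kappa$ every increasing sequence of nodes indexed by $\alpha$ has an upper bound). $\mathrm{Col}(\omega,\omega_1)$ is the forcing of finite partial functions from $\omega$ to $\omega_1$ ordered by reverse inclusion. A notion of forcing is a partially ordered set $\mathbb{P}$ with a maximum $1_{\mathbb{P}}$; $q\le p$ means $q$ is stronger. ''Countable'' means injectable into $\omega$. For sets $x,y$ write $|x|\le^*|y|$ if $x$ is empty or there is a surjection from $y$ onto $x$. For a well-ordered cardinal $\kappa$, $H(\kappa)=\{y : |\kappa|\not\le^*|\mathrm{tcl}(y)|\}$. Given a countable $M\prec (H(\kappa),\in,\mathbb{P})$, a condition $q\in\mathbb{P}$ is $M$-generic if for every open dense $D\subseteq\mathbb{P}$ with $D\in M$, $D\cap M$ is predense below $q$. $\mathbb{P}$ is proper if for all sufficiently large cardinals $\kappa$ (i.e. for a tail of $\kappa$) and every countable elementary submodel $M\prec (H(\kappa),\in,\mathbb{P})$, every $p\in\mathbb{P}\cap M$ has an extension $q\le p$ which is $M$-generic. (If there are no such $M$ for a tail of $\kappa$, the definition holds vacuously.) *)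

(* Defs.v *)
(** Derivability in ZF is rendered semantically: a sentence is a theorem of ZF
    iff it holds in every structure [(V, ∈)] satisfying the first-order axioms
    of ZF (completeness theorem).  Separation and Replacement are schemes over
    first-order formulas with parameters, NOT over arbitrary Rocq predicates:
    the latter would only give second-order models, which inherit choice
    from the metatheory.

    Every set-theoretic notion is written relationally, with all
    quantifiers ranging over the carrier [V]; each one is the transcription of
    a first-order formula of set theory evaluated in [V].  In particular
    "finite", "countable", "ω", and also the formulas and the satisfaction
    relation used for elementary submodels, are those of the model [V], whose
    natural numbers may be nonstandard. *)

Set Implicit Arguments.
Unset Strict Implicit.

Record structure : Type := Structure {
  carrier :> Type;
  mem : carrier -> carrier -> Prop
}.

Declare Scope zf_scope.
Open Scope zf_scope.
Notation "x ∈ y" := (mem x y) (at level 70, no associativity) : zf_scope.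

Definition subset {V : structure} (x y : V) : Prop :=
  forall z : V, z ∈ x -> z ∈ y.
Notation "x ⊆ y" := (subset x y) (at level 70, no associativity) : zf_scope.

(** ** First-order formulas of the language {∈} (de Bruijn indices) *)

Inductive formula : Type :=
| FMem (i j : nat)
| FEq (i j : nat)
| FFalse
| FAnd (f g : formula)
| FOr (f g : formula)
| FImp (f g : formula)
| FAll (f : formula)
| FEx (f : formula).

Definition push {A : Type} (x : A) (e : nat -> A) : nat -> A :=
  fun n => match n with O => x | S m => e m end.

Fixpoint holds {V : structure} (e : nat -> V) (f : formula) : Prop :=
  match f with
  | FMem i j => e i ∈ e j
  | FEq i j => e i = e j
  | FFalse => False
  | FAnd f g => holds e f /\ holds e g
  | FOr f g => holds e f \/ holds e g
  | FImp f g => holds e f -> holds e g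
  | FAll f => forall x : V, holds (push x e) f
  | FEx f => exists x : V, holds (push x e) f
  end.

(** ** Elementary notions *)

Definition is_empty {V : structure} (x : V) : Prop :=
  forall y : V, ~ y ∈ x.

Definition is_upair {V : structure} (z a b : V) : Prop :=
  forall y : V, y ∈ z <-> y = a \/ y = b.

(** Kuratowski pairs: [z = {{a}, {a, b}}]. *)
Definition is_pair {V : structure} (z a b : V) : Prop :=
  exists s t : V, is_upair s a a /\ is_upair t a b /\ is_upair z s t.

(** [z = ((a, b), c)]. *)
Definition is_triple {V : structure} (z a b c : V) : Prop :=
  exists p : V, is_pair p a b /\ is_pair z p c.

(** [y = x ∪ {x}]. *)
Definition is_succ {V : structure} (y x : V) : Prop :=
  forall z : V, z ∈ y <-> z ∈ x \/ z = x.

Definition inductive_set {V : structure} (x : V) : Prop :=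
  (forall y : V, is_empty y -> y ∈ x) /\
  (forall y z : V, y ∈ x -> is_succ z y -> z ∈ x).

(** ** The axioms of ZF *)

(** In Separation, variable 0 is the element and the others are parameters; in
    Replacement, variable 1 is the argument and variable 0 the value. *)
Record ZF (V : structure) : Prop := {
  zf_extensionality :
    forall x y : V, (forall z : V, z ∈ x <-> z ∈ y) -> x = y;
  zf_foundation :
    forall x : V, (exists y : V, y ∈ x) ->
      exists y : V, y ∈ x /\ forall z : V, z ∈ x -> ~ z ∈ y;
  zf_pairing :
    forall a b : V, exists z : V, is_upair z a b;
  zf_union :
    forall x : V, exists u : V,
      forall z : V, z ∈ u <-> exists y : V, y ∈ x /\ z ∈ y;
  zf_powerset :
    forall x : V, exists u : V, forall z : V, z ∈ u <-> z ⊆ x;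
  zf_infinity :
    exists x : V, (exists y : V, is_empty y /\ y ∈ x) /\
      forall y : V, y ∈ x -> exists z : V, is_succ z y /\ z ∈ x;
  zf_separation :
    forall (f : formula) (e : nat -> V) (a : V), exists b : V,
      forall x : V, x ∈ b <-> x ∈ a /\ holds (push x e) f;
  zf_replacement :
    forall (f : formula) (e : nat -> V) (a : V),
      (forall x y y' : V, x ∈ a ->
         holds (push y (push x e)) f -> holds (push y' (push x e)) f ->
         y = y') ->
      exists b : V, forall y : V,
        y ∈ b <-> exists x : V, x ∈ a /\ holds (push y (push x e)) f
}.

(** ** Relations and functions *)

(** [(a, b) ∈ R]. *)
Definition related {V : structure} (R a b : V) : Prop :=
  exists p : V, is_pair p a b /\ p ∈ R.

Definition is_relation {V : structure} (R a b : V) : Prop :=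
  forall p : V, p ∈ R -> exists x y : V, x ∈ a /\ y ∈ b /\ is_pair p x y.

Definition is_partial_function {V : structure} (f a b : V) : Prop :=
  is_relation f a b /\
  forall x y y' : V, related f x y -> related f x y' -> y = y'.

Definition is_function {V : structure} (f a b : V) : Prop :=
  is_partial_function f a b /\
  forall x : V, x ∈ a -> exists y : V, related f x y.

Definition is_injection {V : structure} (f a b : V) : Prop :=
  is_function f a b /\
  forall x x' y : V, related f x y -> related f x' y -> x = x'.

Definition is_surjection {V : structure} (f a b : V) : Prop :=
  is_function f a b /\
  forall y : V, y ∈ b -> exists x : V, related f x y.

Definition is_bijection {V : structure} (f a b : V) : Prop :=
  is_injection f a b /\ is_surjection f a b.

(** [|x| ≤* |y|]. *)
Definition le_star {V : structure} (x y : V) : Prop :=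
  is_empty x \/ exists f : V, is_surjection f y x.

(** ** Ordinals and cardinals *)

Definition transitive_set {V : structure} (x : V) : Prop :=
  forall y : V, y ∈ x -> y ⊆ x.

(** Membership is well-founded by the axiom of foundation. *)
Definition is_ordinal {V : structure} (a : V) : Prop :=
  transitive_set a /\
  forall x y : V, x ∈ a -> y ∈ a -> x ∈ y \/ x = y \/ y ∈ x.

(** Well-ordered cardinals, i.e. initial ordinals. *)
Definition is_cardinal {V : structure} (k : V) : Prop :=
  is_ordinal k /\
  forall a : V, a ∈ k -> ~ exists f : V, is_bijection f a k.

Definition is_omega {V : structure} (w : V) : Prop :=
  inductive_set w /\ forall x : V, inductive_set x -> w ⊆ x.

Definition finite {V : structure} (x : V) : Prop :=
  exists w n f : V, is_omega w /\ n ∈ w /\ is_bijection f x n.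

Definition countable {V : structure} (x : V) : Prop :=
  exists w f : V, is_omega w /\ is_injection f x w.

(** The least uncountable ordinal. *)
Definition is_omega1 {V : structure} (w1 : V) : Prop :=
  is_ordinal w1 /\ ~ countable w1 /\ forall a : V, a ∈ w1 -> countable a.

(** ** [H(κ)] *)

(** [t = tcl(y)], the least transitive set including [y] as a subset. *)
Definition is_tcl {V : structure} (t y : V) : Prop :=
  y ⊆ t /\ transitive_set t /\
  forall u : V, y ⊆ u -> transitive_set u -> t ⊆ u.

Definition is_H {V : structure} (H k : V) : Prop :=
  forall y : V, y ∈ H <-> exists t : V, is_tcl t y /\ ~ le_star k t.

(** ** Partial orders *)

(** [related L x y] reads [x ≤ y]. *)
Definition is_poset {V : structure} (P L : V) : Prop :=
  is_relation L P P /\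
  (forall x : V, x ∈ P -> related L x x) /\
  (forall x y : V, related L x y -> related L y x -> x = y) /\
  (forall x y z : V, related L x y -> related L y z -> related L x z).

Definition strictly_below {V : structure} (L x y : V) : Prop :=
  related L x y /\ x <> y.

Definition well_founded_order {V : structure} (P L : V) : Prop :=
  forall X : V, X ⊆ P -> (exists x : V, x ∈ X) ->
    exists m : V, m ∈ X /\ forall x : V, x ∈ X -> ~ strictly_below L x m.

(** ** Dependent Choice *)

Definition is_tree {V : structure} (T L : V) : Prop :=
  is_poset T L /\ well_founded_order T L /\
  forall t x y : V, related L x t -> related L y t ->
    related L x y \/ related L y x.

Definition increasing_sequence {V : structure} (s a T L : V) : Prop :=
  is_function s a T /\
  forall b c x y : V, c ∈ a -> b ∈ c -> related s b x -> related s c y ->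
    strictly_below L x y.

(** The case [a = 0] says that [T] is nonempty (for [k > 0]). *)
Definition closed_tree {V : structure} (k T L : V) : Prop :=
  forall a s : V, a ∈ k -> increasing_sequence s a T L ->
    exists u : V, u ∈ T /\ forall b x : V, related s b x -> related L x u.

Definition no_maximal {V : structure} (T L : V) : Prop :=
  forall x : V, x ∈ T -> exists y : V, y ∈ T /\ strictly_below L x y.

Definition is_chain {V : structure} (C T L : V) : Prop :=
  C ⊆ T /\
  forall x y : V, x ∈ C -> y ∈ C -> related L x y \/ related L y x.

(** [f] is an isomorphism from [(a, ∈)] onto [C] with the strict order. *)
Definition has_order_type {V : structure} (C L a : V) : Prop :=
  exists f : V, is_bijection f a C /\
    forall b c x y : V, b ∈ a -> c ∈ a -> related f b x -> related f c y ->
      (b ∈ c <-> strictly_below L x y).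

Definition DC (V : structure) : Prop :=
  forall w T L : V, is_omega w ->
    is_tree T L -> closed_tree w T L -> no_maximal T L ->
    exists C : V, is_chain C T L /\ has_order_type C L w.

(** ** Notions of forcing *)

(** The notion of forcing [PP] is the triple [(P, ≤, 1)]; [related L q p] reads
    "[q] is stronger than [p]". *)
Definition is_forcing {V : structure} (PP P L o : V) : Prop :=
  is_triple PP P L o /\ is_poset P L /\ o ∈ P /\
  forall p : V, p ∈ P -> related L p o.

Definition notion_of_forcing {V : structure} (PP : V) : Prop :=
  exists P L o : V, is_forcing PP P L o.

Definition compatible {V : structure} (P L p q : V) : Prop :=
  exists r : V, r ∈ P /\ related L r p /\ related L r q.

Definition open_dense {V : structure} (D P L : V) : Prop :=
  D ⊆ P /\
  (forall d p : V, d ∈ D -> related L p d -> p ∈ D) /\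
  (forall p : V, p ∈ P -> exists d : V, d ∈ D /\ related L d p).

Definition predense_below {V : structure} (A P L q : V) : Prop :=
  forall r : V, related L r q -> exists d : V, d ∈ A /\ compatible P L r d.

Definition is_inter {V : structure} (A x y : V) : Prop :=
  forall z : V, z ∈ A <-> z ∈ x /\ z ∈ y.

(** ** Elementary submodels *)

(** Formulas, as elements of the model [V], of the language with [∈] and one
    constant symbol.  The terms are the natural numbers: 0 is the constant
    symbol, and each [n ≠ 0] is a variable.  The codes are
    [(0,(i,j))] for "t_i ∈ t_j", [(1,(i,j))] for "t_i = t_j",
    [(2,φ)] for "¬ φ", [(3,(φ,ψ))] for "φ ∧ ψ", and
    [(4,(n,φ))], with [n ≠ 0], for "∃ t_n φ". *)

Fixpoint is_numeral {V : structure} (k : nat) (x : V) : Prop :=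
  match k with
  | O => is_empty x
  | S k => exists y : V, is_numeral k y /\ is_succ x y
  end.

Definition tagged {V : structure} (k : nat) (z x : V) : Prop :=
  exists t : V, is_numeral k t /\ is_pair z t x.

Definition tagged_pair {V : structure} (k : nat) (z x y : V) : Prop :=
  exists p : V, is_pair p x y /\ tagged k z p.

Definition mem_code {V : structure} : V -> V -> V -> Prop := tagged_pair 0.
Definition eq_code {V : structure} : V -> V -> V -> Prop := tagged_pair 1.
Definition not_code {V : structure} : V -> V -> Prop := tagged 2.
Definition and_code {V : structure} : V -> V -> V -> Prop := tagged_pair 3.
Definition ex_code {V : structure} : V -> V -> V -> Prop := tagged_pair 4.

Definition formula_closed {V : structure} (w F : V) : Prop :=
  (forall z i j : V, i ∈ w -> j ∈ w -> mem_code z i j -> z ∈ F) /\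
  (forall z i j : V, i ∈ w -> j ∈ w -> eq_code z i j -> z ∈ F) /\
  (forall z f : V, f ∈ F -> not_code z f -> z ∈ F) /\
  (forall z f g : V, f ∈ F -> g ∈ F -> and_code z f g -> z ∈ F) /\
  (forall z n f : V, n ∈ w -> ~ is_empty n -> f ∈ F -> ex_code z n f -> z ∈ F).

Definition is_formula_set {V : structure} (w F : V) : Prop :=
  formula_closed w F /\ forall X : V, formula_closed w X -> F ⊆ X.

(** Assignments of values in [A] to the terms, the constant denoting [c]. *)
Definition is_assignment {V : structure} (w A c s : V) : Prop :=
  is_function s w A /\ forall z : V, is_empty z -> related s z c.

Definition agree_off {V : structure} (w n s s' : V) : Prop :=
  forall i x : V, i ∈ w -> i <> n -> (related s i x <-> related s' i x).

(** [S] is the satisfaction relation of the structure [(A, ∈, c)], i.e. it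
    obeys Tarski's clauses. *)
Definition is_satisfaction {V : structure} (w F A c S : V) : Prop :=
  forall s : V, is_assignment w A c s ->
  (forall z i j : V, i ∈ w -> j ∈ w -> mem_code z i j ->
     (related S z s <->
      exists x y : V, related s i x /\ related s j y /\ x ∈ y)) /\
  (forall z i j : V, i ∈ w -> j ∈ w -> eq_code z i j ->
     (related S z s <-> exists x : V, related s i x /\ related s j x)) /\
  (forall z f : V, f ∈ F -> not_code z f ->
     (related S z s <-> ~ related S f s)) /\
  (forall z f g : V, f ∈ F -> g ∈ F -> and_code z f g ->
     (related S z s <-> related S f s /\ related S g s)) /\
  (forall z n f : V, n ∈ w -> ~ is_empty n -> f ∈ F -> ex_code z n f ->
     (related S z s <->
      exists s' : V, is_assignment w A c s' /\ agree_off w n s s' /\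
        related S f s')).

(** [(A, ∈, c) ⊨ f [s]]. *)
Definition satisfies {V : structure} (A c f s : V) : Prop :=
  exists w F S : V, is_omega w /\ is_formula_set w F /\
    is_satisfaction w F A c S /\ related S f s.

(** [(M, ∈, c) ≺ (H, ∈, c)]; the constant [c] belongs to both. *)
Definition elementary_submodel {V : structure} (M H c : V) : Prop :=
  M ⊆ H /\ c ∈ M /\
  forall w F f s : V, is_omega w -> is_formula_set w F -> f ∈ F ->
    is_assignment w M c s -> (satisfies M c f s <-> satisfies H c f s).

(** ** Properness *)

Definition generic {V : structure} (M P L q : V) : Prop :=
  forall D A : V, open_dense D P L -> D ∈ M -> is_inter A D M ->
    predense_below A P L q.

Definition proper {V : structure} (PP : V) : Prop :=
  exists P L o : V, is_forcing PP P L o /\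
  exists k0 : V, is_cardinal k0 /\
  forall k H M : V, is_cardinal k -> k0 ⊆ k -> is_H H k ->
    countable M -> elementary_submodel M H PP ->
    forall p : V, p ∈ P -> p ∈ M ->
      exists q : V, q ∈ P /\ related L q p /\ generic M P L q.

(** ** The collapse [Col(ω, ω₁)] *)

Definition is_Col_omega_omega1 {V : structure} (PP : V) : Prop :=
  exists w w1 P L o : V, is_omega w /\ is_omega1 w1 /\
    (forall p : V, p ∈ P <-> is_partial_function p w w1 /\ finite p) /\
    (forall z : V, z ∈ L <->
       exists q p : V, q ∈ P /\ p ∈ P /\ p ⊆ q /\ is_pair z q p) /\
    is_empty o /\ is_triple PP P L o.

(* Main.v *)
(** (1) implies (2).  Under DC there is a countable [M ≺ H(κ)] that contains
    every dense set [D_n = {p | n ∈ dom p}] of [Col(ω, ω₁)].  Given a condition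
    [q], choose [n ∉ dom q] and [α < ω₁] outside the countable set
    [{d(n) | d ∈ M}]; then [q ∪ {(n, α)}] is incompatible with every element of
    [D_n ∩ M], so [q] is not [M]-generic.

    (3) implies (1).  A failure of DC gives a set [K] of edges along which one
    can always continue, although no single-valued part of [K] prescribes an
    infinite walk.  This property of [K] is absolute for [H(κ)], so every
    [M ≺ H(κ)] contains such a [K]; but if [M] is countable, then following
    the edge to the least successor in [M] is such a part of [K].  Hence without DC no
    large [H(κ)] has a countable elementary submodel, and every forcing is
    vacuously proper. *)

From Stdlib Require Import Classical ClassicalEpsilon Arith Lia.
Require Import Defs.

Set Implicit Arguments.
Unset Strict Implicit.

(* The model [V] satisfies Separation and Replacement only for first-order formulas, so every
   predicate fed to a scheme must be shown definable; hence the calculus of [dfn] and the search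
   procedure [df]. The operator [epsilon] of the metatheory enters only through [setof], to name
   sets determined by extensionality, so it brings no choice into [V].

   Codes of formulas in [V] may be nonstandard. From (3) to (1) this does no harm, since only a few
   fixed standard formulas are evaluated. From (1) to (2) it is an obstacle: elementarity concerns
   all codes, so satisfaction and the Löwenheim-Skolem construction have to be carried out inside
   [V]. In general H(κ) carries no well-order from which Skolem functions could be defined; the hull
   is therefore the limit of an increasing sequence of finite sequences, each taking care of
   finitely many requirements.

   Since H(κ) is defined through [≤*], the large cardinals needed are Lindenbaum numbers in place of
   Hartogs numbers. *)
Existing Class ZF.

(** * Definability with parameters *)

Definition lift (r : nat -> nat) (n : nat) : nat :=
  match n with O => O | S m => S (r m) end.

Fixpoint rename (r : nat -> nat) (f : formula) : formula :=
  match f with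
  | FMem i j => FMem (r i) (r j)
  | FEq i j => FEq (r i) (r j)
  | FFalse => FFalse
  | FAnd f g => FAnd (rename r f) (rename r g)
  | FOr f g => FOr (rename r f) (rename r g)
  | FImp f g => FImp (rename r f) (rename r g)
  | FAll f => FAll (rename (lift r) f)
  | FEx f => FEx (rename (lift r) f)
  end.

Lemma holds_ext {V : structure} (f : formula) :
  forall e e' : nat -> V, (forall n, e n = e' n) -> holds e f <-> holds e' f.
Proof.
  induction f; simpl; intros e e' E; try rewrite !E; try tauto.
  - rewrite (IHf1 e e' E), (IHf2 e e' E); tauto.
  - rewrite (IHf1 e e' E), (IHf2 e e' E); tauto.
  - rewrite (IHf1 e e' E), (IHf2 e e' E); tauto.
  - assert (Q : forall x, holds (push x e) f <-> holds (push x e') f)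
      by (intro x; apply IHf; intros [|n]; simpl; auto).
    split; intros H x; apply Q, H.
  - assert (Q : forall x, holds (push x e) f <-> holds (push x e') f)
      by (intro x; apply IHf; intros [|n]; simpl; auto).
    split; intros [x H]; exists x; apply Q, H.
Qed.

Lemma holds_rename {V : structure} (f : formula) :
  forall r (e : nat -> V), holds e (rename r f) <-> holds (fun n => e (r n)) f.
Proof.
  induction f; simpl; intros r e; try tauto.
  - rewrite IHf1, IHf2; tauto.
  - rewrite IHf1, IHf2; tauto.
  - rewrite IHf1, IHf2; tauto.
  - assert (Q : forall x, holds (push x e) (rename (lift r) f) <->
                          holds (push x (fun n => e (r n))) f)
      by (intro x; rewrite IHf; apply holds_ext; intros [|n]; reflexivity).
    split; intros H x; apply Q, H.
  - assert (Q : forall x, holds (push x e) (rename (lift r) f) <->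
                          holds (push x (fun n => e (r n))) f)
      by (intro x; rewrite IHf; apply holds_ext; intros [|n]; reflexivity).
    split; intros [x H]; exists x; apply Q, H.
Qed.

(** Variables at even positions, parameters at odd ones. *)
Definition join {A : Type} (e p : nat -> A) (n : nat) : A :=
  if Nat.even n then e (Nat.div2 n) else p (Nat.div2 n).

(** The parameters are hidden under an existential quantifier, so that closure properties need not
    mention them. Interleaving leaves room for infinitely many variables and infinitely many
    parameters at once. *)
Definition dfn {V : structure} (R : (nat -> V) -> Prop) : Prop :=
  exists f p, forall e, holds (join e p) f <-> R e.

(** Terms are handled through their graphs: index 0 holds the value, and the arguments are shifted
    by one. *)
Definition tdf {V : structure} (t : (nat -> V) -> V) : Prop :=
  dfn (fun e => e 0 = t (fun n => e (S n))).

Lemma even_cases n :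
  (Nat.even n = true /\ n = 2 * Nat.div2 n) \/
  (Nat.even n = false /\ n = S (2 * Nat.div2 n)).
Proof.
  destruct (Nat.even n) eqn:E; [left | right]; split; auto.
  - apply Nat.even_spec in E. destruct E as [m ->]. now rewrite Nat.div2_double.
  - assert (O : Nat.odd n = true) by (unfold Nat.odd; now rewrite E).
    apply Nat.odd_spec in O. destruct O as [m ->].
    now rewrite Nat.add_1_r, Nat.div2_succ_double.
Qed.

Lemma join_even {A} (e p : nat -> A) k : join e p (2 * k) = e k.
Proof. unfold join. now rewrite Nat.div2_double, Nat.even_even. Qed.

Lemma join_odd {A} (e p : nat -> A) k : join e p (S (2 * k)) = p k.
Proof.
  unfold join. rewrite Nat.div2_succ_double.
  now rewrite Nat.even_succ, Nat.odd_even.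
Qed.

Section Definability.
Context {V : structure} {hZF : ZF V}.
Implicit Types (R Q : (nat -> V) -> Prop) (t u : (nat -> V) -> V).

Lemma dfn_ext R Q : (forall e, R e <-> Q e) -> dfn R -> dfn Q.
Proof.
  intros E (f & p & H). exists f, p. intro e. now rewrite H.
Qed.

Lemma reparametrize (h : nat -> nat) (f : formula) (p q : nat -> V) :
  (forall k, p k = q (h k)) ->
  exists f', forall e, holds (join e q) f' <-> holds (join e p) f.
Proof.
  intro E.
  exists (rename (fun n => if Nat.even n then n else S (2 * h (Nat.div2 n))) f).
  intro e. rewrite holds_rename. apply holds_ext. intro n.
  destruct (even_cases n) as [[-> Hn]|[Hn' Hn]].
  - rewrite Hn at 1 2. now rewrite !join_even.
  - rewrite Hn'. rewrite Hn at 2. now rewrite !join_odd, E.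
Qed.

(** The two lists of parameters are interleaved by [join] itself, so that a connective can combine
    formulas over a single list. *)
Lemma common_parameters R Q :
  dfn R -> dfn Q ->
  exists f g p, (forall e, holds (join e p) f <-> R e) /\
                (forall e, holds (join e p) g <-> Q e).
Proof.
  intros (f & p & Hf) (g & q & Hg).
  destruct (@reparametrize (fun k => 2 * k) f p (join p q)) as [f' Hf'].
  { intro k. now rewrite join_even. }
  destruct (@reparametrize (fun k => S (2 * k)) g q (join p q)) as [g' Hg'].
  { intro k. now rewrite join_odd. }
  exists f', g', (join p q). split; intro e; [rewrite Hf' | rewrite Hg']; auto.
Qed.

Lemma dfn_and R Q : dfn R -> dfn Q -> dfn (fun e => R e /\ Q e).
Proof.
  intros HR HQ. destruct (common_parameters HR HQ) as (f & g & p & Hf & Hg).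
  exists (FAnd f g), p. intro e. simpl. now rewrite Hf, Hg.
Qed.

Lemma dfn_or R Q : dfn R -> dfn Q -> dfn (fun e => R e \/ Q e).
Proof.
  intros HR HQ. destruct (common_parameters HR HQ) as (f & g & p & Hf & Hg).
  exists (FOr f g), p. intro e. simpl. now rewrite Hf, Hg.
Qed.

Lemma dfn_imp R Q : dfn R -> dfn Q -> dfn (fun e => R e -> Q e).
Proof.
  intros HR HQ. destruct (common_parameters HR HQ) as (f & g & p & Hf & Hg).
  exists (FImp f g), p. intro e. simpl. now rewrite Hf, Hg.
Qed.

Lemma dfn_iff R Q : dfn R -> dfn Q -> dfn (fun e => R e <-> Q e).
Proof. intros. apply dfn_and; now apply dfn_imp. Qed.

(** Excluded middle in the metatheory decides [A], and one of two closed formulas expresses the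
    outcome. Side conditions that do not mention the variables are thus always definable. *)
Lemma dfn_const (A : Prop) : dfn (fun _ : nat -> V => A).
Proof.
  destruct (zf_infinity hZF) as [v _]. destruct (classic A).
  - exists (FImp FFalse FFalse), (fun _ => v). intro e; simpl; tauto.
  - exists FFalse, (fun _ => v). intro e; simpl; tauto.
Qed.

Lemma dfn_rename (h : nat -> nat) R : dfn R -> dfn (fun e => R (fun n => e (h n))).
Proof.
  intros (f & p & H).
  exists (rename (fun n => if Nat.even n then 2 * h (Nat.div2 n) else n) f), p.
  intro e. rewrite <- H, holds_rename. apply holds_ext. intro n.
  destruct (even_cases n) as [[-> Hn]|[Hn' Hn]].
  - rewrite Hn at 2. now rewrite !join_even.
  - rewrite Hn'. rewrite Hn. now rewrite !join_odd.
Qed.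

(** Pushing a bound variable in front of a joined environment exchanges the parities: old variables
    land on odd positions and parameters on even ones. The renaming undoes this. *)
Lemma bind_parameters f (p : nat -> V) :
  exists f', forall e x,
    holds (push x (join e p)) f' <-> holds (join (push x e) p) f.
Proof.
  exists (rename (fun n => match n with
                           | O => O
                           | S m => if Nat.even n then m else S n
                           end) f).
  intros e x. rewrite holds_rename. apply holds_ext. intro n.
  destruct n as [|m]; [reflexivity|].
  destruct (even_cases (S m)) as [[-> Hn]|[-> Hn]].
  - destruct (Nat.div2 (S m)) as [|k]; [discriminate|].
    rewrite Hn, join_even. replace m with (S (2 * k)) by lia. simpl push at 2.
    change (join e p (2 * k) = e k). apply join_even.
  - rewrite Hn. change (join e p (S (2 * Nat.div2 (S m)))
                        = join (push x e) p (S (2 * Nat.div2 (S m)))).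
    now rewrite !join_odd.
Qed.

Lemma dfn_all (R : (nat -> V) -> V -> Prop) :
  dfn (fun e => R (fun n => e (S n)) (e 0)) -> dfn (fun e => forall x, R e x).
Proof.
  intros (f & p & H). destruct (bind_parameters f p) as [f' H'].
  exists (FAll f'), p. intro e. simpl.
  split; intros A x; [apply (H (push x e)), H', A | apply H', (H (push x e)), A].
Qed.

Lemma dfn_ex (R : (nat -> V) -> V -> Prop) :
  dfn (fun e => R (fun n => e (S n)) (e 0)) -> dfn (fun e => exists x, R e x).
Proof.
  intros (f & p & H). destruct (bind_parameters f p) as [f' H'].
  exists (FEx f'), p. intro e. simpl.
  split; intros [x A]; exists x;
    [apply (H (push x e)), H', A | apply H', (H (push x e)), A].
Qed.

Lemma tdf_var k : tdf (fun e : nat -> V => e k).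
Proof.
  destruct (zf_infinity hZF) as [v _].
  exists (FEq 0 (2 * S k)), (fun _ => v). intro e.
  change (join e (fun _ => v) (2 * 0) = join e (fun _ => v) (2 * S k) <->
          e 0 = e (S k)).
  now rewrite !join_even.
Qed.

Lemma tdf_cst c : tdf (fun _ : nat -> V => c).
Proof.
  exists (FEq 0 1), (fun _ => c). intro e.
  change (join e (fun _ => c) (2 * 0) = join e (fun _ => c) (S (2 * 0)) <->
          e 0 = c).
  now rewrite join_even, join_odd.
Qed.

Lemma tdf_rename (h : nat -> nat) t : tdf t -> tdf (fun e => t (fun n => e (h n))).
Proof. exact (@dfn_rename (lift h) (fun e => e 0 = t (fun n => e (S n)))). Qed.

(** Substitution of a definable term, expressed by quantifying over its value. All the [dfn_app] and
    [tdf_app] lemmas reduce to it. *)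
Lemma dfn_let (R : (nat -> V) -> V -> Prop) t :
  tdf t -> dfn (fun e => R (fun n => e (S n)) (e 0)) -> dfn (fun e => R e (t e)).
Proof.
  intros Ht HR. apply (@dfn_ext (fun e => exists x, x = t e /\ R e x)).
  - intro e. split; [intros (x & -> & H); exact H | eauto].
  - apply dfn_ex. now apply dfn_and.
Qed.

Definition def1 (P : V -> Prop) := dfn (fun e => P (e 0)).
Definition def2 (P : V -> V -> Prop) := dfn (fun e => P (e 0) (e 1)).
Definition def3 (P : V -> V -> V -> Prop) := dfn (fun e => P (e 0) (e 1) (e 2)).
Definition def4 (P : V -> V -> V -> V -> Prop) :=
  dfn (fun e => P (e 0) (e 1) (e 2) (e 3)).
Definition def5 (P : V -> V -> V -> V -> V -> Prop) :=
  dfn (fun e => P (e 0) (e 1) (e 2) (e 3) (e 4)).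

Definition tdef1 (f : V -> V) := def2 (fun y a => y = f a).
Definition tdef2 (f : V -> V -> V) := def3 (fun y a b => y = f a b).
Definition tdef3 (f : V -> V -> V -> V) := def4 (fun y a b c => y = f a b c).

Lemma dfn_app1 P t : def1 P -> tdf t -> dfn (fun e => P (t e)).
Proof.
  intros HP Ht. apply (dfn_let (R := fun e x => P x)); auto.
Qed.

Lemma dfn_app2 (P : V -> V -> Prop) t u :
  def2 P -> tdf t -> tdf u -> dfn (fun e => P (t e) (u e)).
Proof.
  intros HP Ht Hu. apply (dfn_let (R := fun e x => P x (u e)) Ht).
  apply (dfn_let (R := fun e x => P (e 0) x) (tdf_rename S Hu)).
  (* The values are pushed one after the other, so the last argument sits at index 0: the renaming
     reverses the order. *)
  exact (dfn_rename (fun n => match n with 0 => 1 | _ => 0 end) HP).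
Qed.

Lemma dfn_app3 (P : V -> V -> V -> Prop) t u v :
  def3 P -> tdf t -> tdf u -> tdf v -> dfn (fun e => P (t e) (u e) (v e)).
Proof.
  intros HP Ht Hu Hv. apply (dfn_let (R := fun e x => P x (u e) (v e)) Ht).
  apply (dfn_let (R := fun e x => P (e 0) x (v _)) (tdf_rename S Hu)).
  apply (dfn_let (R := fun e x => P (e 1) (e 0) x)
           (tdf_rename (fun n => S (S n)) Hv)).
  exact (dfn_rename (fun n => match n with 0 => 2 | 1 => 1 | _ => 0 end) HP).
Qed.

Lemma dfn_app4 (P : V -> V -> V -> V -> Prop) t u v w :
  def4 P -> tdf t -> tdf u -> tdf v -> tdf w ->
  dfn (fun e => P (t e) (u e) (v e) (w e)).
Proof.
  intros HP Ht Hu Hv Hw. apply (dfn_let (R := fun e x => P x (u e) (v e) (w e)) Ht).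
  apply (dfn_let (R := fun e x => P (e 0) x (v _) (w _)) (tdf_rename S Hu)).
  apply (dfn_let (R := fun e x => P (e 1) (e 0) x (w _))
           (tdf_rename (fun n => S (S n)) Hv)).
  apply (dfn_let (R := fun e x => P (e 2) (e 1) (e 0) x)
           (tdf_rename (fun n => S (S (S n))) Hw)).
  exact (dfn_rename
           (fun n => match n with 0 => 3 | 1 => 2 | 2 => 1 | _ => 0 end) HP).
Qed.

Lemma dfn_app5 (P : V -> V -> V -> V -> V -> Prop) t u v w r :
  def5 P -> tdf t -> tdf u -> tdf v -> tdf w -> tdf r ->
  dfn (fun e => P (t e) (u e) (v e) (w e) (r e)).
Proof.
  intros HP Ht Hu Hv Hw Hr.
  apply (dfn_let (R := fun e x => P x (u e) (v e) (w e) (r e)) Ht).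
  apply (dfn_let (R := fun e x => P (e 0) x (v _) (w _) (r _)) (tdf_rename S Hu)).
  apply (dfn_let (R := fun e x => P (e 1) (e 0) x (w _) (r _))
           (tdf_rename (fun n => S (S n)) Hv)).
  apply (dfn_let (R := fun e x => P (e 2) (e 1) (e 0) x (r _))
           (tdf_rename (fun n => S (S (S n))) Hw)).
  apply (dfn_let (R := fun e x => P (e 3) (e 2) (e 1) (e 0) x)
           (tdf_rename (fun n => S (S (S (S n)))) Hr)).
  exact (dfn_rename
    (fun n => match n with 0 => 4 | 1 => 3 | 2 => 2 | 3 => 1 | _ => 0 end) HP).
Qed.

Lemma tdf_app1 f t : tdef1 f -> tdf t -> tdf (fun e => f (t e)).
Proof.
  intros Hf Ht.
  exact (dfn_app2 (P := fun y a => y = f a) (t := fun e => e 0) Hf (tdf_var 0) (tdf_rename S Ht)).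
Qed.

Lemma tdf_app2 (f : V -> V -> V) t u :
  tdef2 f -> tdf t -> tdf u -> tdf (fun e => f (t e) (u e)).
Proof.
  intros Hf Ht Hu.
  exact (dfn_app3 (P := fun y a b => y = f a b) (t := fun e => e 0) Hf (tdf_var 0)
           (tdf_rename S Ht) (tdf_rename S Hu)).
Qed.

Lemma tdf_app3 (f : V -> V -> V -> V) t u v :
  tdef3 f -> tdf t -> tdf u -> tdf v -> tdf (fun e => f (t e) (u e) (v e)).
Proof.
  intros Hf Ht Hu Hv.
  exact (dfn_app4 (P := fun y a b c => y = f a b c) (t := fun e => e 0) Hf (tdf_var 0)
           (tdf_rename S Ht) (tdf_rename S Hu) (tdf_rename S Hv)).
Qed.

Lemma def_mem : def2 (@mem V).
Proof.
  destruct (zf_infinity hZF) as [v _].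
  exists (FMem (2 * 0) (2 * 1)), (fun _ => v). intro e.
  change (join e (fun _ => v) (2 * 0) ∈ join e (fun _ => v) (2 * 1) <->
          e 0 ∈ e 1).
  now rewrite !join_even.
Qed.

Lemma def_eq : def2 (@eq V).
Proof.
  destruct (zf_infinity hZF) as [v _].
  exists (FEq (2 * 0) (2 * 1)), (fun _ => v). intro e.
  change (join e (fun _ => v) (2 * 0) = join e (fun _ => v) (2 * 1) <->
          e 0 = e 1).
  now rewrite !join_even.
Qed.

End Definability.

(* Automation for definability *)
Create HintDb zfdef.
#[global] Hint Resolve def_mem def_eq : zfdef.

(** Syntax-directed: connectives and quantifiers of Rocq become those of [formula], a term without
    variables becomes a parameter, and defined notions are looked up in [zfdef]. *)
Ltac df :=
  lazymatch goal with
  | |- def1 (fun _ => _) => unfold def1; df_beta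
  | |- def2 (fun _ => _) => unfold def2; df_beta
  | |- def3 (fun _ => _) => unfold def3; df_beta
  | |- def4 (fun _ => _) => unfold def4; df_beta
  | |- def5 (fun _ => _) => unfold def5; df_beta
  | |- def1 _ => solve [eauto 3 with zfdef nocore]
  | |- def2 _ => solve [eauto 3 with zfdef nocore]
  | |- def3 _ => solve [eauto 3 with zfdef nocore]
  | |- def4 _ => solve [eauto 3 with zfdef nocore]
  | |- tdef1 _ => unfold tdef1; df
  | |- tdef2 _ => unfold tdef2; df
  | |- tdef3 _ => unfold tdef3; df
  | |- tdf (fun e => e _) => apply tdf_var
  | |- tdf (fun _ => ?c) => apply (tdf_cst c)
  | |- tdf _ =>
      first [ eapply tdf_app3; [ solve [eauto 3 with zfdef nocore] | df | df | df ]
            | eapply tdf_app2; [ solve [eauto 3 with zfdef nocore] | df | df ]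
            | eapply tdf_app1; [ solve [eauto 3 with zfdef nocore] | df ] ]
  | |- dfn (fun _ => ?P) => apply (dfn_const P)
  | |- dfn (fun e => @?P e /\ @?Q e) => apply (@dfn_and _ P Q); df_beta
  | |- dfn (fun e => @?P e \/ @?Q e) => apply (@dfn_or _ P Q); df_beta
  | |- dfn (fun e => @?P e <-> @?Q e) => apply (@dfn_iff _ P Q); df_beta
  | |- dfn (fun e => ~ @?P e) => apply (@dfn_imp _ P (fun _ => False)); df_beta
  | |- dfn (fun e => exists x, @?P e x) => apply (@dfn_ex _ P); df_beta
  | |- dfn (fun e => forall x : carrier _, @?P e x) => apply (@dfn_all _ P); df_beta
  | |- dfn (fun e => @?P e -> @?Q e) => apply (@dfn_imp _ P Q); df_beta
  | |- dfn _ =>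
      first
        [ eapply dfn_app5; [ solve [eauto 3 with zfdef nocore] | df | df | df | df | df ]
        | eapply dfn_app4; [ solve [eauto 3 with zfdef nocore] | df | df | df | df ]
        | eapply dfn_app3; [ solve [eauto 3 with zfdef nocore] | df | df | df ]
        | eapply dfn_app2; [ solve [eauto 3 with zfdef nocore] | df | df ]
        | eapply dfn_app1; [ solve [eauto 3 with zfdef nocore] | df ] ]
  end
with df_beta := cbv beta; df.

(** * Separation and Replacement for definable predicates *)

Section Schemes.
Context {V : structure} {hZF : ZF V}.

Lemma separation (P : V -> Prop) (a : V) :
  def1 P -> exists b, forall x, x ∈ b <-> x ∈ a /\ P x.
Proof.
  intros (f & p & H).
  (* All even positions collapse to the element at index 0, and the parameters move to the positions
     after it. *)
  destruct (zf_separation hZF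
    (rename (fun n => if Nat.even n then 0 else S (Nat.div2 n)) f) p a) as [b Hb].
  exists b. intro x. rewrite Hb, holds_rename, <- (H (fun _ => x)).
  apply and_iff_compat_l, holds_ext. intro n. unfold join.
  destruct (Nat.even n); reflexivity.
Qed.

Lemma replacement (R : V -> V -> Prop) (a : V) :
  def2 R ->
  (forall x y y', x ∈ a -> R x y -> R x y' -> y = y') ->
  exists b, forall y, y ∈ b <-> exists x, x ∈ a /\ R x y.
Proof.
  intros (f & p & H) Hfun.
  (* The axiom has the value at index 0 and the argument at index 1, so the two variables are
     exchanged; the parameters start at index 2. *)
  set (r := fun n => if Nat.even n
                     then match n with 0 => 1 | _ => 0 end
                     else S (S (Nat.div2 n))).
  assert (E : forall x y, holds (push y (push x p)) (rename r f) <-> R x y).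
  { intros x y. rewrite holds_rename.
    rewrite <- (H (fun n => match n with 0 => x | _ => y end)).
    apply holds_ext. intro n. unfold r, join.
    destruct (even_cases n) as [[-> Hn]|[-> Hn]]; [|reflexivity].
    destruct n as [|[|n]]; [reflexivity|discriminate|reflexivity]. }
  destruct (@zf_replacement V hZF (rename r f) p a) as [b Hb].
  - intros x y y' Hx H1 H2. apply E in H1, H2. eauto.
  - exists b. intro y. rewrite Hb. now setoid_rewrite E.
Qed.

End Schemes.

(** * Set-theoretic operations *)

Section Operations.
Context {V : structure} {hZF : ZF V}.
Implicit Types (x y z a b c f u v w : V).

Lemma zf_inhabited : inhabited V.
Proof. destruct (zf_infinity hZF) as [v _]. now constructor. Qed.

(** An arbitrary set when the class [P] is proper. *)
Definition setof (P : V -> Prop) : V :=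
  epsilon zf_inhabited (fun u => forall z, z ∈ u <-> P z).

Lemma in_setof (P : V -> Prop) :
  (exists u, forall z, z ∈ u <-> P z) -> forall z, z ∈ setof P <-> P z.
Proof. intro H. exact (epsilon_spec zf_inhabited _ H). Qed.

Lemma ext x y : (forall z, z ∈ x <-> z ∈ y) -> x = y.
Proof. apply (zf_extensionality hZF). Qed.

(** Extensionality turns an equation with a set-builder term into a first-order condition on
    members; this is how the operations below are seen to be definable. *)
Lemma eq_setof (P : V -> Prop) :
  (forall z, z ∈ setof P <-> P z) -> forall y, y = setof P <-> (forall z, z ∈ y <-> P z).
Proof.
  intros H y. split.
  - intros ->. exact H.
  - intro E. apply ext. intro z. now rewrite E, H.
Qed.

Definition emp : V := setof (fun _ => False).
Definition upair a b : V := setof (fun z => z = a \/ z = b).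
Definition Un x : V := setof (fun z => exists y, y ∈ x /\ z ∈ y).
Definition Pw x : V := setof (fun z => z ⊆ x).
Definition bun a b : V := setof (fun z => z ∈ a \/ z ∈ b).
Definition pr a b : V := upair (upair a a) (upair a b).
Definition sc x : V := setof (fun z => z ∈ x \/ z = x).
Definition adj x a : V := setof (fun z => z ∈ x \/ z = a).
Definition prod a b : V := setof (fun p => exists x y, x ∈ a /\ y ∈ b /\ p = pr x y).
Definition dom f : V := setof (fun x => exists y, pr x y ∈ f).
Definition rng f : V := setof (fun y => exists x, pr x y ∈ f).
Definition img f a : V := setof (fun y => exists x, x ∈ a /\ pr x y ∈ f).
Definition om : V := setof (fun x => forall w, inductive_set w -> x ∈ w).

Lemma in_emp z : ~ z ∈ emp.
Proof.
  unfold emp. rewrite in_setof; [tauto|].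
  destruct zf_inhabited as [v].
  destruct (separation v (P := fun _ => False)) as [b Hb]; [df|].
  exists b. intro t. rewrite Hb. tauto.
Qed.

Lemma in_upair a b z : z ∈ upair a b <-> z = a \/ z = b.
Proof. apply in_setof. exact (zf_pairing hZF a b). Qed.

Lemma in_Un x z : z ∈ Un x <-> exists y, y ∈ x /\ z ∈ y.
Proof. apply in_setof. exact (zf_union hZF x). Qed.

Lemma in_Pw x z : z ∈ Pw x <-> z ⊆ x.
Proof. apply (in_setof (P := fun z => z ⊆ x)). exact (zf_powerset hZF x). Qed.

Lemma in_bun a b z : z ∈ bun a b <-> z ∈ a \/ z ∈ b.
Proof.
  apply (in_setof (P := fun z => z ∈ a \/ z ∈ b)). exists (Un (upair a b)). intro t. rewrite in_Un.
  setoid_rewrite in_upair.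
  split; [intros (y & [-> | ->] & H); auto | intros [H|H]; eauto].
Qed.

Lemma in_adj x a z : z ∈ adj x a <-> z ∈ x \/ z = a.
Proof.
  apply (in_setof (P := fun z => z ∈ x \/ z = a)). exists (bun x (upair a a)). intro t.
  rewrite in_bun, in_upair. tauto.
Qed.

Lemma in_sc x z : z ∈ sc x <-> z ∈ x \/ z = x.
Proof. exact (in_adj x x z). Qed.

Lemma upair_inj a b c d : upair a b = upair c d -> (a = c /\ b = d) \/ (a = d /\ b = c).
Proof.
  intro E.
  assert (H : forall z, (z = a \/ z = b) <-> (z = c \/ z = d))
    by (intro z; rewrite <- !in_upair, E; tauto).
  destruct (proj1 (H a) (or_introl eq_refl)), (proj1 (H b) (or_intror eq_refl)),
    (proj2 (H c) (or_introl eq_refl)), (proj2 (H d) (or_intror eq_refl));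
    subst; auto.
Qed.

Lemma pr_inj a b c d : pr a b = pr c d -> a = c /\ b = d.
Proof.
  intro E. apply upair_inj in E. destruct E as [[E1 E2]|[E1 E2]];
    apply upair_inj in E1; apply upair_inj in E2;
    destruct E1 as [[? ?]|[? ?]], E2 as [[? ?]|[? ?]]; subst; auto.
Qed.

Lemma eq_emp_iff z : z = emp <-> forall x, ~ x ∈ z.
Proof.
  split; [intros ->; exact in_emp|]. intro H. apply ext. intro x.
  split; intro; exfalso; [eapply H; eauto | eapply in_emp; eauto].
Qed.

Lemma def_subset : def2 (@subset V).
Proof. unfold subset. df. Qed.

Lemma def_upair : tdef2 upair.
Proof.
  apply (@dfn_ext V (fun e => forall z, z ∈ e 0 <-> z = e 1 \/ z = e 2)).
  - intro e. symmetry. apply eq_setof, in_upair.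
  - df.
Qed.

Lemma def_Un : tdef1 Un.
Proof.
  apply (@dfn_ext V (fun e => forall z, z ∈ e 0 <-> exists y, y ∈ e 1 /\ z ∈ y)).
  - intro e. symmetry. apply eq_setof, in_Un.
  - df.
Qed.

Hint Resolve def_subset def_upair : zfdef.

Lemma def_Pw : tdef1 Pw.
Proof.
  apply (@dfn_ext V (fun e => forall z, z ∈ e 0 <-> z ⊆ e 1)).
  - intro e. symmetry. apply (eq_setof (P := fun z => z ⊆ e 1)), in_Pw.
  - df.
Qed.

Lemma def_bun : tdef2 bun.
Proof.
  apply (@dfn_ext V (fun e => forall z, z ∈ e 0 <-> z ∈ e 1 \/ z ∈ e 2)).
  - intro e. symmetry. apply (eq_setof (P := fun z => z ∈ e 1 \/ z ∈ e 2)), in_bun.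
  - df.
Qed.

Lemma def_adj : tdef2 adj.
Proof.
  apply (@dfn_ext V (fun e => forall z, z ∈ e 0 <-> z ∈ e 1 \/ z = e 2)).
  - intro e. symmetry. apply (eq_setof (P := fun z => z ∈ e 1 \/ z = e 2)), in_adj.
  - df.
Qed.

Lemma def_sc : tdef1 sc.
Proof.
  apply (@dfn_ext V (fun e => forall z, z ∈ e 0 <-> z ∈ e 1 \/ z = e 1)).
  - intro e. symmetry. apply (eq_setof (P := fun z => z ∈ e 1 \/ z = e 1)), in_sc.
  - df.
Qed.

Lemma def_pr : tdef2 pr.
Proof. unfold pr. df. Qed.

Hint Resolve def_Un def_Pw def_bun def_adj def_sc def_pr : zfdef.

Lemma in_prod a b p : p ∈ prod a b <-> exists x y, x ∈ a /\ y ∈ b /\ p = pr x y.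
Proof.
  revert p. apply in_setof.
  destruct (separation (Pw (Pw (bun a b)))
    (P := fun p => exists x y, x ∈ a /\ y ∈ b /\ p = pr x y)) as [u Hu]; [df|].
  exists u. intro p. rewrite Hu. split; [tauto|]. intro H. split; [|exact H].
  destruct H as (x & y & Hx & Hy & ->). rewrite in_Pw. intros s Hs.
  rewrite in_Pw. unfold pr in Hs. rewrite in_upair in Hs. intros t Ht. rewrite in_bun.
  destruct Hs as [-> | ->]; rewrite in_upair in Ht; destruct Ht; subst; auto.
Qed.

Lemma pr_in_prod a b x y : pr x y ∈ prod a b <-> x ∈ a /\ y ∈ b.
Proof.
  rewrite in_prod. split.
  - intros (x' & y' & Hx & Hy & E). apply pr_inj in E. now destruct E; subst.
  - intros [Hx Hy]. now exists x, y.
Qed.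

Lemma pr_components x y f : pr x y ∈ f -> x ∈ Un (Un f) /\ y ∈ Un (Un f).
Proof.
  intro H. rewrite !in_Un.
  split; exists (upair x y); rewrite in_upair; (split; [|tauto]);
    apply in_Un; exists (pr x y); (split; [exact H|]); apply in_upair; tauto.
Qed.

Lemma in_dom f x : x ∈ dom f <-> exists y, pr x y ∈ f.
Proof.
  revert x. apply in_setof.
  destruct (separation (Un (Un f)) (P := fun x => exists y, pr x y ∈ f)) as [u Hu]; [df|].
  exists u. intro x. rewrite Hu. split; [tauto|]. intros [y H].
  split; [apply (pr_components H) | eauto].
Qed.

Lemma in_rng f y : y ∈ rng f <-> exists x, pr x y ∈ f.
Proof.
  revert y. apply in_setof.
  destruct (separation (Un (Un f)) (P := fun y => exists x, pr x y ∈ f)) as [u Hu]; [df|].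
  exists u. intro x. rewrite Hu. split; [tauto|]. intros [y H].
  split; [apply (pr_components H) | eauto].
Qed.

Lemma in_img f a y : y ∈ img f a <-> exists x, x ∈ a /\ pr x y ∈ f.
Proof.
  revert y. apply in_setof.
  destruct (separation (Un (Un f)) (P := fun y => exists x, x ∈ a /\ pr x y ∈ f))
    as [u Hu]; [df|].
  exists u. intro x. rewrite Hu. split; [tauto|]. intros (y & Hy & H).
  split; [apply (pr_components H) | eauto].
Qed.

Lemma def_dom : tdef1 dom.
Proof.
  apply (@dfn_ext V (fun e => forall x, x ∈ e 0 <-> exists y, pr x y ∈ e 1)).
  - intro e. symmetry. apply eq_setof, in_dom.
  - df.
Qed.

Lemma def_img : tdef2 img.
Proof.
  apply (@dfn_ext V (fun e => forall y, y ∈ e 0 <-> exists x, x ∈ e 2 /\ pr x y ∈ e 1)).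
  - intro e. symmetry. apply eq_setof, in_img.
  - df.
Qed.

Lemma is_upair_iff z a b : is_upair z a b <-> z = upair a b.
Proof. symmetry. apply eq_setof, in_upair. Qed.

Lemma is_pair_iff z a b : is_pair z a b <-> z = pr a b.
Proof.
  unfold is_pair. setoid_rewrite is_upair_iff.
  split; [intros (s & t & -> & -> & ->); reflexivity | intros ->; unfold pr; eauto].
Qed.

Lemma is_triple_iff z a b c : is_triple z a b c <-> z = pr (pr a b) c.
Proof.
  unfold is_triple. setoid_rewrite is_pair_iff.
  split; [intros (p & -> & ->); reflexivity | intros ->; eauto].
Qed.

Lemma related_iff R a b : related R a b <-> pr a b ∈ R.
Proof.
  unfold related. setoid_rewrite is_pair_iff.
  split; [intros (p & -> & H); exact H | eauto].
Qed.

Lemma is_succ_iff y x : is_succ y x <-> y = sc x.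
Proof. symmetry. apply (eq_setof (P := fun z => z ∈ x \/ z = x)), in_sc. Qed.

Lemma is_empty_iff x : is_empty x <-> x = emp.
Proof. symmetry. apply eq_emp_iff. Qed.

Lemma inductive_set_iff w :
  inductive_set w <-> emp ∈ w /\ forall y, y ∈ w -> sc y ∈ w.
Proof.
  unfold inductive_set. setoid_rewrite is_empty_iff. setoid_rewrite is_succ_iff.
  split; intros [H1 H2]; split; intros; subst; eauto.
Qed.

Lemma def_is_empty : def1 (@is_empty V).
Proof. unfold is_empty. df. Qed.

Hint Resolve def_is_empty def_dom def_img : zfdef.

Lemma def_is_upair : def3 (@is_upair V).
Proof. unfold is_upair. df. Qed.
Hint Resolve def_is_upair : zfdef.
Lemma def_is_pair : def3 (@is_pair V).
Proof. unfold is_pair. df. Qed.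
Lemma def_is_succ : def2 (@is_succ V).
Proof. unfold is_succ. df. Qed.
Hint Resolve def_is_pair def_is_succ : zfdef.
Lemma def_related : def3 (@related V).
Proof. unfold related. df. Qed.
Lemma def_inductive_set : def1 (@inductive_set V).
Proof. unfold inductive_set. df. Qed.
Lemma def_transitive_set : def1 (@transitive_set V).
Proof. unfold transitive_set. df. Qed.
Hint Resolve def_related def_inductive_set def_transitive_set : zfdef.
Lemma def_is_ordinal : def1 (@is_ordinal V).
Proof. unfold is_ordinal. df. Qed.
Lemma def_is_relation : def3 (@is_relation V).
Proof. unfold is_relation. df. Qed.
Hint Resolve def_is_relation def_is_ordinal : zfdef.
Lemma def_is_partial_function : def3 (@is_partial_function V).
Proof. unfold is_partial_function. df. Qed.
Hint Resolve def_is_partial_function : zfdef.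
Lemma def_is_function : def3 (@is_function V).
Proof. unfold is_function. df. Qed.
Hint Resolve def_is_function : zfdef.
Lemma def_is_injection : def3 (@is_injection V).
Proof. unfold is_injection. df. Qed.
Lemma def_is_surjection : def3 (@is_surjection V).
Proof. unfold is_surjection. df. Qed.
Hint Resolve def_is_injection def_is_surjection : zfdef.
Lemma def_is_bijection : def3 (@is_bijection V).
Proof. unfold is_bijection. df. Qed.
Lemma def_le_star : def2 (@le_star V).
Proof. unfold le_star. df. Qed.
Lemma def_is_omega : def1 (@is_omega V).
Proof. unfold is_omega. df. Qed.
Hint Resolve def_is_bijection def_le_star def_is_omega : zfdef.
Lemma def_finite : def1 (@finite V).
Proof. unfold finite. df. Qed.
Lemma is_relation_iff f a b : is_relation f a b <-> f ⊆ prod a b.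
Proof.
  unfold is_relation, subset. setoid_rewrite is_pair_iff. setoid_rewrite in_prod.
  reflexivity.
Qed.

Lemma is_partial_function_iff f a b :
  is_partial_function f a b <->
  f ⊆ prod a b /\ forall x y y', pr x y ∈ f -> pr x y' ∈ f -> y = y'.
Proof.
  unfold is_partial_function. rewrite is_relation_iff.
  setoid_rewrite related_iff. reflexivity.
Qed.

Lemma is_function_iff f a b :
  is_function f a b <->
  f ⊆ prod a b /\ (forall x y y', pr x y ∈ f -> pr x y' ∈ f -> y = y') /\
  forall x, x ∈ a -> exists y, pr x y ∈ f.
Proof.
  unfold is_function. rewrite is_partial_function_iff.
  setoid_rewrite related_iff. tauto.
Qed.

Lemma is_injection_iff f a b :
  is_injection f a b <->
  is_function f a b /\ forall x x' y, pr x y ∈ f -> pr x' y ∈ f -> x = x'.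
Proof. unfold is_injection. setoid_rewrite related_iff. reflexivity. Qed.

Lemma is_surjection_iff f a b :
  is_surjection f a b <->
  is_function f a b /\ forall y, y ∈ b -> exists x, pr x y ∈ f.
Proof. unfold is_surjection. setoid_rewrite related_iff. reflexivity. Qed.

Lemma function_value f a b x : is_function f a b -> x ∈ a -> exists y, y ∈ b /\ pr x y ∈ f.
Proof.
  rewrite is_function_iff. intros (H & _ & T) Hx. destruct (T x Hx) as [y Hy].
  exists y. split; auto. apply H, pr_in_prod in Hy. tauto.
Qed.

Lemma partial_function_intro a b (R : V -> V -> Prop) :
  def2 R ->
  (forall x y y', x ∈ a -> y ∈ b -> y' ∈ b -> R x y -> R x y' -> y = y') ->
  exists f, is_partial_function f a b /\
    forall x y, pr x y ∈ f <-> x ∈ a /\ y ∈ b /\ R x y.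
Proof.
  intros HR HF.
  destruct (separation (prod a b) (P := fun p => exists x y, p = pr x y /\ R x y))
    as [f Hf]; [df|].
  assert (E : forall x y, pr x y ∈ f <-> x ∈ a /\ y ∈ b /\ R x y).
  { intros x y. rewrite Hf, pr_in_prod. split.
    - intros [[? ?] (x' & y' & E & ?)]. apply pr_inj in E. destruct E; subst. auto.
    - intros (? & ? & ?). split; eauto. }
  exists f. split; [|exact E]. rewrite is_partial_function_iff. split.
  - intros p Hp. now apply Hf in Hp.
  - intros x y y' H1 H2. apply E in H1, H2. destruct H1 as (? & ? & ?), H2 as (? & ? & ?). eauto.
Qed.

Lemma foundation_on (P : V -> Prop) a :
  def1 P -> (exists x, x ∈ a /\ P x) ->
  exists x, x ∈ a /\ P x /\ forall z, z ∈ a -> P z -> ~ z ∈ x.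
Proof.
  intros HP (x & Hx & Px). destruct (separation a HP) as [b Hb].
  destruct (zf_foundation hZF (x := b)) as (m & Hm & Hmin).
  - exists x. now apply Hb.
  - apply Hb in Hm. destruct Hm. exists m. repeat split; auto.
    intros z Hz Pz. apply Hmin, Hb. auto.
Qed.

Lemma mem_irrefl x : ~ x ∈ x.
Proof.
  intro H. destruct (@foundation_on (fun z => z = x) (upair x x)) as (y & _ & -> & Hm).
  - df.
  - exists x. rewrite in_upair. auto.
  - apply (Hm x); rewrite ?in_upair; auto.
Qed.

Lemma mem_asym x y : x ∈ y -> ~ y ∈ x.
Proof.
  intros H H'. destruct (@foundation_on (fun z => z = x \/ z = y) (upair x y))
    as (m & _ & Hm & Hmin).
  - df.
  - exists x. rewrite in_upair. auto.
  - destruct Hm as [-> | ->]; [apply (Hmin y) | apply (Hmin x)];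
      rewrite ?in_upair; auto.
Qed.

End Operations.

#[global] Hint Resolve def_subset def_upair def_Un def_Pw def_bun def_adj def_sc
  def_pr def_is_empty def_dom def_img def_is_upair def_is_pair
  def_is_succ def_related def_inductive_set def_transitive_set def_is_ordinal
  def_is_relation def_is_partial_function def_is_function def_is_injection
  def_is_surjection def_is_bijection def_le_star def_is_omega def_finite : zfdef.

(** * Natural numbers, ordinals, recursion *)

Section Ordinals.
Context {V : structure} {hZF : ZF V}.
Implicit Types (x y z a b c f u v w n m : V).

Lemma in_om z : z ∈ om <-> forall w, inductive_set w -> z ∈ w.
Proof.
  revert z. apply in_setof. destruct (zf_infinity hZF) as (I & (o & Ho & HoI) & HI).
  assert (II : inductive_set I).
  { split.
    - intros y Hy. apply is_empty_iff in Hy, Ho. now subst.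
    - intros y z Hy Hz. destruct (HI y Hy) as (z' & Hz' & H).
      apply is_succ_iff in Hz, Hz'. now subst. }
  destruct (separation I (P := fun x => forall w, inductive_set w -> x ∈ w)) as [b Hb]; [df|].
  exists b. intro z. rewrite Hb. firstorder.
Qed.

Lemma emp_om : emp ∈ om.
Proof. apply in_om. intros w H. apply inductive_set_iff in H. tauto. Qed.

Lemma sc_om n : n ∈ om -> sc n ∈ om.
Proof.
  intro Hn. apply in_om. intros w H. rewrite in_om in Hn. specialize (Hn w H).
  apply inductive_set_iff in H. destruct H; auto.
Qed.

Lemma om_ind (P : V -> Prop) :
  def1 P -> P emp -> (forall n, n ∈ om -> P n -> P (sc n)) ->
  forall n, n ∈ om -> P n.
Proof.
  intros HP H0 HS n Hn. destruct (separation om HP) as [b Hb].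
  assert (H : n ∈ b); [|apply Hb in H; tauto].
  rewrite in_om in Hn. apply Hn, inductive_set_iff. split.
  - apply Hb. auto using emp_om.
  - intros y Hy. apply Hb in Hy. apply Hb. destruct Hy. auto using sc_om.
Qed.

Lemma is_omega_iff w : is_omega w <-> w = om.
Proof.
  assert (H : is_omega om).
  { split; [apply inductive_set_iff; auto using emp_om, sc_om|].
    intros x Hx z Hz. rewrite in_om in Hz. auto. }
  split; [|intros ->; exact H]. intros [H1 H2]. destruct H as [H3 H4].
  apply ext. intro z. split; [apply H2, H3 | apply H4, H1].
Qed.

Lemma om_cases n : n ∈ om -> n = emp \/ exists m, m ∈ om /\ n = sc m.
Proof.
  revert n. apply om_ind; [df | auto | intros; right; eauto].
Qed.

Lemma ord_transitive a b c : is_ordinal a -> b ∈ a -> c ∈ b -> c ∈ a.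
Proof. intros [H _] Hb Hc. exact (H b Hb c Hc). Qed.

Lemma ord_mem a b : is_ordinal a -> b ∈ a -> is_ordinal b.
Proof.
  intros Ha Hb. pose proof Ha as [T L]. split.
  - intros y Hy z Hz.
    assert (y ∈ a) by exact (ord_transitive Ha Hb Hy).
    assert (Hza : z ∈ a) by exact (T y H z Hz).
    destruct (L z b Hza Hb) as [?|[->|Hbz]]; auto.
    + exfalso. exact (mem_asym Hy Hz).
    (* The cycle [b ∈ z ∈ y ∈ b] contradicts foundation for the set of its three members. *)
    + exfalso. destruct (@foundation_on V hZF (fun t => t = z \/ t = b \/ t = y)
        (adj (upair z b) y)) as (m & _ & Hm & Hmin); [df| |].
      * exists z. rewrite in_adj, in_upair. auto.
      * destruct Hm as [-> | [-> | ->]];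
        [apply (Hmin b) | apply (Hmin y) | apply (Hmin z)];
          rewrite ?in_adj, ?in_upair; auto.
  - intros x y Hx Hy. apply L; eapply ord_transitive; eauto.
Qed.

(** If [c] omits an element of [a], then [c] equals the least omitted one. *)
Lemma transitive_subset_ord a c :
  is_ordinal a -> transitive_set c -> c ⊆ a -> c = a \/ c ∈ a.
Proof.
  intros Ha Tc Hc. destruct (classic (exists x, x ∈ a /\ ~ x ∈ c)) as [H|H].
  - right. apply (@foundation_on V hZF (fun x => ~ x ∈ c) a) in H; [|df].
    destruct H as (m & Hma & Hmc & Hmin).
    replace c with m; auto. apply ext. intro x. split; intro Hx.
    + apply NNPP. intro N. apply (Hmin x); auto. eapply ord_transitive; eauto.
    + destruct Ha as [T L]. destruct (L x m (Hc x Hx) Hma) as [?|[->|?]]; auto.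
      * contradiction.
      * exfalso. apply Hmc. apply (Tc x Hx m H).
  - left. apply ext. intro x. split; [apply Hc|].
    intro Hx. apply NNPP. eauto.
Qed.

(** The intersection is a transitive subset of both ordinals, hence equal to or a member of each; a
    member of both would be a member of itself. *)
Lemma ord_trichotomy a b : is_ordinal a -> is_ordinal b -> a ∈ b \/ a = b \/ b ∈ a.
Proof.
  intros Ha Hb. destruct (separation a (P := fun x => x ∈ b)) as [c Hc]; [df|].
  assert (T : transitive_set c).
  { intros x Hx y Hy. apply Hc in Hx. destruct Hx. apply Hc.
    split; eapply ord_transitive; eauto. }
  destruct (@transitive_subset_ord a c Ha T) as [E1|E1];
    [intros x Hx; now apply Hc in Hx| |];
  (destruct (@transitive_subset_ord b c Hb T) as [E2|E2];
    [intros x Hx; now apply Hc in Hx| |]); subst; auto.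
  exfalso. apply (@mem_irrefl V hZF c). apply Hc. auto.
Qed.

Lemma ord_of_ords a :
  transitive_set a -> (forall x, x ∈ a -> is_ordinal x) -> is_ordinal a.
Proof. intros T H. split; auto. intros x y Hx Hy. apply ord_trichotomy; auto. Qed.

Lemma ord_ind (P : V -> Prop) :
  def1 P -> (forall a, is_ordinal a -> (forall b, b ∈ a -> P b) -> P a) ->
  forall a, is_ordinal a -> P a.
Proof.
  intros HP H a Ha. apply H; auto. intros b Hb. apply NNPP. intro N.
  destruct (@foundation_on V hZF (fun x => ~ P x) a) as (m & Hm & Nm & Hmin);
    [df | eauto |].
  apply Nm, H; [eapply ord_mem; eauto|]. intros x Hx. apply NNPP. intro Nx.
  apply (Hmin x); auto. eapply ord_transitive; eauto.
Qed.

Lemma ord_emp : is_ordinal emp.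
Proof.
  split; [intros x Hx | intros x y Hx]; now apply in_emp in Hx.
Qed.

Lemma ord_sc a : is_ordinal a -> is_ordinal (sc a).
Proof.
  intro Ha. apply ord_of_ords.
  - intros x Hx y Hy. apply in_sc. apply in_sc in Hx. destruct Hx as [Hx | ->]; auto.
    left. eapply ord_transitive; eauto.
  - intros x Hx. apply in_sc in Hx. destruct Hx as [Hx | ->]; auto. eapply ord_mem; eauto.
Qed.

Lemma ord_nat n : n ∈ om -> is_ordinal n.
Proof. revert n. apply om_ind; [df | exact ord_emp | auto using ord_sc]. Qed.

Lemma om_transitive : transitive_set om.
Proof.
  intros n Hn x. revert n Hn. apply (@om_ind (fun n => x ∈ n -> x ∈ om)); [df | |].
  - intro H. now apply in_emp in H.
  - intros n Hn IH H. apply in_sc in H. destruct H as [H | ->]; auto.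
Qed.

Lemma nat_mem n m : n ∈ om -> m ∈ n -> m ∈ om.
Proof. intros; eapply om_transitive; eauto. Qed.

Lemma nat_trans n m k : k ∈ om -> n ∈ m -> m ∈ k -> n ∈ k.
Proof. intros Hk H1 H2. exact (ord_transitive (ord_nat Hk) H2 H1). Qed.

Lemma nat_trichotomy n m : n ∈ om -> m ∈ om -> n ∈ m \/ n = m \/ m ∈ n.
Proof. auto using ord_trichotomy, ord_nat. Qed.

Lemma sc_inj n m : n ∈ om -> sc n = sc m -> n = m.
Proof.
  intros Hn E. assert (H1 : n ∈ sc m) by (rewrite <- E; apply in_sc; auto).
  assert (H2 : m ∈ sc n) by (rewrite E; apply in_sc; auto).
  apply in_sc in H1, H2. destruct H1 as [H1|H1], H2 as [H2|H2]; auto.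
  exfalso. eapply mem_asym; eauto.
Qed.

(** ** Recursion on ordinals *)

Section Recursion.
Context (G : V -> V).

(** Values outside [a] are left free, so an approximation on an ordinal also serves for every
    smaller one without being restricted. *)
Definition approx h a : Prop :=
  (forall x y y', pr x y ∈ h -> pr x y' ∈ h -> y = y') /\
  forall b, b ∈ a -> pr b (G (img h b)) ∈ h.

(** The class function with [ord_rec a = G {ord_rec b | b ∈ a}]. *)
Definition ord_rec a : V :=
  setof (fun z => is_ordinal a /\ exists h y, approx h (sc a) /\ pr a y ∈ h /\ z ∈ y).

Context (HG : tdef1 G).

Lemma def_approx : def2 approx.
Proof. unfold approx. df. Qed.
Hint Resolve def_approx : zfdef.

(** At a least disagreement the earlier values coincide, hence so do the two arguments of [G]. *)
Lemma approx_unique h h' a a' b y y' :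
  transitive_set a -> transitive_set a' -> approx h a -> approx h' a' ->
  b ∈ a -> b ∈ a' -> pr b y ∈ h -> pr b y' ∈ h' -> y = y'.
Proof.
  intros Ta Ta' [F1 A1] [F2 A2] Hb Hb' Hy Hy'.
  rewrite (F1 _ _ _ Hy (A1 b Hb)), (F2 _ _ _ Hy' (A2 b Hb')).
  clear y y' Hy Hy'. apply NNPP. intro N.
  destruct (@foundation_on V hZF (fun b => b ∈ a' /\ G (img h b) <> G (img h' b)) a)
    as (m & Hm & (Hm' & Nm) & Hmin); [df | eauto |].
  apply Nm. f_equal. apply ext. intro y. rewrite !in_img.
  assert (E : forall x, x ∈ m -> G (img h x) = G (img h' x)).
  { intros x Hx. apply NNPP. intro Nx. exact (Hmin x (Ta _ Hm _ Hx) (conj (Ta' _ Hm' _ Hx) Nx) Hx). }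
  split; intros (x & Hx & Hxy); exists x; (split; [exact Hx|]).
  - rewrite (F1 _ _ _ Hxy (A1 x (Ta _ Hm _ Hx))), (E x Hx).
    exact (A2 x (Ta' _ Hm' _ Hx)).
  - rewrite (F2 _ _ _ Hxy (A2 x (Ta' _ Hm' _ Hx))), <- (E x Hx).
    exact (A1 x (Ta _ Hm _ Hx)).
Qed.

Lemma ord_trans_sc a : is_ordinal a -> transitive_set (sc a).
Proof. intro Ha. apply (ord_sc Ha). Qed.

(** By induction on [a]. Replacement collects the values at all [b ∈ a], which are unique, and not
    the approximations themselves, which would have to be chosen. *)
Lemma approx_exists a : is_ordinal a -> exists h, approx h (sc a).
Proof.
  revert a. apply ord_ind; [df|]. intros a Ha IH.
  destruct (@replacement V hZF (fun b p => exists h y, approx h (sc b) /\ pr b y ∈ h /\ p = pr b y) a)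
    as [h0 Hh0]; [df| |].
  { intros b p p' Hb (h & y & Hh & Hy & ->) (h' & y' & Hh' & Hy' & ->). f_equal.
    assert (Tb := ord_trans_sc (ord_mem Ha Hb)).
    eapply (approx_unique Tb Tb Hh Hh'); eauto; apply in_sc; auto. }
  assert (E0 : forall b y, pr b y ∈ h0 <-> b ∈ a /\ exists h, approx h (sc b) /\ pr b y ∈ h).
  { intros b y. rewrite Hh0. split.
    - intros (b' & Hb' & h & y' & Hh & Hy & E). apply pr_inj in E. destruct E; subst. eauto.
    - intros (Hb & h & Hh & Hy). exists b. eauto 7. }
  set (h := adj h0 (pr a (G (img h0 a)))).
  assert (E1 : forall b y, b ∈ a -> (pr b y ∈ h <-> pr b y ∈ h0)).
  { intros b y Hb. unfold h. rewrite in_adj. split; auto. intros [H|H]; auto.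
    apply pr_inj in H. destruct H; subst. exfalso. eapply mem_irrefl; eauto. }
  assert (F0 : forall b y y', pr b y ∈ h0 -> pr b y' ∈ h0 -> y = y').
  { intros b y y' H1 H2. apply E0 in H1, H2. destruct H1 as (Hb & h1 & A1 & H1), H2 as (_ & h2 & A2 & H2).
    assert (Tb := ord_trans_sc (ord_mem Ha Hb)).
    eapply (approx_unique Tb Tb A1 A2); eauto; apply in_sc; auto. }
  exists h. split.
  - intros x y y' H1 H2. destruct (classic (x ∈ a)) as [Hx|Hx].
    + rewrite E1 in H1, H2 by auto. eauto.
    + unfold h in H1, H2. rewrite in_adj in H1, H2.
      destruct H1 as [H1|H1]; [apply E0 in H1; tauto|].
      destruct H2 as [H2|H2]; [apply E0 in H2; tauto|].
      rewrite <- H2 in H1. now apply pr_inj in H1.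
  - intros b Hb. apply in_sc in Hb. destruct Hb as [Hb | ->].
    + rewrite E1 by auto. apply E0. split; auto. destruct (IH b Hb) as [hb Ab].
      exists hb. split; auto.
      (* Below [b] the values of [h] come from various approximations, but by uniqueness they are
         those of the single [hb]. *)
      replace (img h b) with (img hb b); [apply Ab, in_sc; auto|].
      apply ext. intro y. rewrite !in_img.
      assert (Q : forall x, x ∈ b -> (pr x y ∈ hb <-> pr x y ∈ h)).
      { intros x Hx. assert (Hxa : x ∈ a) by (eapply ord_transitive; eauto).
        assert (Tb := ord_trans_sc (ord_mem Ha Hb)).
        assert (Tx := ord_trans_sc (ord_mem Ha Hxa)).
        rewrite E1, E0 by auto. destruct (IH x Hxa) as [hx Ax].
        assert (Hxb : x ∈ sc b) by (apply in_sc; auto).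
        assert (Hxx : x ∈ sc x) by (apply in_sc; auto).
        split.
        - intro H. split; auto. exists hx. split; auto.
          rewrite (approx_unique Tb Tx Ab Ax Hxb Hxx H (proj2 Ax x Hxx)).
          apply Ax, Hxx.
        - intros (_ & h' & A' & H').
          rewrite (approx_unique Tx Tb A' Ab Hxx Hxb H' (proj2 Ab x Hxb)).
          apply Ab, Hxb. }
      split; intros (x & Hx & H); exists x; (split; [exact Hx|]); apply Q; auto.
    + unfold h at 2. rewrite in_adj. right. do 2 f_equal. apply ext. intro y.
      rewrite !in_img. split; intros (x & Hx & H); exists x; (split; [exact Hx|]); apply E1; auto.
Qed.

Lemma ord_rec_value a h y :
  is_ordinal a -> approx h (sc a) -> pr a y ∈ h -> ord_rec a = y.
Proof.
  intros Ha Hh Hy. assert (T := ord_trans_sc Ha).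
  assert (E : forall z, z ∈ y <-> is_ordinal a /\ exists h y, approx h (sc a) /\ pr a y ∈ h /\ z ∈ y).
  { intro z. split; [eauto 7|]. intros (_ & h' & y' & Hh' & Hy' & Hz).
    assert (Hs : a ∈ sc a) by (apply in_sc; auto).
    now rewrite (approx_unique T T Hh Hh' Hs Hs Hy Hy'). }
  apply ext. intro z. unfold ord_rec. rewrite in_setof by eauto. symmetry. apply E.
Qed.

(** Approximations are sets, so the value is described by a first-order formula. Outside the
    ordinals the value is empty, which keeps the description valid for every argument. *)
Lemma def_ord_rec : tdef1 ord_rec.
Proof.
  apply (@dfn_ext V (fun e => forall z, z ∈ e 0 <->
    (is_ordinal (e 1) /\ exists h y, approx h (sc (e 1)) /\ pr (e 1) y ∈ h /\ z ∈ y)));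
    [|df].
  intro e. symmetry. apply eq_setof, in_setof.
  destruct (classic (is_ordinal (e 1))) as [Ha|Ha].
  - destruct (approx_exists Ha) as [h Hh].
    assert (Hs : e 1 ∈ sc (e 1)) by (apply in_sc; auto).
    assert (T := ord_trans_sc Ha).
    exists (G (img h (e 1))). intro z. split.
    + intro Hz. split; auto. exists h. eexists. split; [exact Hh|]. split; [|exact Hz].
      apply Hh, Hs.
    + intros (_ & h' & y' & Hh' & Hy' & Hz).
      now rewrite (approx_unique T T Hh Hh' Hs Hs (proj2 Hh _ Hs) Hy').
  - exists emp. intro z. split; [intro H; now apply in_emp in H | tauto].
Qed.

Lemma ord_rec_eq a z :
  is_ordinal a -> (forall y, y ∈ z <-> exists b, b ∈ a /\ y = ord_rec b) ->
  ord_rec a = G z.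
Proof.
  intros Ha Hz. destruct (approx_exists Ha) as [h Hh].
  assert (Hs : a ∈ sc a) by (apply in_sc; auto).
  rewrite (ord_rec_value Ha Hh (proj2 Hh a Hs)). f_equal.
  apply ext. intro y. rewrite Hz, in_img.
  assert (A : forall b, b ∈ a -> exists h', approx h' (sc b) /\ pr b (G (img h b)) ∈ h').
  { intros b Hb. exists h. split; [split; [apply Hh|]|].
    - intros c Hc. apply Hh. apply in_sc. left. apply in_sc in Hc.
      destruct Hc as [Hc | ->]; auto. eapply ord_transitive; eauto.
    - apply Hh, in_sc. auto. }
  assert (Q : forall b, b ∈ a -> ord_rec b = G (img h b)).
  { intros b Hb. destruct (A b Hb) as (h' & A1 & A2).
    exact (ord_rec_value (ord_mem Ha Hb) A1 A2). }
  split; intros (b & Hb & H); exists b; (split; [exact Hb|]).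
  - rewrite Q by auto. apply (proj1 Hh b); auto. apply Hh, in_sc. auto.
  - subst. rewrite Q by auto. apply Hh, in_sc. auto.
Qed.

End Recursion.

Hint Resolve def_ord_rec : zfdef.

(** * The cumulative hierarchy and transitive closures *)

Lemma class_image (F : V -> V) a :
  tdef1 F -> exists z, forall y, y ∈ z <-> exists b, b ∈ a /\ y = F b.
Proof.
  intro HF. apply (@replacement V hZF (fun b y => y = F b)).
  - df.
  - intros; congruence.
Qed.

(** [W a] is [V_(a+1)]. *)
Definition W : V -> V := ord_rec (fun z => Pw (Un z)).

Lemma def_W_step : tdef1 (fun z : V => Pw (Un z)).
Proof. df. Qed.

Lemma def_W : tdef1 W.
Proof. exact (def_ord_rec def_W_step). Qed.

Lemma in_W a x : is_ordinal a -> (x ∈ W a <-> forall u, u ∈ x -> exists b, b ∈ a /\ u ∈ W b).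
Proof.
  intro Ha. destruct (class_image a def_W) as [z Hz].
  unfold W at 1. rewrite (ord_rec_eq def_W_step Ha Hz), in_Pw.
  unfold subset. setoid_rewrite in_Un. setoid_rewrite Hz.
  split; intros H u Hu.
  - destruct (H u Hu) as (y & (b & Hb & ->) & Hub). eauto.
  - destruct (H u Hu) as (b & Hb & Hub). eauto.
Qed.

Lemma transitive_superset y : exists t, y ⊆ t /\ transitive_set t.
Proof.
  (* [ord_rec] hands over the set of earlier stages: the inner union merges them, and the outer one
     passes to the members of their members. *)
  set (G := fun z => bun y (Un (Un z))).
  assert (HG : tdef1 G) by (unfold G; df).
  assert (HF := def_ord_rec HG). set (F := ord_rec G) in *.
  destruct (class_image om HF) as [z Hz].
  assert (E : forall n x, n ∈ om ->
    (x ∈ F n <-> x ∈ y \/ exists m u, m ∈ n /\ u ∈ F m /\ x ∈ u)).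
  { intros n x Hn. destruct (class_image n HF) as [z' Hz'].
    unfold F at 1. rewrite (ord_rec_eq HG (ord_nat Hn) Hz'). unfold G.
    rewrite in_bun, in_Un. setoid_rewrite in_Un. setoid_rewrite Hz'.
    apply or_iff_compat_l. split.
    - intros (u & (t & (m & Hm & ->) & Hu) & Hx). eauto 6.
    - intros (m & u & Hm & Hu & Hx). exists u. split; auto. exists (F m). eauto. }
  exists (Un z). split.
  - intros x Hx. apply in_Un. exists (F emp). rewrite Hz.
    split; [exists emp; auto using emp_om|]. apply E; auto using emp_om.
  - intros u Hu x Hx. apply in_Un in Hu. destruct Hu as (t & Ht & Hu).
    apply Hz in Ht. destruct Ht as (n & Hn & ->). apply in_Un.
    exists (F (sc n)). rewrite Hz. split; [exists (sc n); auto using sc_om|].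
    apply E; auto using sc_om. right. exists n, u. split; auto. apply in_sc; auto.
Qed.

Lemma tcl_exists y : exists t, is_tcl t y.
Proof.
  destruct (transitive_superset y) as (t & Hy & Ht).
  destruct (separation t (P := fun x => forall u, y ⊆ u -> transitive_set u -> x ∈ u))
    as [b Hb]; [df|].
  exists b. split; [|split].
  - intros x Hx. apply Hb. split; auto.
  - intros x Hx z Hz. apply Hb in Hx. destruct Hx as [Hxt Hx]. apply Hb. split.
    + exact (Ht x Hxt z Hz).
    + intros u Hu Tu. exact (Tu x (Hx u Hu Tu) z Hz).
  - intros u Hu Tu x Hx. apply Hb in Hx. destruct Hx; auto.
Qed.

End Ordinals.
#[global] Hint Resolve def_ord_rec def_W : zfdef.

(** * Finite and countable sets, surjections, [H(κ)] *)

Section Cardinality.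
Context {V : structure} {hZF : ZF V}.
Implicit Types (x y z a b c f g t u v w n m k : V).

Lemma is_bijection_iff f a b :
  is_bijection f a b <->
  f ⊆ prod a b /\ (forall x y y', pr x y ∈ f -> pr x y' ∈ f -> y = y') /\
  (forall x, x ∈ a -> exists y, pr x y ∈ f) /\
  (forall x x' y, pr x y ∈ f -> pr x' y ∈ f -> x = x') /\
  (forall y, y ∈ b -> exists x, pr x y ∈ f).
Proof.
  unfold is_bijection. rewrite is_injection_iff, is_surjection_iff, is_function_iff. tauto.
Qed.

Lemma finite_iff x : finite x <-> exists n f, n ∈ om /\ is_bijection f x n.
Proof.
  unfold finite. setoid_rewrite is_omega_iff. split.
  - intros (w & n & f & -> & H). eauto.
  - intros (n & f & H). eauto.
Qed.

Lemma finite_emp : finite emp.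
Proof.
  apply finite_iff. exists emp, emp. split; [exact emp_om|].
  apply is_bijection_iff. repeat split; [intros x H|intros x y y' H|intros x H|intros x x' y H|intros y H];
    now apply in_emp in H.
Qed.

Lemma adj_same x a : a ∈ x -> adj x a = x.
Proof.
  intro H. apply ext. intro z. rewrite in_adj. split; [intros [?| ->]; auto | auto].
Qed.

Lemma finite_adj x a : finite x -> finite (adj x a).
Proof.
  intro H. destruct (classic (a ∈ x)) as [Ha|Ha]; [now rewrite adj_same|].
  apply finite_iff in H. destruct H as (n & f & Hn & Hf).
  apply is_bijection_iff in Hf. destruct Hf as (S & F & T & I & O).
  apply finite_iff. exists (sc n), (adj f (pr a n)). split; [now apply sc_om|].
  assert (E : forall u v, pr u v ∈ adj f (pr a n) <-> pr u v ∈ f \/ (u = a /\ v = n)).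
  { intros u v. rewrite in_adj. split; intros [?|E]; auto.
    - right. now apply pr_inj in E.
    - destruct E; subst; auto. }
  assert (D : forall u v, pr u v ∈ f -> u <> a /\ v <> n).
  { intros u v Huv. apply S, pr_in_prod in Huv. destruct Huv. split; intros ->; [tauto|].
    eapply mem_irrefl; eauto. }
  apply is_bijection_iff. setoid_rewrite E. split; [|split; [|split; [|split]]].
  - intros p Hp. apply in_adj in Hp. destruct Hp as [Hp | ->].
    + apply S, in_prod in Hp. destruct Hp as (u & v & Hu & Hv & ->).
      apply pr_in_prod. rewrite in_adj, in_sc. auto.
    + apply pr_in_prod. rewrite in_adj, in_sc. auto.
  - intros u v v' [H1|[-> ->]] [H2|[? ->]]; subst; eauto; exfalso;
      [apply D in H1 | apply D in H2]; tauto.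
  - intros u Hu. apply in_adj in Hu. destruct Hu as [Hu | ->]; [|eauto].
    destruct (T u Hu) as [v Hv]. eauto.
  - intros u u' v [H1|[-> ->]] [H2|[-> ?]]; subst; eauto; exfalso;
      [apply D in H1 | apply D in H2]; tauto.
  - intros v Hv. apply in_sc in Hv. destruct Hv as [Hv | ->]; [|eauto].
    destruct (O v Hv) as [u Hu]. eauto.
Qed.

Lemma remove_exists x a : exists y, forall z, z ∈ y <-> z ∈ x /\ z <> a.
Proof. apply (separation x (P := fun z => z <> a)). df. Qed.

Lemma fin_ind (P : V -> Prop) :
  def1 P -> P emp -> (forall x a, finite x -> P x -> P (adj x a)) ->
  forall x, finite x -> P x.
Proof.
  intros HP P0 PS x Hx. apply finite_iff in Hx. destruct Hx as (n & f & Hn & Hf).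
  revert n Hn x f Hf.
  apply (@om_ind V hZF (fun n => forall x f, is_bijection f x n -> P x)); [df | |].
  - intros x f Hf. apply is_bijection_iff in Hf. destruct Hf as (S & _ & T & _).
    replace x with (@emp V hZF); auto. symmetry. apply eq_emp_iff. intros u Hu.
    destruct (T u Hu) as [v Hv]. apply S, pr_in_prod in Hv. destruct Hv as [_ Hv].
    now apply in_emp in Hv.
  - intros n Hn IH x f Hf. apply is_bijection_iff in Hf. destruct Hf as (S & F & T & I & O).
    (* [a] is the element numbered by the largest member [n] of [sc n], so removing it leaves a
       bijection with [n]. *)
    destruct (O n) as [a Ha]; [apply in_sc; auto|].
    destruct (remove_exists x a) as [x' Hx'].
    destruct (remove_exists f (pr a n)) as [f' Hf'].
    assert (Hax : a ∈ x) by (apply S, pr_in_prod in Ha; tauto).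
    replace x with (adj x' a).
    2:{ apply ext. intro z. rewrite in_adj, Hx'. split.
        - intros [[? ?]| ->]; auto.
        - intro. destruct (classic (z = a)); auto. }
    assert (B : is_bijection f' x' n).
    { assert (E : forall u v, pr u v ∈ f' <-> pr u v ∈ f /\ u <> a).
      { intros u v. rewrite Hf'.
        enough (pr u v ∈ f -> (pr u v <> pr a n <-> u <> a)) by tauto. intro Huv. split.
        - intros N ->. apply N. f_equal. eauto.
        - intros N E. apply pr_inj in E. tauto. }
      apply is_bijection_iff. setoid_rewrite E. split; [|split; [|split; [|split]]].
      - intros p Hp. assert (Hp' := Hp). apply Hf' in Hp'. destruct Hp' as [Hp' _].
        apply S, in_prod in Hp'. destruct Hp' as (u & v & Hu & Hv & ->).
        apply E in Hp. destruct Hp as [Hp N]. apply pr_in_prod. rewrite Hx'. split; auto.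
        apply in_sc in Hv. destruct Hv as [?| ->]; auto. exfalso. eauto.
      - intros u v v' [? _] [? _]. eauto.
      - intros u Hu. apply Hx' in Hu. destruct Hu as [Hu N]. destruct (T u Hu). eauto.
      - intros u u' v [? _] [? _]. eauto.
      - intros v Hv. destruct (O v) as [u Hu]; [apply in_sc; auto|].
        exists u. split; auto. intros ->. rewrite (F _ _ _ Ha Hu) in Hv.
        eapply mem_irrefl; eauto. }
    apply PS; [|eapply IH; eauto]. apply finite_iff. eauto.
Qed.

Lemma finite_subset x y : finite x -> y ⊆ x -> finite y.
Proof.
  intros Hx. revert x Hx y.
  apply (@fin_ind (fun x => forall y, y ⊆ x -> finite y)); [df | |].
  - intros y Hy. replace y with (@emp V hZF); [apply finite_emp|].
    symmetry. apply eq_emp_iff. intros u Hu. apply Hy in Hu. now apply in_emp in Hu.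
  - intros x a _ IH y Hy. destruct (remove_exists y a) as [y' Hy'].
    assert (F : finite y').
    { apply IH. intros z Hz. apply Hy' in Hz. destruct Hz as [Hz N].
      apply Hy, in_adj in Hz. tauto. }
    destruct (classic (a ∈ y)) as [Ha|Ha].
    + replace y with (adj y' a); [now apply finite_adj|]. apply ext. intro z.
      rewrite in_adj, Hy'. split.
      * intros [[? ?]| ->]; auto.
      * intro. destruct (classic (z = a)); auto.
    + replace y with y'; auto. apply ext. intro z. rewrite Hy'. split; [tauto|].
      intro. split; auto. intros ->. auto.
Qed.

Lemma finite_image (R : V -> V -> Prop) x y :
  def2 R -> finite x -> (forall v, v ∈ y -> exists u, u ∈ x /\ R u v) ->
  (forall u v v', v ∈ y -> v' ∈ y -> R u v -> R u v' -> v = v') -> finite y.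
Proof.
  intros HR Hx. revert x Hx y.
  apply (@fin_ind (fun x => forall y, (forall v, v ∈ y -> exists u, u ∈ x /\ R u v) ->
    (forall u v v', v ∈ y -> v' ∈ y -> R u v -> R u v' -> v = v') -> finite y));
    [df | |].
  - intros y Hy _. apply (finite_subset finite_emp). intros v Hv.
    destruct (Hy v Hv) as (u & Hu & _). now apply in_emp in Hu.
  - intros x a _ IH y Hy F.
    destruct (separation y (P := fun v => ~ R a v)) as [y' Hy']; [df|].
    assert (Fy' : finite y').
    { apply IH.
      - intros v Hv. apply Hy' in Hv. destruct Hv as [Hv N].
        destruct (Hy v Hv) as (u & Hu & Huv). apply in_adj in Hu.
        destruct Hu as [Hu| ->]; [eauto | contradiction].
      - intros u v v' Hv Hv'. apply Hy' in Hv, Hv'. apply F; tauto. }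
    destruct (classic (exists v0, v0 ∈ y /\ R a v0)) as [(v0 & Hv0 & H0)|N].
    + apply (finite_subset (finite_adj v0 Fy')). intros v Hv. apply in_adj. rewrite Hy'.
      destruct (classic (R a v)); [right; exact (F a v v0 Hv Hv0 H H0) | auto].
    + apply (finite_subset Fy'). intros v Hv. apply Hy'. split; eauto.
Qed.

Lemma finite_bun x y : finite x -> finite y -> finite (bun x y).
Proof.
  intros Hx Hy. revert y Hy. apply (@fin_ind (fun y => finite (bun x y))); [df | |].
  - apply (finite_subset Hx). intros u Hu. apply in_bun in Hu. destruct Hu as [?|H]; auto.
    now apply in_emp in H.
  - intros y a _ IH. apply (finite_subset (finite_adj a IH)).
    intros u. rewrite in_bun, !in_adj, in_bun. tauto.
Qed.

Lemma finite_Pw x : finite x -> finite (Pw x).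
Proof.
  revert x. apply fin_ind; [df | |].
  - apply (finite_subset (finite_adj emp finite_emp)). intros u Hu. apply in_Pw in Hu.
    apply in_adj. right. apply eq_emp_iff. intros v Hv. apply Hu in Hv. now apply in_emp in Hv.
  - intros x a _ IH.
    destruct (@class_image V hZF (fun y => adj y a) (Pw x)) as [z Hz]; [df|].
    apply (@finite_subset (bun (Pw x) z)).
    + apply finite_bun; auto. apply (@finite_image (fun y v => v = adj y a) (Pw x)); auto;
        [df | | intros; congruence].
      intros v Hv. now apply Hz.
    + intros u Hu. apply in_Pw in Hu. apply in_bun. destruct (remove_exists u a) as [u' Hu'].
      assert (P : u' ⊆ x).
      { intros v Hv. apply Hu' in Hv. destruct Hv as [Hv N]. apply Hu, in_adj in Hv. tauto. }
      destruct (classic (a ∈ u)) as [Ha|Ha].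
      * right. apply Hz. exists u'. rewrite in_Pw. split; auto. apply ext. intro v.
        rewrite in_adj, Hu'. split; [|intros [[? _]| ->]; auto].
        intro. destruct (classic (v = a)); auto.
      * left. apply in_Pw. intros v Hv. apply P, Hu'. split; auto. intros ->. auto.
Qed.

(** A bound is carried along as elements are added, by taking maxima; no function choosing an [n]
    for each [u] is formed. *)
Lemma finite_bounded (R : V -> V -> Prop) x :
  def2 R -> (forall n m u, n ∈ om -> m ∈ n -> R m u -> R n u) ->
  finite x -> (forall u, u ∈ x -> exists n, n ∈ om /\ R n u) ->
  exists n, n ∈ om /\ forall u, u ∈ x -> R n u.
Proof.
  intros HR M Hx. revert x Hx.
  apply (@fin_ind (fun x => (forall u, u ∈ x -> exists n, n ∈ om /\ R n u) ->
                       exists n, n ∈ om /\ forall u, u ∈ x -> R n u)); [df | |].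
  - intros _. exists emp. split; [exact emp_om|]. intros u Hu. now apply in_emp in Hu.
  - intros x a _ IH H. destruct IH as (n & Hn & Hnx).
    { intros u Hu. apply H, in_adj. auto. }
    destruct (H a) as (m & Hm & Hma); [apply in_adj; auto|].
    assert (Q : exists k, k ∈ om /\ (n = k \/ n ∈ k) /\ (m = k \/ m ∈ k)).
    { destruct (nat_trichotomy Hn Hm) as [?|[?|?]]; [exists m | exists m | exists n]; auto. }
    destruct Q as (k & Hk & Q1 & Q2). exists k. split; auto.
    intros u Hu. apply in_adj in Hu. destruct Hu as [Hu| ->].
    + destruct Q1 as [->|Q1]; eauto.
    + destruct Q2 as [->|Q2]; eauto.
Qed.

Lemma finite_nat_bounded x : finite x -> x ⊆ om -> exists n, n ∈ om /\ x ⊆ n.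
Proof.
  intros Hx Ho. apply (@finite_bounded (fun n u => u ∈ n)); auto; [df | |].
  - intros n m u Hn Hm Hu. exact (nat_trans Hn Hu Hm).
  - intros u Hu. exists (sc u). split; [apply sc_om; auto | apply in_sc; auto].
Qed.

Lemma finite_nat n : n ∈ om -> finite n.
Proof.
  revert n. apply om_ind; [df | exact finite_emp |].
  intros n _ H. exact (finite_adj n H).
Qed.

Lemma om_least (P : V -> Prop) :
  def1 P -> (exists n, n ∈ om /\ P n) ->
  exists n, n ∈ om /\ P n /\ forall m, m ∈ n -> ~ P m.
Proof.
  intros HP H. destruct (foundation_on HP H) as (n & Hn & Pn & Hm).
  exists n. repeat split; auto. intros m Hmn Pm. apply (Hm m); auto. eapply nat_mem; eauto.
Qed.

(** * Countability and surjective comparison *)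

Lemma countable_iff x : countable x <-> exists f, is_injection f x om.
Proof.
  unfold countable. setoid_rewrite is_omega_iff. split.
  - intros (w & f & -> & H). eauto.
  - intros (f & H). eauto.
Qed.

(** Each element goes to its least index, so it is enough to have a labelling in which elements may
    carry many labels and labels may be idle. *)
Lemma countable_intro (R : V -> V -> Prop) x :
  def2 R -> (forall y, y ∈ x -> exists n, n ∈ om /\ R n y) ->
  (forall n y y', n ∈ om -> y ∈ x -> y' ∈ x -> R n y -> R n y' -> y = y') ->
  countable x.
Proof.
  intros HR T I. apply countable_iff.
  destruct (@partial_function_intro V hZF x om
    (fun y n => R n y /\ forall m, m ∈ n -> ~ R m y)) as (f & Hf & E); [df| |].
  { intros y n n' _ Hn Hn' [H1 L1] [H2 L2].
    destruct (nat_trichotomy Hn Hn') as [H|[H|H]]; auto; exfalso; firstorder. }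
  exists f. apply is_injection_iff. split; [split; auto|].
  - setoid_rewrite related_iff. intros y Hy.
    destruct (@om_least (fun n => R n y)) as (n & Hn & H1 & H2); [df|auto|].
    exists n. apply E. auto.
  - intros y y' n H1 H2. apply E in H1, H2. destruct H1 as (? & ? & ? & _), H2 as (? & ? & ? & _). eauto.
Qed.

Lemma le_star_intro (R : V -> V -> Prop) k t :
  def2 R ->
  (forall x y y', x ∈ t -> y ∈ k -> y' ∈ k -> R x y -> R x y' -> y = y') ->
  (forall y, y ∈ k -> exists x, x ∈ t /\ R x y) -> le_star k t.
Proof.
  intros HR F O. destruct (classic (is_empty k)) as [|N]; [now left|].
  assert (N' : exists y0, y0 ∈ k).
  { apply NNPP. intro N'. apply N. intros y Hy. eauto. }
  destruct N' as [y0 Hy0]. right.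
  (* A surjection has to be total on [t]; elements without a value are sent to the default [y0]. *)
  destruct (@partial_function_intro V hZF t k
    (fun x y => R x y \/ (y = y0 /\ forall y', y' ∈ k -> ~ R x y'))) as (f & Hf & E); [df| |].
  { intros x y y' Hx Hy Hy' [H1|[E1 H1]] [H2|[E2 H2]]; [eauto | | |congruence].
    - destruct (H2 y Hy H1).
    - destruct (H1 y' Hy' H2). }
  exists f. apply is_surjection_iff. split; [split; auto|].
  - setoid_rewrite related_iff. intros x Hx.
    destruct (classic (exists y, y ∈ k /\ R x y)) as [(y & Hy & H)|H].
    + exists y. apply E. auto.
    + exists y0. apply E. repeat split; auto. right. split; eauto.
  - intros y Hy. destruct (O y Hy) as (x & Hx & H). exists x. apply E. auto.
Qed.

Lemma le_star_elim k t :
  le_star k t -> exists f, (forall x y y', pr x y ∈ f -> pr x y' ∈ f -> y = y') /\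
    forall y, y ∈ k -> exists x, x ∈ t /\ pr x y ∈ f.
Proof.
  intros [H|[f H]].
  - exists emp. split; [intros x y y' Hx; now apply in_emp in Hx|].
    intros y Hy. now apply H in Hy.
  - exists f. apply is_surjection_iff in H. destruct H as [H O].
    apply is_function_iff in H. destruct H as (S & F & T). split; auto.
    intros y Hy. destruct (O y Hy) as [x Hx]. exists x. split; auto.
    apply S, pr_in_prod in Hx. tauto.
Qed.

Lemma le_star_mono k k' t t' : k ⊆ k' -> t ⊆ t' -> le_star k' t -> le_star k t'.
Proof.
  intros Hk Ht H. destruct (le_star_elim H) as (f & F & O).
  destruct (separation f (P := fun p => exists x y, p = pr x y /\ x ∈ t)) as [g Hg]; [df|].
  assert (E : forall x y, pr x y ∈ g <-> pr x y ∈ f /\ x ∈ t).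
  { intros x y. rewrite Hg. apply and_iff_compat_l. split; [|eauto].
    intros (x' & y' & E & ?). apply pr_inj in E. destruct E; now subst. }
  apply (@le_star_intro (fun x y => pr x y ∈ g)); [df | |].
  - intros x y y' _ _ _ H1 H2. apply E in H1, H2. destruct H1, H2; eauto.
  - intros y Hy. destruct (O y (Hk y Hy)) as (x & Hx & Hxy). exists x. rewrite E. auto.
Qed.

Lemma le_star_trans k l t : le_star k l -> le_star l t -> le_star k t.
Proof.
  intros H1 H2. destruct (le_star_elim H1) as (f & Ff & Of), (le_star_elim H2) as (g & Fg & Og).
  apply (@le_star_intro (fun x z => exists y, pr x y ∈ g /\ pr y z ∈ f)); [df | |].
  - intros x z z' _ _ _ (y & A & B) (y' & A' & B'). rewrite (Fg _ _ _ A' A) in B'. eauto.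
  - intros z Hz. destruct (Of z Hz) as (y & Hy & A), (Og y Hy) as (x & Hx & B). eauto.
Qed.

Lemma le_star_subset k t : k ⊆ t -> le_star k t.
Proof.
  intro H. apply (@le_star_intro (fun x y => x = y)); [df | congruence |].
  intros y Hy. exists y. auto.
Qed.

Lemma countable_le_star x : countable x <-> le_star x om.
Proof.
  split.
  - intro H. apply countable_iff in H. destruct H as (f & H). apply is_injection_iff in H.
    destruct H as [H I].
    apply (@le_star_intro (fun n y => pr y n ∈ f)); [df | eauto |].
    intros y Hy. exact (function_value H Hy).
  - intro H. destruct (le_star_elim H) as (f & F & O).
    apply (@countable_intro (fun n y => pr n y ∈ f)); [df | auto | eauto].
Qed.

(** The relation on [t] induced by a map [g] onto an ordinal determines [g],
    since [g(x) = {g(y) | y R x}]. *)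
Lemma collapse_unique t a b f g :
  is_ordinal a -> is_ordinal b -> is_surjection f t a -> is_surjection g t b ->
  (forall x y u v u' v', pr x u ∈ f -> pr y v ∈ f -> pr x u' ∈ g -> pr y v' ∈ g ->
     (u ∈ v <-> u' ∈ v')) ->
  a ⊆ b.
Proof.
  intros Ha Hb Hf Hg HR. apply is_surjection_iff in Hf, Hg.
  destruct Hf as [Hf Of], Hg as [Hg Og].
  assert (Hf' := Hf). assert (Hg' := Hg). apply is_function_iff in Hf', Hg'.
  destruct Hf' as (Sf & Ff & _), Hg' as (Sg & Fg & _).
  assert (Q : forall u, u ∈ a -> forall x, pr x u ∈ f -> pr x u ∈ g).
  { intros u Hu. apply NNPP. intro N.
    destruct (@foundation_on V hZF (fun u => ~ forall x, pr x u ∈ f -> pr x u ∈ g) a)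
      as (m & Hm & Nm & Hmin); [df | eauto |].
    apply Nm. intros x Hx.
    assert (Hxt : x ∈ t) by (apply Sf, pr_in_prod in Hx; tauto).
    destruct (function_value Hg Hxt) as (m' & Hm' & Hxm').
    replace m with m'; auto. apply ext. intro v. split; intro Hv.
    - destruct (Og v) as [y Hy]; [eapply ord_transitive; eauto|].
      assert (Hyt : y ∈ t) by (apply Sg, pr_in_prod in Hy; tauto).
      destruct (function_value Hf Hyt) as (v' & Hv' & Hyv').
      assert (Hvm : v' ∈ m) by (apply (HR y x v' m v m'); auto).
      replace v with v'; auto. apply (Fg y); auto. apply NNPP. intro Nv.
      apply (Hmin v'); auto.
    - assert (Hva : v ∈ a) by (eapply ord_transitive; eauto).
      destruct (Of v Hva) as [y Hy]. apply (HR y x v m v m'); auto.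
      apply NNPP. intro Nv. apply (Hmin v); auto. }
  intros u Hu. destruct (Of u Hu) as [x Hx]. specialize (Q u Hu x Hx).
  apply Sg, pr_in_prod in Q. tauto.
Qed.

(** The Lindenbaum number of [t], the least ordinal onto which [t] cannot be mapped: the counterpart
    of the Hartogs number for [≤*]. *)
Definition lindenbaum t : V := setof (fun a => is_ordinal a /\ le_star a t).

(** What needs proof is that these ordinals form a set. A surjection from [t] onto an ordinal pulls
    [∈] back to a relation on [t] that determines the ordinal, so Replacement over [Pw (prod t t)]
    collects them. *)
Lemma in_lind t a : a ∈ lindenbaum t <-> is_ordinal a /\ le_star a t.
Proof.
  revert a. apply (in_setof (P := fun a => is_ordinal a /\ le_star a t)).
  set (Phi := fun r a => is_ordinal a /\ exists f, is_surjection f t a /\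
    forall x y u v, pr x u ∈ f -> pr y v ∈ f -> (pr x y ∈ r <-> u ∈ v)).
  destruct (@replacement V hZF Phi (Pw (prod t t))) as [B HB]; [unfold Phi; df | |].
  { assert (I : forall r a b, Phi r a -> Phi r b -> a ⊆ b).
    { intros r a b (Ha & f & Hf & E1) (Hb & g & Hg & E2).
      apply (@collapse_unique t a b f g); auto.
      intros x y u v u' v' H1 H2 H3 H4. now rewrite <- (E1 x y u v), <- (E2 x y u' v'). }
    intros r a b _ H1 H2. apply ext. intro z. split; eapply I; eauto. }
  (* The empty ordinal is added by hand: [le_star] admits it always, but a nonempty [t] has no
     function onto it. *)
  exists (adj B emp). intro a. rewrite in_adj, HB. split.
  - intros [(r & _ & Ha & f & Hf & _)| ->].
    + split; auto. right. eauto.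
    + split; [apply ord_emp|]. left. intro. apply in_emp.
  - intros [Ha [H|[f Hf]]]; [right; now apply is_empty_iff|left].
    destruct (separation (prod t t) (P := fun p => exists x y u v,
      p = pr x y /\ pr x u ∈ f /\ pr y v ∈ f /\ u ∈ v)) as [r Hr]; [df|].
    exists r. split; [apply in_Pw; intros p Hp; now apply Hr in Hp|].
    split; auto. exists f. split; auto.
    apply is_surjection_iff in Hf. destruct Hf as [Hf _]. apply is_function_iff in Hf.
    destruct Hf as (Sf & Ff & _).
    intros x y u v Hx Hy. rewrite Hr, pr_in_prod. split.
    + intros (_ & x' & y' & u' & v' & E & Hx' & Hy' & H). apply pr_inj in E. destruct E; subst.
      now rewrite (Ff _ _ _ Hx Hx'), (Ff _ _ _ Hy Hy').
    + intro H. split; [|eauto 10]. apply Sf, pr_in_prod in Hx, Hy. tauto.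
Qed.

Lemma ord_lind t : is_ordinal (lindenbaum t).
Proof.
  apply ord_of_ords.
  - intros a Ha b Hb. apply in_lind in Ha. destruct Ha as [Ha Ht]. apply in_lind.
    split; [eapply ord_mem; eauto|]. apply (le_star_mono (k' := a) (t := t)); auto.
    + intros c Hc. eapply ord_transitive; eauto.
    + intros c Hc. exact Hc.
  - intros a Ha. now apply in_lind in Ha.
Qed.

Lemma lind_not_le_star t : ~ le_star (lindenbaum t) t.
Proof.
  intro H. apply (@mem_irrefl V hZF (lindenbaum t)). apply in_lind. split; auto using ord_lind.
Qed.

Lemma cardinal_lind t : is_cardinal (lindenbaum t).
Proof.
  split; [apply ord_lind|]. intros a Ha [f [_ Hf]]. apply in_lind in Ha.
  apply (@lind_not_le_star t). apply le_star_trans with a; [right; eauto | tauto].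
Qed.

Lemma subset_lind t k : is_ordinal k -> k ⊆ t -> k ⊆ lindenbaum t.
Proof.
  intros Hk H a Ha. apply in_lind. split; [eapply ord_mem; eauto|].
  apply le_star_subset. intros b Hb. apply H. eapply ord_transitive; eauto.
Qed.

(** For images of ω countability and [≤*] agree, so the first uncountable ordinal is the Lindenbaum
    number of ω. *)
Lemma omega1_lind : is_omega1 (lindenbaum om).
Proof.
  split; [apply ord_lind|split].
  - rewrite countable_le_star. apply lind_not_le_star.
  - intros a Ha. apply in_lind in Ha. apply countable_le_star. tauto.
Qed.

(** Any transitive superset that does not map onto [k] certifies membership, which spares the
    computation of transitive closures. *)
Lemma in_H H k y :
  is_H H k -> (y ∈ H <-> exists t, y ⊆ t /\ transitive_set t /\ ~ le_star k t).
Proof.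
  intro HH. rewrite (HH y). split.
  - intros (t & (? & ? & _) & N). eauto.
  - intros (t & Hy & Ht & N). destruct (tcl_exists y) as [s Hs]. exists s. split; auto.
    intro L. apply N. apply (le_star_mono (k' := k) (t := s)); auto.
    + intros z Hz. exact Hz.
    + apply Hs; auto.
Qed.

Lemma H_transitive H k : is_H H k -> transitive_set H.
Proof.
  intros HH y Hy z Hz. rewrite in_H in * by eauto. destruct Hy as (t & Hy & Ht & N).
  exists t. split; auto.
Qed.

Lemma H_subset H k x y : is_H H k -> y ∈ H -> x ⊆ y -> x ∈ H.
Proof.
  intros HH Hy Hx. rewrite in_H in * by eauto. destruct Hy as (t & Hy & Ht & N).
  exists t. split; auto. intros z Hz. auto.
Qed.

(** If a transitive set [t] is not covered by the levels below [k], then each of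
    these levels contributes a new element of [t], so [t] maps onto [k]. *)
Lemma small_transitive_in_W k t :
  is_ordinal k -> transitive_set t -> ~ le_star k t ->
  forall x, x ∈ t -> exists a, a ∈ k /\ x ∈ W a.
Proof.
  intros Hk Ht N. apply NNPP. intro M. apply N.
  apply (@le_star_intro (fun x a => x ∈ W a /\ forall b, b ∈ a -> ~ x ∈ W b)); [df | |].
  - intros x a b _ Ha Hb [A1 A2] [B1 B2].
    destruct (proj2 Hk a b Ha Hb) as [H|[H|H]]; auto; exfalso; eauto.
    + exact (B2 a H A1).
    + exact (A2 b H B1).
  - intros a Ha.
    (* An ∈-minimal element of [t] outside the levels below [a] has all its members in those levels,
       hence lies in [W a]. *)
    destruct (@foundation_on V hZF (fun x => forall b, b ∈ a -> ~ x ∈ W b) t)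
      as (x & Hx & Px & Hmin); [df | |].
    + apply NNPP. intro M'. apply M. intros x Hx. apply NNPP. intro Nx. apply M'.
      exists x. split; auto. intros b Hb Hxb. apply Nx. exists b. split; auto.
      exact (ord_transitive Hk Ha Hb).
    + exists x. split; auto. split; auto. apply in_W; [eapply ord_mem; eauto|].
      intros u Hu. apply NNPP. intro Nu. apply (Hmin u); [exact (Ht x Hx u Hu) | | exact Hu].
      intros b Hb Hub. eauto.
Qed.

(** The class is a set because ranks are bounded: every member of H(k) is a subset of the union of
    the levels [W a] with [a ∈ k]. *)
Lemma H_exists k : is_ordinal k -> exists H, is_H H k.
Proof.
  intro Hk. destruct (class_image k (@def_W V hZF)) as [z Hz].
  destruct (separation (Pw (Un z)) (P := fun y => exists t, y ⊆ t /\ transitive_set t /\ ~ le_star k t))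
    as [H HH]; [df|].
  exists H. intro y. rewrite HH. split.
  - intros (_ & t & Hy & Ht & N). destruct (tcl_exists y) as [s Hs]. exists s. split; auto.
    intro L. apply N. apply (le_star_mono (k' := k) (t := s)); auto.
    + intros v Hv. exact Hv.
    + apply Hs; auto.
  - intros (t & (Hy & Ht & _) & N). split; [|eauto]. apply in_Pw. intros x Hx.
    apply in_Un. destruct (small_transitive_in_W Hk Ht N (Hy x Hx)) as (a & Ha & Hxa).
    exists (W a). rewrite Hz. eauto.
Qed.

End Cardinality.

(** * Hereditarily finite sets, codes of formulas, satisfaction *)

Section Formulas.
Context {V : structure} {hZF : ZF V}.
Implicit Types (x y z a b c f g i j t u v w n m s p A Y Z X S : V).

Lemma W_mono a b : is_ordinal a -> b ∈ a -> W b ⊆ W a.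
Proof.
  intros Ha Hb x Hx. rewrite in_W in Hx by (eapply ord_mem; eauto).
  apply in_W; auto. intros u Hu. destruct (Hx u Hu) as (d & Hd & Hud).
  exists d. split; auto. exact (ord_transitive Ha Hb Hd).
Qed.

Lemma in_W_sc n x : is_ordinal n -> (x ∈ W (sc n) <-> x ⊆ W n).
Proof.
  intro Hn. rewrite in_W by now apply ord_sc. split; intros H u Hu.
  - destruct (H u Hu) as (b & Hb & Hub). apply in_sc in Hb. destruct Hb as [Hb | ->]; auto.
    exact (W_mono Hn Hb Hub).
  - exists n. split; auto. apply in_sc. auto.
Qed.

Lemma finite_W n : n ∈ om -> finite (W n).
Proof.
  revert n. apply om_ind; [df | |].
  - apply (finite_subset (finite_adj emp finite_emp)). intros x Hx. apply in_adj. right.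
    apply eq_emp_iff. intros u Hu. rewrite in_W in Hx by apply ord_emp.
    destruct (Hx u Hu) as (b & Hb & _). now apply in_emp in Hb.
  - intros n Hn IH. apply (finite_subset (finite_Pw IH)). intros x Hx. apply in_Pw.
    apply in_W_sc; eauto using ord_nat.
Qed.

(** This is [V_ω]. It contains every code of a formula, which bounds the intersection defining [FF],
    and every requirement met in the Löwenheim-Skolem construction. *)
Definition Vom : V := setof (fun x => exists n, n ∈ om /\ x ∈ W n).

Lemma in_Vom x : x ∈ Vom <-> exists n, n ∈ om /\ x ∈ W n.
Proof.
  revert x. apply in_setof. destruct (class_image om (@def_W V hZF)) as [z Hz].
  exists (Un z). intro x. rewrite in_Un. setoid_rewrite Hz. split.
  - intros (y & (n & Hn & ->) & Hx). eauto.
  - intros (n & Hn & Hx). eauto.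
Qed.

Lemma finite_in_Vom x : finite x -> x ⊆ Vom -> x ∈ Vom.
Proof.
  intros Hx H. apply in_Vom.
  destruct (@finite_bounded V hZF (fun n u => u ∈ W n) x) as (n & Hn & Hnx); auto; [df | | |].
  - intros n m u Hn Hm Hu. exact (W_mono (ord_nat Hn) Hm Hu).
  - intros u Hu. apply in_Vom. auto.
  - exists (sc n). split; [now apply sc_om|]. apply in_W_sc; eauto using ord_nat.
Qed.

Lemma upair_in_Vom a b : a ∈ Vom -> b ∈ Vom -> upair a b ∈ Vom.
Proof.
  intros Ha Hb. apply finite_in_Vom.
  - apply (finite_subset (finite_adj b (finite_adj a finite_emp))). intros u Hu.
    rewrite !in_adj. apply in_upair in Hu. tauto.
  - intros u Hu. apply in_upair in Hu. destruct Hu; now subst.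
Qed.

Lemma pr_in_Vom a b : a ∈ Vom -> b ∈ Vom -> pr a b ∈ Vom.
Proof. intros. apply upair_in_Vom; now apply upair_in_Vom. Qed.

Lemma nat_in_Vom n : n ∈ om -> n ∈ Vom.
Proof.
  intro Hn. enough (n ∈ Vom /\ n ⊆ Vom) by tauto. revert n Hn.
  apply (@om_ind V hZF (fun n => n ∈ Vom /\ n ⊆ Vom)); [df | |].
  - assert (E : @emp V hZF ⊆ Vom) by (intros u Hu; now apply in_emp in Hu).
    split; eauto using finite_in_Vom, finite_emp.
  - intros n Hn [H1 H2].
    assert (E : sc n ⊆ Vom).
    { intros u Hu. apply in_sc in Hu. destruct Hu as [Hu | ->]; auto. }
    split; auto. apply finite_in_Vom; auto. apply finite_nat. now apply sc_om.
Qed.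

(** * Numerals and codes of formulas *)

Fixpoint num (k : nat) : V :=
  match k with O => emp | Datatypes.S k => sc (num k) end.

Lemma num_om (k : nat) : num k ∈ om.
Proof. induction k; simpl; eauto using emp_om, sc_om. Qed.

Lemma num_inj (k l : nat) : num k = num l -> k = l.
Proof.
  revert l. induction k as [|k IH]; intros [|l] E; auto; simpl in E.
  - exfalso. apply (@in_emp V hZF (num l)). rewrite E. apply in_sc. auto.
  - exfalso. apply (@in_emp V hZF (num k)). rewrite <- E. apply in_sc. auto.
  - f_equal. apply IH. apply sc_inj; eauto using num_om.
Qed.

Lemma is_numeral_iff k x : is_numeral k x <-> x = num k.
Proof.
  revert x. induction k as [|k IH]; intro x; simpl; [apply is_empty_iff|].
  setoid_rewrite IH. setoid_rewrite is_succ_iff.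
  split; [intros (y & -> & ->); reflexivity | eauto].
Qed.

Lemma tagged_iff k z x : tagged k z x <-> z = pr (num k) x.
Proof.
  unfold tagged. setoid_rewrite is_numeral_iff. setoid_rewrite is_pair_iff.
  split; [intros (t & -> & ->); reflexivity | eauto].
Qed.

Lemma tagged_pair_iff k z x y : tagged_pair k z x y <-> z = pr (num k) (pr x y).
Proof.
  unfold tagged_pair. setoid_rewrite tagged_iff. setoid_rewrite is_pair_iff.
  split; [intros (t & -> & ->); reflexivity | eauto].
Qed.

Definition cmem i j : V := pr (num 0) (pr i j).
Definition ceq i j : V := pr (num 1) (pr i j).
Definition cnot f : V := pr (num 2) f.
Definition cand f g : V := pr (num 3) (pr f g).
Definition cex n f : V := pr (num 4) (pr n f).

Lemma mem_code_iff z i j : mem_code z i j <-> z = cmem i j.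
Proof. apply tagged_pair_iff. Qed.
Lemma eq_code_iff z i j : eq_code z i j <-> z = ceq i j.
Proof. apply tagged_pair_iff. Qed.
Lemma not_code_iff z f : not_code z f <-> z = cnot f.
Proof. apply tagged_iff. Qed.
Lemma and_code_iff z f g : and_code z f g <-> z = cand f g.
Proof. apply tagged_pair_iff. Qed.
Lemma ex_code_iff z n f : ex_code z n f <-> z = cex n f.
Proof. apply tagged_pair_iff. Qed.

Lemma def_is_numeral k : def1 (@is_numeral V k).
Proof. induction k; simpl; [unfold is_empty|]; df. Qed.
Hint Resolve def_is_numeral : zfdef.
Lemma def_tagged k : def2 (@tagged V k).
Proof. unfold tagged. df. Qed.
Hint Resolve def_tagged : zfdef.
Lemma def_tagged_pair k : def3 (@tagged_pair V k).
Proof. unfold tagged_pair. df. Qed.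
Lemma def_mem_code : def3 (@mem_code V).
Proof. apply def_tagged_pair. Qed.
Lemma def_eq_code : def3 (@eq_code V).
Proof. apply def_tagged_pair. Qed.
Lemma def_and_code : def3 (@and_code V).
Proof. apply def_tagged_pair. Qed.
Lemma def_ex_code : def3 (@ex_code V).
Proof. apply def_tagged_pair. Qed.
Hint Resolve def_mem_code def_eq_code def_and_code def_ex_code : zfdef.
Lemma def_cmem : tdef2 cmem.
Proof. unfold cmem. df. Qed.
Lemma def_ceq : tdef2 ceq.
Proof. unfold ceq. df. Qed.
Lemma def_cand : tdef2 cand.
Proof. unfold cand. df. Qed.
Lemma def_cex : tdef2 cex.
Proof. unfold cex. df. Qed.
Lemma def_formula_closed : def2 (@formula_closed V).
Proof. unfold formula_closed. df. Qed.
Hint Resolve def_cmem def_ceq def_cand def_cex def_formula_closed : zfdef.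
Lemma def_is_formula_set : def2 (@is_formula_set V).
Proof. unfold is_formula_set. df. Qed.
Lemma def_is_assignment : def4 (@is_assignment V).
Proof. unfold is_assignment. df. Qed.
Lemma def_agree_off : def4 (@agree_off V).
Proof. unfold agree_off. df. Qed.
Hint Resolve def_is_formula_set def_is_assignment def_agree_off : zfdef.
Lemma def_is_satisfaction : def5 (@is_satisfaction V).
Proof. unfold is_satisfaction. df. Qed.
Hint Resolve def_is_satisfaction : zfdef.
Lemma def_satisfies : def4 (@satisfies V).
Proof. unfold satisfies. df. Qed.
Hint Resolve def_satisfies : zfdef.

Lemma formula_closed_iff X :
  formula_closed om X <->
  (forall i j, i ∈ om -> j ∈ om -> cmem i j ∈ X) /\
  (forall i j, i ∈ om -> j ∈ om -> ceq i j ∈ X) /\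
  (forall f, f ∈ X -> cnot f ∈ X) /\
  (forall f g, f ∈ X -> g ∈ X -> cand f g ∈ X) /\
  (forall n f, n ∈ om -> n <> emp -> f ∈ X -> cex n f ∈ X).
Proof.
  unfold formula_closed. setoid_rewrite mem_code_iff. setoid_rewrite eq_code_iff.
  setoid_rewrite not_code_iff. setoid_rewrite and_code_iff. setoid_rewrite ex_code_iff.
  setoid_rewrite is_empty_iff.
  split; intros (H1 & H2 & H3 & H4 & H5);
    (split; [|split; [|split; [|split]]]); intros; subst; auto.
  - now apply (H1 _ i j).
  - now apply (H2 _ i j).
  - now apply (H3 _ f).
  - now apply (H4 _ f g).
  - now apply (H5 _ n f).
Qed.

Lemma Vom_formula_closed : formula_closed om Vom.
Proof.
  apply formula_closed_iff. unfold cmem, ceq, cnot, cand, cex.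
  repeat split; intros; repeat apply pr_in_Vom; eauto using nat_in_Vom, num_om.
Qed.

Definition FF : V := setof (fun z => forall X, formula_closed om X -> z ∈ X).

Lemma in_FF z : z ∈ FF <-> forall X, formula_closed om X -> z ∈ X.
Proof.
  revert z. apply in_setof.
  destruct (separation Vom (P := fun z => forall X, formula_closed om X -> z ∈ X)) as [F HF]; [df|].
  exists F. intro z. rewrite HF. split; [tauto|]. split; eauto using Vom_formula_closed.
Qed.

Lemma FF_in_Vom f : f ∈ FF -> f ∈ Vom.
Proof. intro H. rewrite in_FF in H. eauto using Vom_formula_closed. Qed.

Lemma FF_closed : formula_closed om FF.
Proof.
  apply formula_closed_iff. setoid_rewrite in_FF.
  split; [|split; [|split; [|split]]]; intros; match goal with H : formula_closed _ _ |- _ =>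
    pose proof H as K; apply formula_closed_iff in K;
    destruct K as (K1 & K2 & K3 & K4 & K5); auto end.
Qed.

Lemma is_formula_set_iff F : is_formula_set om F <-> F = FF.
Proof.
  split.
  - intros [H1 H2]. apply ext. intro z. split; intro Hz.
    + exact (H2 FF FF_closed z Hz).
    + rewrite in_FF in Hz. auto.
  - intros ->. split; [exact FF_closed|]. intros X HX z Hz. rewrite in_FF in Hz. auto.
Qed.

Lemma cmem_FF i j : i ∈ om -> j ∈ om -> cmem i j ∈ FF.
Proof. apply (proj1 (formula_closed_iff FF) FF_closed). Qed.
Lemma ceq_FF i j : i ∈ om -> j ∈ om -> ceq i j ∈ FF.
Proof. apply (proj1 (formula_closed_iff FF) FF_closed). Qed.
Lemma cnot_FF f : f ∈ FF -> cnot f ∈ FF.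
Proof. apply (proj1 (formula_closed_iff FF) FF_closed). Qed.
Lemma cand_FF f g : f ∈ FF -> g ∈ FF -> cand f g ∈ FF.
Proof. apply (proj1 (formula_closed_iff FF) FF_closed). Qed.
Lemma cex_FF n f : n ∈ om -> n <> emp -> f ∈ FF -> cex n f ∈ FF.
Proof. apply (proj1 (formula_closed_iff FF) FF_closed). Qed.

Lemma FF_ind (P : V -> Prop) :
  def1 P ->
  (forall i j, i ∈ om -> j ∈ om -> P (cmem i j)) ->
  (forall i j, i ∈ om -> j ∈ om -> P (ceq i j)) ->
  (forall f, f ∈ FF -> P f -> P (cnot f)) ->
  (forall f g, f ∈ FF -> g ∈ FF -> P f -> P g -> P (cand f g)) ->
  (forall n f, n ∈ om -> n <> emp -> f ∈ FF -> P f -> P (cex n f)) ->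
  forall f, f ∈ FF -> P f.
Proof.
  intros HP H1 H2 H3 H4 H5 f Hf. destruct (separation FF HP) as [X HX].
  assert (H : f ∈ X); [|apply HX in H; tauto].
  rewrite in_FF in Hf. apply Hf, formula_closed_iff. setoid_rewrite HX.
  repeat split; intros; repeat match goal with H : _ /\ _ |- _ => destruct H end;
    eauto using cmem_FF, ceq_FF, cnot_FF, cand_FF, cex_FF.
Qed.

(** ** Assignments *)

Lemma is_assignment_iff A c s :
  is_assignment om A c s <-> is_function s om A /\ pr emp c ∈ s.
Proof.
  unfold is_assignment. setoid_rewrite is_empty_iff. setoid_rewrite related_iff.
  split; intros [H1 H2]; split; intros; subst; auto.
Qed.

Lemma agree_off_iff n s s' :
  agree_off om n s s' <-> forall i x, i ∈ om -> i <> n -> (pr i x ∈ s <-> pr i x ∈ s').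
Proof. unfold agree_off. setoid_rewrite related_iff. reflexivity. Qed.

Lemma assignment_functional A c s i x y :
  is_assignment om A c s -> pr i x ∈ s -> pr i y ∈ s -> x = y.
Proof.
  rewrite is_assignment_iff, is_function_iff. intros ((_ & F & _) & _). apply F.
Qed.

Lemma assignment_value A c s i :
  is_assignment om A c s -> i ∈ om -> exists x, x ∈ A /\ pr i x ∈ s.
Proof. rewrite is_assignment_iff. intros (H & _). exact (function_value H). Qed.

Lemma assignment_range A c s i x :
  is_assignment om A c s -> pr i x ∈ s -> i ∈ om /\ x ∈ A.
Proof.
  rewrite is_assignment_iff, is_function_iff. intros ((H & _) & _) Hi.
  now apply H, pr_in_prod in Hi.
Qed.

Lemma assignment_mono A B c s : A ⊆ B -> is_assignment om A c s -> is_assignment om B c s.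
Proof.
  intro H. rewrite !is_assignment_iff, !is_function_iff. intros ((H1 & H2 & H3) & H4).
  repeat split; auto. intros p Hp. apply H1, in_prod in Hp.
  destruct Hp as (u & v & Hu & Hv & ->). apply pr_in_prod. auto.
Qed.

Lemma constant_assignment A c : c ∈ A ->
  exists s, is_assignment om A c s /\ forall i, i ∈ om -> pr i c ∈ s.
Proof.
  intro Hc. exists (prod om (upair c c)).
  assert (E : forall i x, pr i x ∈ prod om (upair c c) <-> i ∈ om /\ x = c).
  { intros i x. rewrite pr_in_prod, in_upair. tauto. }
  split; [|intros i Hi; now apply E].
  apply is_assignment_iff. rewrite is_function_iff. repeat split.
  - intros p Hp. apply in_prod in Hp. destruct Hp as (i & x & Hi & Hx & ->).
    apply in_upair in Hx. apply pr_in_prod. split; auto. destruct Hx; now subst.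
  - intros x y y' H1 H2. apply E in H1, H2. destruct H1, H2; now subst.
  - intros i Hi. exists c. now apply E.
  - apply E. eauto using emp_om.
Qed.

(** The index [emp] is excluded because it carries the constant symbol, whose value must remain
    [c]. *)
Lemma update_assignment A c s n x :
  is_assignment om A c s -> n ∈ om -> n <> emp -> x ∈ A ->
  exists s', is_assignment om A c s' /\ agree_off om n s s' /\ pr n x ∈ s'.
Proof.
  intros Hs Hn N Hx. rewrite is_assignment_iff, is_function_iff in Hs.
  destruct Hs as ((H1 & H2 & H3) & H4).
  destruct (separation (prod om A) (P := fun p =>
    (p ∈ s /\ ~ exists y, p = pr n y) \/ p = pr n x)) as [s' Hs']; [df|].
  assert (E : forall i y, pr i y ∈ s' <-> (pr i y ∈ s /\ i <> n) \/ (i = n /\ y = x)).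
  { intros i y. rewrite Hs', pr_in_prod. split.
    - intros [_ [[H N']|H]]; [left|right; now apply pr_inj in H].
      split; auto. intros ->. eauto.
    - intros [[H N']|[-> ->]]; (split; [|auto]).
      + now apply H1, pr_in_prod in H.
      + left. split; auto. intros [z Hz]. apply pr_inj in Hz. tauto.
      + auto. }
  exists s'. split; [|split].
  - apply is_assignment_iff. rewrite is_function_iff. repeat split.
    + intros p Hp. now apply Hs' in Hp.
    + intros i y y' A1 A2. apply E in A1, A2.
      destruct A1 as [[? ?]|[? ?]], A2 as [[? ?]|[? ?]]; subst; eauto; contradiction.
    + intros i Hi. destruct (classic (i = n)) as [->|Ni].
      * exists x. apply E. auto.
      * destruct (H3 i Hi) as [y Hy]. exists y. apply E. auto.
    + apply E. auto.
  - apply agree_off_iff. intros i y Hi Ni. rewrite E. tauto.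
  - apply E. auto.
Qed.

(** ** Existence of the satisfaction relation *)

Section Satisfaction.
Context (A c : V).

Definition Asg : V := setof (fun s => is_assignment om A c s).

Lemma in_Asg s : s ∈ Asg <-> is_assignment om A c s.
Proof.
  revert s. apply (in_setof (P := fun s => is_assignment om A c s)).
  destruct (separation (Pw (prod om A)) (P := fun s => is_assignment om A c s)) as [u Hu]; [df|].
  exists u. intro s. rewrite Hu. split; [tauto|]. intro H. split; auto. apply in_Pw.
  apply is_assignment_iff in H. destruct H as [H _]. now apply is_function_iff in H.
Qed.

Definition asg_where (P : V -> Prop) : V := setof (fun s => s ∈ Asg /\ P s).

Lemma in_asg_where (P : V -> Prop) s : def1 P -> (s ∈ asg_where P <-> s ∈ Asg /\ P s).
Proof.
  intro HP. revert s. apply in_setof. exact (separation Asg HP).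
Qed.

Lemma eq_asg_where (P : V -> Prop) y :
  def1 P -> (y = asg_where P <-> forall s, s ∈ y <-> s ∈ Asg /\ P s).
Proof.
  intro HP. apply eq_setof. intro s. now apply in_asg_where.
Qed.

(** These are Tarski's clauses read as operations on truth sets: the set of assignments satisfying a
    compound formula is computed from those of its parts. *)
Definition Tmem i j : V := asg_where (fun s => exists x y, pr i x ∈ s /\ pr j y ∈ s /\ x ∈ y).
Definition Teq i j : V := asg_where (fun s => exists x, pr i x ∈ s /\ pr j x ∈ s).
Definition Tnot Y : V := asg_where (fun s => ~ s ∈ Y).
Definition Tand Y Z : V := asg_where (fun s => s ∈ Y /\ s ∈ Z).
Definition Tex n Y : V :=
  asg_where (fun s => exists s', is_assignment om A c s' /\ agree_off om n s s' /\ s' ∈ Y).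

Lemma def_Tmem : tdef2 Tmem.
Proof.
  apply (@dfn_ext V (fun e => forall s, s ∈ e 0 <-> s ∈ Asg /\
    exists x y, pr (e 1) x ∈ s /\ pr (e 2) y ∈ s /\ x ∈ y)); [|df].
  intro e. symmetry. apply (@eq_asg_where (fun s => exists x y, pr (e 1) x ∈ s /\ pr (e 2) y ∈ s /\ x ∈ y)). df.
Qed.

Lemma def_Teq : tdef2 Teq.
Proof.
  apply (@dfn_ext V (fun e => forall s, s ∈ e 0 <-> s ∈ Asg /\
    exists x, pr (e 1) x ∈ s /\ pr (e 2) x ∈ s)); [|df].
  intro e. symmetry. apply (@eq_asg_where (fun s => exists x, pr (e 1) x ∈ s /\ pr (e 2) x ∈ s)). df.
Qed.

Lemma def_Tnot : tdef1 Tnot.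
Proof.
  apply (@dfn_ext V (fun e => forall s, s ∈ e 0 <-> s ∈ Asg /\ ~ s ∈ e 1)); [|df].
  intro e. symmetry. apply (@eq_asg_where (fun s => ~ s ∈ e 1)). df.
Qed.

Lemma def_Tand : tdef2 Tand.
Proof.
  apply (@dfn_ext V (fun e => forall s, s ∈ e 0 <-> s ∈ Asg /\ (s ∈ e 1 /\ s ∈ e 2))); [|df].
  intro e. symmetry. apply (@eq_asg_where (fun s => s ∈ e 1 /\ s ∈ e 2)). df.
Qed.

Lemma def_Tex : tdef2 Tex.
Proof.
  apply (@dfn_ext V (fun e => forall s, s ∈ e 0 <-> s ∈ Asg /\
    exists s', is_assignment om A c s' /\ agree_off om (e 1) s s' /\ s' ∈ e 2)); [|df].
  intro e. symmetry.
  apply (@eq_asg_where (fun s => exists s', is_assignment om A c s' /\ agree_off om (e 1) s s' /\ s' ∈ e 2)). df.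
Qed.

Hint Resolve def_Tmem def_Teq def_Tnot def_Tand def_Tex : zfdef.

Definition truth_closed X : Prop :=
  (forall i j, i ∈ om -> j ∈ om -> pr (cmem i j) (Tmem i j) ∈ X) /\
  (forall i j, i ∈ om -> j ∈ om -> pr (ceq i j) (Teq i j) ∈ X) /\
  (forall f Y, pr f Y ∈ X -> pr (cnot f) (Tnot Y) ∈ X) /\
  (forall f g Y Z, pr f Y ∈ X -> pr g Z ∈ X -> pr (cand f g) (Tand Y Z) ∈ X) /\
  (forall n f Y, n ∈ om -> n <> emp -> pr f Y ∈ X -> pr (cex n f) (Tex n Y) ∈ X).

Lemma def_truth_closed : def1 truth_closed.
Proof. unfold truth_closed. df. Qed.
Hint Resolve def_truth_closed : zfdef.

(** The least relation between formulas and sets of assignments that obeys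
    Tarski's clauses; it turns out to be functional. *)
Definition Val : V := setof (fun p => forall X, truth_closed X -> p ∈ X).

Lemma asg_where_subset (P : V -> Prop) : def1 P -> asg_where P ∈ Pw Asg.
Proof. intro HP. apply in_Pw. intros s Hs. apply in_asg_where in Hs; tauto. Qed.

Lemma prod_truth_closed : truth_closed (prod FF (Pw Asg)).
Proof.
  unfold truth_closed. setoid_rewrite pr_in_prod.
  repeat split; intros; repeat match goal with H : _ /\ _ |- _ => destruct H end;
    eauto using cmem_FF, ceq_FF, cnot_FF, cand_FF, cex_FF; apply asg_where_subset; df.
Qed.

Lemma in_Val p : p ∈ Val <-> forall X, truth_closed X -> p ∈ X.
Proof.
  revert p. apply in_setof.
  destruct (separation (prod FF (Pw Asg)) (P := fun p => forall X, truth_closed X -> p ∈ X))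
    as [u Hu]; [df|].
  exists u. intro p. rewrite Hu. split; [tauto|]. split; eauto using prod_truth_closed.
Qed.

Lemma Val_closed : truth_closed Val.
Proof.
  unfold truth_closed. setoid_rewrite in_Val.
  split; [|split; [|split; [|split]]]; intros; match goal with H : truth_closed _ |- _ =>
    pose proof H as K; destruct K as (K1 & K2 & K3 & K4 & K5); auto end.
Qed.

Lemma Val_in_prod f Y : pr f Y ∈ Val -> f ∈ FF /\ Y ⊆ Asg.
Proof.
  intro H. rewrite in_Val in H. specialize (H _ prod_truth_closed).
  now rewrite pr_in_prod, in_Pw in H.
Qed.

Definition Val_inv z Y : Prop :=
  (exists i j, z = cmem i j /\ Y = Tmem i j) \/
  (exists i j, z = ceq i j /\ Y = Teq i j) \/
  (exists f Z, pr f Z ∈ Val /\ z = cnot f /\ Y = Tnot Z) \/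
  (exists f g Z Z', pr f Z ∈ Val /\ pr g Z' ∈ Val /\ z = cand f g /\ Y = Tand Z Z') \/
  (exists n f Z, pr f Z ∈ Val /\ z = cex n f /\ Y = Tex n Z).

(** The pairs in [Val] that arise from one of the clauses already form a truth-closed set, so
    leastness leaves no others. *)
Lemma Val_inversion z Y : pr z Y ∈ Val -> Val_inv z Y.
Proof.
  intro H.
  destruct (separation Val (P := fun p => exists z Y, p = pr z Y /\ Val_inv z Y)) as [X HX];
    [unfold Val_inv; df|].
  assert (E : forall z Y, pr z Y ∈ X <-> pr z Y ∈ Val /\ Val_inv z Y).
  { intros z' Y'. rewrite HX. apply and_iff_compat_l. split; [|eauto].
    intros (z1 & Y1 & E & K). apply pr_inj in E. destruct E; now subst. }
  enough (pr z Y ∈ X) by now apply E.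
  rewrite in_Val in H. apply H.
  destruct Val_closed as (H1 & H2 & H3 & H4 & H5).
  unfold truth_closed. setoid_rewrite E. unfold Val_inv.
  repeat split; intros; repeat match goal with H : _ /\ _ |- _ => destruct H end; auto.
  - left. eauto.
  - right; left. eauto.
  - right; right; left. eauto 6.
  - right; right; right; left. eauto 10.
  - right; right; right; right. eauto 8.
Qed.

Ltac code_inj E :=
  unfold cmem, ceq, cnot, cand, cex in E; apply pr_inj in E;
  let E' := fresh in destruct E as [E' E]; apply num_inj in E'; try discriminate E'; clear E';
  try (apply pr_inj in E; destruct E as [E E']).

(** By induction on the code. Tags separate the five kinds of codes and pairing is injective, so
    inversion leaves a single clause, applied to parts whose truth sets are already unique. *)
Lemma Val_functional f : f ∈ FF ->
  exists Y, pr f Y ∈ Val /\ forall Y', pr f Y' ∈ Val -> Y' = Y.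
Proof.
  destruct Val_closed as (H1 & H2 & H3 & H4 & H5).
  revert f. apply FF_ind; [df | | | | |].
  - intros i j Hi Hj. exists (Tmem i j). split; auto. intros Y HY. apply Val_inversion in HY.
    destruct HY as [(i' & j' & E & ->)|[(i' & j' & E & ->)|[(f & Z & HZ & E & ->)|
      [(f & g & Z & Z' & HZ & HZ' & E & ->)|(n & f & Z & HZ & E & ->)]]]]; code_inj E; now subst.
  - intros i j Hi Hj. exists (Teq i j). split; auto. intros Y HY. apply Val_inversion in HY.
    destruct HY as [(i' & j' & E & ->)|[(i' & j' & E & ->)|[(f & Z & HZ & E & ->)|
      [(f & g & Z & Z' & HZ & HZ' & E & ->)|(n & f & Z & HZ & E & ->)]]]]; code_inj E; now subst.
  - intros f0 Hf0 (Y0 & HY0 & U0). exists (Tnot Y0). split; auto. intros Y HY. apply Val_inversion in HY.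
    destruct HY as [(i' & j' & E & ->)|[(i' & j' & E & ->)|[(f & Z & HZ & E & ->)|
      [(f & g & Z & Z' & HZ & HZ' & E & ->)|(n & f & Z & HZ & E & ->)]]]]; code_inj E; subst.
    now rewrite (U0 Z HZ).
  - intros f0 g0 Hf0 Hg0 (Y0 & HY0 & U0) (Y1 & HY1 & U1). exists (Tand Y0 Y1).
    split; auto. intros Y HY. apply Val_inversion in HY.
    destruct HY as [(i' & j' & E & ->)|[(i' & j' & E & ->)|[(f & Z & HZ & E & ->)|
      [(f & g & Z & Z' & HZ & HZ' & E & ->)|(n & f & Z & HZ & E & ->)]]]]; code_inj E; subst.
    now rewrite (U0 Z HZ), (U1 Z' HZ').
  - intros n0 f0 Hn0 N0 Hf0 (Y0 & HY0 & U0). exists (Tex n0 Y0).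
    split; auto. intros Y HY. apply Val_inversion in HY.
    destruct HY as [(i' & j' & E & ->)|[(i' & j' & E & ->)|[(f & Z & HZ & E & ->)|
      [(f & g & Z & Z' & HZ & HZ' & E & ->)|(n & f & Z & HZ & E & ->)]]]]; code_inj E; subst.
    now rewrite (U0 Z HZ).
Qed.

Lemma is_satisfaction_iff S :
  is_satisfaction om FF A c S <-> forall s, is_assignment om A c s ->
  (forall i j, i ∈ om -> j ∈ om ->
     (pr (cmem i j) s ∈ S <-> exists x y, pr i x ∈ s /\ pr j y ∈ s /\ x ∈ y)) /\
  (forall i j, i ∈ om -> j ∈ om ->
     (pr (ceq i j) s ∈ S <-> exists x, pr i x ∈ s /\ pr j x ∈ s)) /\
  (forall f, f ∈ FF -> (pr (cnot f) s ∈ S <-> ~ pr f s ∈ S)) /\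
  (forall f g, f ∈ FF -> g ∈ FF ->
     (pr (cand f g) s ∈ S <-> pr f s ∈ S /\ pr g s ∈ S)) /\
  (forall n f, n ∈ om -> n <> emp -> f ∈ FF ->
     (pr (cex n f) s ∈ S <->
      exists s', is_assignment om A c s' /\ agree_off om n s s' /\ pr f s' ∈ S)).
Proof.
  unfold is_satisfaction. setoid_rewrite mem_code_iff. setoid_rewrite eq_code_iff.
  setoid_rewrite not_code_iff. setoid_rewrite and_code_iff. setoid_rewrite ex_code_iff.
  setoid_rewrite is_empty_iff. setoid_rewrite related_iff.
  split; intros H s Hs; specialize (H s Hs); destruct H as (H1 & H2 & H3 & H4 & H5);
    (split; [|split; [|split; [|split]]]); intros; subst; auto.
Qed.

Lemma satisfaction_exists : exists S, is_satisfaction om FF A c S.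
Proof.
  (* The satisfaction relation pairs each code with the members of its truth set. *)
  destruct (separation (prod FF Asg) (P := fun p =>
    exists f s Y, p = pr f s /\ pr f Y ∈ Val /\ s ∈ Y)) as [S HS]; [df|].
  assert (E : forall f Y s, pr f Y ∈ Val -> (pr f s ∈ S <-> s ∈ Y)).
  { intros f Y s HY. assert (Hf := Val_in_prod HY). destruct Hf as [Hf HA].
    destruct (Val_functional Hf) as (Y0 & HY0 & U). rewrite (U Y HY).
    rewrite HS, pr_in_prod. split.
    - intros (_ & f' & s' & Y' & E & HY' & Hs). apply pr_inj in E. destruct E; subst.
      now rewrite <- (U Y' HY').
    - intro Hs. split; [|eauto 6]. split; auto. apply Val_in_prod in HY0. apply HY0, Hs. }
  exists S. apply is_satisfaction_iff. intros s Hs.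
  destruct Val_closed as (H1 & H2 & H3 & H4 & H5). apply in_Asg in Hs.
  split; [|split; [|split; [|split]]].
  - intros i j Hi Hj. rewrite (E _ _ s (H1 i j Hi Hj)). unfold Tmem.
    rewrite in_asg_where by df. tauto.
  - intros i j Hi Hj. rewrite (E _ _ s (H2 i j Hi Hj)). unfold Teq.
    rewrite in_asg_where by df. tauto.
  - intros f Hf. destruct (Val_functional Hf) as (Y & HY & _).
    rewrite (E _ _ s (H3 f Y HY)), (E _ _ s HY). unfold Tnot.
    rewrite in_asg_where by df. tauto.
  - intros f g Hf Hg. destruct (Val_functional Hf) as (Y & HY & _), (Val_functional Hg) as (Z & HZ & _).
    rewrite (E _ _ s (H4 f g Y Z HY HZ)), (E _ _ s HY), (E _ _ s HZ). unfold Tand.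
    rewrite in_asg_where by df. tauto.
  - intros n f Hn N Hf. destruct (Val_functional Hf) as (Y & HY & _).
    rewrite (E _ _ s (H5 n f Y Hn N HY)). unfold Tex.
    rewrite in_asg_where by df. setoid_rewrite (fun s => E f Y s HY). tauto.
Qed.

Lemma satisfaction_unique S S' :
  is_satisfaction om FF A c S -> is_satisfaction om FF A c S' ->
  forall f, f ∈ FF -> forall s, is_assignment om A c s -> (pr f s ∈ S <-> pr f s ∈ S').
Proof.
  intros H H'. rewrite is_satisfaction_iff in H, H'.
  apply (@FF_ind (fun f => forall s, is_assignment om A c s -> (pr f s ∈ S <-> pr f s ∈ S')));
    [df | intros i j Hi Hj | intros i j Hi Hj | intros f Hf IH | intros f g Hf Hg IH1 IH2
    | intros n f Hn N Hf IH ]; intros s Hs;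
    destruct (H s Hs) as (H1 & H2 & H3 & H4 & H5), (H' s Hs) as (K1 & K2 & K3 & K4 & K5).
  - rewrite H1, K1 by auto. tauto.
  - rewrite H2, K2 by auto. tauto.
  - rewrite H3, K3, IH by auto. tauto.
  - rewrite H4, K4, IH1, IH2 by auto. tauto.
  - rewrite H5, K5 by auto. split; intros (s' & Hs' & Ha & Hf'); exists s'; split; auto; split; auto;
      now apply IH.
Qed.

(** [satisfies] asks for some satisfaction relation; since any two agree on codes and assignments,
    each of them decides it. *)
Lemma satisfies_iff S f s :
  is_satisfaction om FF A c S -> f ∈ FF -> is_assignment om A c s ->
  (satisfies A c f s <-> pr f s ∈ S).
Proof.
  intros HS Hf Hs. unfold satisfies. split.
  - intros (w & F & S' & Hw & HF & HS' & H). apply is_omega_iff in Hw. subst.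
    apply is_formula_set_iff in HF. subst. apply related_iff in H.
    now apply (satisfaction_unique HS HS').
  - intro H. exists om, FF, S. rewrite is_omega_iff, is_formula_set_iff, related_iff. auto.
Qed.

(** * Tarski's clauses for [satisfies] *)

Lemma sat_mem i j s : is_assignment om A c s -> i ∈ om -> j ∈ om ->
  (satisfies A c (cmem i j) s <-> exists x y, pr i x ∈ s /\ pr j y ∈ s /\ x ∈ y).
Proof.
  intro Hs. intros. destruct satisfaction_exists as [S HS].
  rewrite (satisfies_iff HS) by eauto using cmem_FF.
  rewrite is_satisfaction_iff in HS. destruct (HS s Hs) as (K1 & K2 & K3 & K4 & K5). auto.
Qed.

Lemma sat_eq i j s : is_assignment om A c s -> i ∈ om -> j ∈ om ->
  (satisfies A c (ceq i j) s <-> exists x, pr i x ∈ s /\ pr j x ∈ s).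
Proof.
  intro Hs. intros. destruct satisfaction_exists as [S HS].
  rewrite (satisfies_iff HS) by eauto using ceq_FF.
  rewrite is_satisfaction_iff in HS. destruct (HS s Hs) as (K1 & K2 & K3 & K4 & K5). auto.
Qed.

Lemma sat_not f s : is_assignment om A c s -> f ∈ FF ->
  (satisfies A c (cnot f) s <-> ~ satisfies A c f s).
Proof.
  intro Hs. intros. destruct satisfaction_exists as [S HS].
  rewrite !(satisfies_iff HS) by eauto using cnot_FF.
  rewrite is_satisfaction_iff in HS. destruct (HS s Hs) as (K1 & K2 & K3 & K4 & K5). auto.
Qed.

Lemma sat_and f g s : is_assignment om A c s -> f ∈ FF -> g ∈ FF ->
  (satisfies A c (cand f g) s <-> satisfies A c f s /\ satisfies A c g s).
Proof.
  intro Hs. intros. destruct satisfaction_exists as [S HS].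
  rewrite !(satisfies_iff HS) by eauto using cand_FF.
  rewrite is_satisfaction_iff in HS. destruct (HS s Hs) as (K1 & K2 & K3 & K4 & K5). auto.
Qed.

Lemma sat_ex n f s : is_assignment om A c s -> n ∈ om -> n <> emp -> f ∈ FF ->
  (satisfies A c (cex n f) s <->
   exists s', is_assignment om A c s' /\ agree_off om n s s' /\ satisfies A c f s').
Proof.
  intro Hs. intros. destruct satisfaction_exists as [S HS].
  rewrite !(satisfies_iff HS) by eauto using cex_FF.
  assert (HS' := HS). rewrite is_satisfaction_iff in HS'.
  transitivity (exists s', is_assignment om A c s' /\ agree_off om n s s' /\ pr f s' ∈ S);
    [destruct (HS' s Hs) as (K1 & K2 & K3 & K4 & K5); auto|].
  split; intros (s' & Hs' & Ha & Hf'); exists s'; split; auto; split; auto;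
    now apply (satisfies_iff HS).
Qed.

End Satisfaction.
End Formulas.

#[global] Hint Resolve def_is_numeral def_tagged def_mem_code def_eq_code def_and_code
  def_ex_code def_cmem def_ceq def_cand def_cex
  def_formula_closed def_is_formula_set def_is_assignment def_agree_off
  def_is_satisfaction def_satisfies : zfdef.

(** * Elementary submodels and standard formulas *)

Section Coding.
Context {V : structure} {hZF : ZF V}.
Implicit Types (x y z a b c f g t u v w m s p A K M H : V).

Definition upd (e : nat -> V) (n : nat) (x : V) (k : nat) : V :=
  if Nat.eqb k n then x else e k.

(** The internal assignment also has values at nonstandard indices; only the standard ones are
    compared with the external environment. *)
Definition realizes s (e : nat -> V) : Prop := forall k, pr (num k) (e k) ∈ s.

(** The code is chosen before the structure [A], so one and the same formula is evaluated in [M] and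
    in [H]. Unlike in [dfn], index 0 is reserved for the constant, and quantifiers range over
    [A]. *)
Definition coded (R : V -> (nat -> V) -> Prop) : Prop :=
  exists f, f ∈ FF /\ forall A c s e, is_assignment om A c s -> realizes s e ->
    (satisfies A c f s <-> R A e).

Lemma coded_ext (R Q : V -> (nat -> V) -> Prop) :
  (forall A e, R A e <-> Q A e) -> coded R -> coded Q.
Proof.
  intros E (f & Hf & H). exists f. split; auto. intros A c s e Hs He.
  rewrite <- E. eauto.
Qed.

Lemma coded_mem i j : coded (fun A e => e i ∈ e j).
Proof.
  exists (cmem (num i) (num j)). split; [apply cmem_FF; apply num_om|].
  intros A c s e Hs He. rewrite sat_mem by eauto using num_om. split.
  - intros (x & y & Hx & Hy & H).
    now rewrite (assignment_functional Hs (He i) Hx), (assignment_functional Hs (He j) Hy).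
  - intro H. exists (e i), (e j). auto.
Qed.

Lemma coded_eq i j : coded (fun A e => e i = e j).
Proof.
  exists (ceq (num i) (num j)). split; [apply ceq_FF; apply num_om|].
  intros A c s e Hs He. rewrite sat_eq by eauto using num_om. split.
  - intros (x & Hx & Hy).
    now rewrite (assignment_functional Hs (He i) Hx), (assignment_functional Hs (He j) Hy).
  - intro H. exists (e i). split; auto. rewrite H. auto.
Qed.

Lemma coded_not (R : V -> (nat -> V) -> Prop) : coded R -> coded (fun A e => ~ R A e).
Proof.
  intros (f & Hf & H). exists (cnot f). split; [now apply cnot_FF|].
  intros A c s e Hs He. rewrite sat_not by auto. now rewrite (H A c s e).
Qed.

Lemma coded_and (R Q : V -> (nat -> V) -> Prop) :
  coded R -> coded Q -> coded (fun A e => R A e /\ Q A e).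
Proof.
  intros (f & Hf & H) (g & Hg & H'). exists (cand f g). split; [now apply cand_FF|].
  intros A c s e Hs He. rewrite sat_and by auto. now rewrite (H A c s e), (H' A c s e).
Qed.

Lemma coded_imp (R Q : V -> (nat -> V) -> Prop) :
  coded R -> coded Q -> coded (fun A e => R A e -> Q A e).
Proof.
  intros HR HQ. apply (@coded_ext (fun A e => ~ (R A e /\ ~ Q A e))).
  - intros A e. tauto.
  - auto using coded_not, coded_and.
Qed.

Lemma coded_or (R Q : V -> (nat -> V) -> Prop) :
  coded R -> coded Q -> coded (fun A e => R A e \/ Q A e).
Proof.
  intros HR HQ. apply (@coded_ext (fun A e => ~ (~ R A e /\ ~ Q A e))).
  - intros A e. tauto.
  - auto using coded_not, coded_and.
Qed.

Lemma realizes_update A c s s' e n x :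
  is_assignment om A c s -> is_assignment om A c s' -> realizes s e ->
  agree_off om (num n) s s' -> pr (num n) x ∈ s' -> realizes s' (upd e n x).
Proof.
  intros Hs Hs' He Ha Hx k. unfold upd. destruct (Nat.eqb_spec k n) as [->|N]; auto.
  rewrite agree_off_iff in Ha. apply Ha; auto using num_om.
  intro E. apply N. exact (num_inj E).
Qed.

Lemma num_not_emp (n : nat) : n <> 0 -> num n <> emp.
Proof. intros N E. apply N. exact (@num_inj V hZF n 0 E). Qed.

Lemma coded_ex_upd (n : nat) (R : V -> (nat -> V) -> Prop) :
  n <> 0 -> coded R -> coded (fun A e => exists x, x ∈ A /\ R A (upd e n x)).
Proof.
  intros N (f & Hf & H). assert (N' := num_not_emp N). assert (Hn := num_om n).
  exists (cex (num n) f). split; [now apply cex_FF|].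
  intros A c s e Hs He. rewrite sat_ex by auto. split.
  - intros (s' & Hs' & Ha & Hf').
    destruct (assignment_value Hs' Hn) as (x & Hx & Hnx).
    exists x. split; auto.
    apply (H A c s' _ Hs' (realizes_update Hs Hs' He Ha Hnx)). exact Hf'.
  - intros (x & Hx & HR). destruct (update_assignment Hs Hn N' Hx) as (s' & Hs' & Ha & Hnx).
    exists s'. split; [|split]; auto.
    now apply (H A c s' _ Hs' (realizes_update Hs Hs' He Ha Hnx)).
Qed.

(** [B] does not mention the variable [n], so that the bound variable may be
    named [n]. *)
Lemma coded_ex (n : nat) (B : V -> (nat -> V) -> V -> Prop) :
  n <> 0 -> (forall A e x, B A (upd e n x) x <-> B A e x) ->
  coded (fun A e => B A e (e n)) -> coded (fun A e => exists x, x ∈ A /\ B A e x).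
Proof.
  intros N E HB. eapply coded_ext; [|exact (coded_ex_upd N HB)].
  intros A e. simpl. unfold upd at 2. rewrite Nat.eqb_refl. now setoid_rewrite E.
Qed.

Lemma coded_all (n : nat) (B : V -> (nat -> V) -> V -> Prop) :
  n <> 0 -> (forall A e x, B A (upd e n x) x <-> B A e x) ->
  coded (fun A e => B A e (e n)) -> coded (fun A e => forall x, x ∈ A -> B A e x).
Proof.
  intros N E HB.
  apply (@coded_ext (fun A e => ~ exists x, x ∈ A /\ ~ B A e x)).
  - intros A e. split.
    + intros M x Hx. apply NNPP. eauto.
    + intros M (x & Hx & Nx). auto.
  - apply coded_not. apply (@coded_ex n (fun A e x => ~ B A e x)); auto.
    + intros A e x. now rewrite E.
    + now apply coded_not.
Qed.

(** The existential formula is passed from [H] down to [M], a witness is taken there, and the matrix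
    is passed back up. The updated assignment is returned too, so that the lemma can be iterated. *)
Lemma tarski_vaught M H c (R : V -> (nat -> V) -> Prop) (n : nat) e s :
  elementary_submodel M H c -> coded R -> n <> 0 ->
  is_assignment om M c s -> realizes s e ->
  (exists y, y ∈ H /\ R H (upd e n y)) ->
  exists y s', y ∈ M /\ R H (upd e n y) /\
    is_assignment om M c s' /\ realizes s' (upd e n y).
Proof.
  intros (HM & Hc & HE) (f & Hf & HR) N Hs He (y & Hy & HRy).
  assert (N' := num_not_emp N). assert (Hn := num_om n).
  assert (HsH := assignment_mono HM Hs).
  assert (Ow : is_omega (@om V hZF)) by now apply is_omega_iff.
  assert (OF : is_formula_set om (@FF V hZF)) by now apply is_formula_set_iff.
  assert (Q : satisfies M c (cex (num n) f) s).
  { apply (HE om FF); auto using cex_FF. apply sat_ex; auto.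
    destruct (update_assignment HsH Hn N' Hy) as (s' & Hs' & Ha & Hny).
    exists s'. split; [|split]; auto.
    now apply (HR H c s' _ Hs' (realizes_update HsH Hs' He Ha Hny)). }
  apply sat_ex in Q; auto. destruct Q as (s' & Hs' & Ha & Q).
  destruct (assignment_value Hs' Hn) as (x & Hx & Hnx).
  assert (Hr := realizes_update Hs Hs' He Ha Hnx).
  exists x, s'. split; [|split; [|split]]; auto.
  apply (HR H c s' _ (assignment_mono HM Hs') Hr).
  now apply (HE om FF).
Qed.

End Coding.

(** The argument is the next fresh variable. That the body does not mention it is checked by
    computation, which is what [reflexivity] does here. *)
Ltac cd n :=
  cbv beta;
  lazymatch goal with
  | |- coded (fun A e => exists x, x ∈ A /\ @?B A e x) =>
      apply (@coded_ex _ _ n B); [discriminate | intros; reflexivity | cd (S n)]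
  | |- coded (fun A e => forall x, x ∈ A -> @?B A e x) =>
      apply (@coded_all _ _ n B); [discriminate | intros; reflexivity | cd (S n)]
  | |- coded (fun A e => @?P A e /\ @?Q A e) => apply (@coded_and _ _ P Q); cd n
  | |- coded (fun A e => @?P A e \/ @?Q A e) => apply (@coded_or _ _ P Q); cd n
  | |- coded (fun A e => @?P A e <-> @?Q A e) =>
      apply (@coded_and _ _ (fun A e => P A e -> Q A e) (fun A e => Q A e -> P A e)); cd n
  | |- coded (fun A e => ~ @?P A e) => apply (@coded_not _ _ P); cd n
  | |- coded (fun A e => @?P A e -> @?Q A e) => apply (@coded_imp _ _ P Q); cd n
  | |- coded (fun A e => e ?i ∈ e ?j) => apply coded_mem
  | |- coded (fun A e => e ?i = e ?j) => apply coded_eq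
  end.

(** * Countable elementary submodels yield dependent choice *)

Section Reflection.
Context {V : structure} {hZF : ZF V}.
Implicit Types (x y z a b c f g j t u v w n m s p A K M H T L : V).

(** The suffix [A] marks relativisation to [A]. Every quantifier is bounded by [A] and pairs are
    spelled out, which is the form that [cd] accepts. *)
Definition upairA A z a b : Prop := forall u, u ∈ A -> (u ∈ z <-> u = a \/ u = b).
Definition pairA A p x y : Prop :=
  exists s, s ∈ A /\ exists t, t ∈ A /\ (upairA A s x x /\ upairA A t x y /\ upairA A p s t).
Definition edgeA A K x y : Prop := exists p, p ∈ A /\ (p ∈ K /\ pairA A p x y).

Definition serial K : Prop :=
  (exists x y, pr x y ∈ K) /\ forall x y, pr x y ∈ K -> exists z, pr y z ∈ K.
Definition serialA A K : Prop :=
  (exists x, x ∈ A /\ exists y, y ∈ A /\ edgeA A K x y) /\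
  forall x, x ∈ A -> forall y, y ∈ A -> edgeA A K x y -> exists z, z ∈ A /\ edgeA A K y z.
Definition single_valued g : Prop :=
  forall x y y', pr x y ∈ g -> pr x y' ∈ g -> y = y'.
Definition single_valuedA A g : Prop :=
  forall x, x ∈ A -> forall y, y ∈ A -> forall y', y' ∈ A ->
    edgeA A g x y -> edgeA A g x y' -> y = y'.

(** A failure of dependent choice, phrased without [ω] so that it is absolute
    for [H(κ)]: along [K] one can always go on, but no part of [K] prescribes
    an infinite walk. *)
Definition choiceless K : Prop :=
  serial K /\ ~ exists g, g ⊆ K /\ serial g /\ single_valued g.
Definition choicelessA A K : Prop :=
  serialA A K /\ ~ exists g, g ∈ A /\ ((forall p, p ∈ A -> (p ∈ g -> p ∈ K)) /\
     serialA A g /\ single_valuedA A g).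

Lemma coded_edge : coded (fun A e => edgeA A (e 1) (e 2) (e 3)).
Proof. unfold edgeA, pairA, upairA. cd 4. Qed.

Lemma coded_choiceless : coded (fun A e => choicelessA A (e 1)).
Proof.
  unfold choicelessA, serialA, single_valuedA, edgeA, pairA, upairA. cd 2.
Qed.

(** An edge lies in [K ∈ A], so transitivity puts the pair and the two unordered pairs inside it
    into [A]; the bounded quantifiers lose nothing. *)
Lemma edgeA_iff A K x y :
  transitive_set A -> K ∈ A -> x ∈ A -> y ∈ A -> (edgeA A K x y <-> pr x y ∈ K).
Proof.
  intros HT HK Hx Hy.
  assert (U : forall z a b, z ∈ A -> a ∈ A -> b ∈ A -> (upairA A z a b <-> z = upair a b)).
  { intros z a b Hz Ha Hb. split.
    - intro E. apply ext. intro u. rewrite in_upair. split; intro Hu.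
      + apply E; auto. exact (HT z Hz u Hu).
      + apply E; auto. destruct Hu; now subst.
    - intros -> u Hu. apply in_upair. }
  split.
  - intros (p & Hp & HpK & s & Hs & t & Ht & H1 & H2 & H3).
    apply U in H1, H2, H3; auto. subst. exact HpK.
  - intro HpK. assert (Hp : pr x y ∈ A) by exact (HT K HK _ HpK).
    assert (Hs : upair x x ∈ A) by (apply (HT _ Hp), in_upair; auto).
    assert (Ht : upair x y ∈ A) by (apply (HT _ Hp), in_upair; auto).
    exists (pr x y). split; auto. split; auto.
    exists (upair x x). split; auto. exists (upair x y). split; auto.
    split; [now apply U | split; now apply U].
Qed.

Lemma edge_in A K x y : transitive_set A -> K ∈ A -> pr x y ∈ K -> x ∈ A /\ y ∈ A.
Proof.
  intros HT HK H. assert (Hp : pr x y ∈ A) by exact (HT K HK _ H).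
  assert (Ht : upair x y ∈ A) by (apply (HT _ Hp), in_upair; auto).
  split; apply (HT _ Ht), in_upair; auto.
Qed.

Lemma serialA_iff A K : transitive_set A -> K ∈ A -> (serialA A K <-> serial K).
Proof.
  intros HT HK. assert (E := fun x y => @edgeA_iff A K x y HT HK).
  assert (I := fun x y => @edge_in A K x y HT HK). unfold serialA, serial. split.
  - intros [(x & Hx & y & Hy & H) S]. split.
    + exists x, y. now apply E.
    + intros x' y' H'. destruct (I _ _ H') as [Hx' Hy'].
      destruct (S x' Hx' y' Hy') as (z & Hz & Hyz); [now apply E|]. exists z. now apply E.
  - intros [(x & y & H) S]. split.
    + destruct (I _ _ H). exists x. split; auto. exists y. split; auto. now apply E.
    + intros x' Hx' y' Hy' H'. apply E in H'; auto. destruct (S _ _ H') as [z Hz].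
      exists z. destruct (I _ _ Hz). split; auto. now apply E.
Qed.

Lemma single_valuedA_iff A g :
  transitive_set A -> g ∈ A -> (single_valuedA A g <-> single_valued g).
Proof.
  intros HT Hg. assert (E := fun x y => @edgeA_iff A g x y HT Hg).
  assert (I := fun x y => @edge_in A g x y HT Hg). unfold single_valuedA, single_valued. split.
  - intros S x y y' H H'. destruct (I _ _ H), (I _ _ H'). apply (S x) ; auto; now apply E.
  - intros S x Hx y Hy y' Hy' H H'. apply E in H, H'; eauto.
Qed.

(** Transitivity makes edges absolute. In addition H(κ) contains all subsets of its members, so the
    second-order quantifier over [g ⊆ K] is absolute as well. *)
Lemma choicelessA_iff H k K : is_H H k -> K ∈ H -> (choicelessA H K <-> choiceless K).
Proof.
  intros HH HK. assert (HT := H_transitive HH).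
  unfold choicelessA, choiceless. rewrite serialA_iff by auto.
  apply and_iff_compat_l. split; intros N; contradict N.
  - destruct N as (g & Hg & S & F). assert (Hg' := H_subset HH HK Hg).
    exists g. split; auto. split; [intros p Hp; apply Hg|].
    now rewrite serialA_iff, single_valuedA_iff.
  - destruct N as (g & Hg & Hs & S & F). exists g.
    rewrite serialA_iff in S by auto. rewrite single_valuedA_iff in F by auto. 
    split; auto. intros p Hp. apply Hs; auto. exact (HT g Hg p Hp).
Qed.

(** Each vertex in a countable serial set [M] can choose its least successor. *)
Lemma countable_serial M K :
  countable M -> (exists x y, x ∈ M /\ y ∈ M /\ pr x y ∈ K) ->
  (forall x y, x ∈ M -> y ∈ M -> pr x y ∈ K -> exists z, z ∈ M /\ pr y z ∈ K) ->
  ~ choiceless K.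
Proof.
  intros HM (x0 & y0 & Hx0 & Hy0 & H0) S [_ N]. apply N.
  apply countable_iff in HM. destruct HM as [j Hj]. apply is_injection_iff in Hj.
  destruct Hj as [Hj Ij]. assert (Hj' := Hj). apply is_function_iff in Hj'.
  destruct Hj' as (Sj & Fj & _).
  set (Q := fun x n => exists y, y ∈ M /\ pr x y ∈ K /\ pr y n ∈ j).
  assert (DQ : def2 Q) by (unfold Q; df).
  destruct (separation K (P := fun p => exists x y n, p = pr x y /\ x ∈ M /\ y ∈ M /\
    pr y n ∈ j /\ forall m, m ∈ n -> ~ Q x m)) as [g Hg]; [df|].
  assert (E : forall x y, pr x y ∈ g <-> pr x y ∈ K /\ x ∈ M /\ y ∈ M /\ exists n,
    pr y n ∈ j /\ forall m, m ∈ n -> ~ Q x m).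
  { intros x y. rewrite Hg. apply and_iff_compat_l. split.
    - intros (x' & y' & n & E & H). apply pr_inj in E. destruct E; subst.
      destruct H as (? & ? & ? & ?). eauto.
    - intros (? & ? & n & ? & ?). exists x, y, n. auto. }
  assert (T : forall x y, x ∈ M -> y ∈ M -> pr x y ∈ K -> exists z, pr x z ∈ g).
  { intros x y Hx Hy Hxy.
    destruct (@om_least V hZF (fun n => Q x n)) as (n & Hn & (z & Hz & Hxz & Hzn) & Hmin); [df| |].
    - destruct (function_value Hj Hy) as (n & Hn & Hyn). exists n. split; auto. exists y. auto.
    - exists z. apply E. eauto 8. }
  exists g. split; [|split; [split|]].
  - intros p Hp. now apply Hg in Hp.
  - destruct (T x0 y0 Hx0 Hy0 H0) as [z Hz]. eauto.
  - intros x y Hxy. apply E in Hxy. destruct Hxy as (H & Hx & Hy & _).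
    destruct (S x y Hx Hy H) as (z & Hz & Hyz). eauto.
  - intros x y y' H1 H2. apply E in H1, H2.
    destruct H1 as (K1 & Hx & Hy & n & Hyn & L), H2 as (K2 & _ & Hy' & n' & Hyn' & L').
    assert (Hn : n ∈ om) by (apply Sj, pr_in_prod in Hyn; tauto).
    assert (Hn' : n' ∈ om) by (apply Sj, pr_in_prod in Hyn'; tauto).
    destruct (nat_trichotomy Hn Hn') as [Hlt|[->|Hlt]].
    + exfalso. apply (L' n Hlt). exists y. auto.
    + eauto.
    + exfalso. apply (L n' Hlt). exists y'. auto.
Qed.

Lemma no_countable_elementary H k M c K :
  is_H H k -> K ∈ H -> choiceless K -> countable M -> ~ elementary_submodel M H c.
Proof.
  intros HH HK HC HM HE. assert (HT := H_transitive HH).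
  assert (Hc : c ∈ M) by apply HE. assert (HMH : M ⊆ H) by apply HE.
  destruct (constant_assignment Hc) as (s & Hs & Hsc).
  assert (Hr : realizes s (fun _ => c)) by (intro i; apply Hsc, num_om).
  destruct (tarski_vaught (n := 1) HE coded_choiceless (Nat.neq_succ_0 0) Hs Hr)
    as (K' & s1 & HK' & HC' & Hs1 & Hr1).
  { exists K. split; auto. now apply (choicelessA_iff HH). }
  change (choicelessA H K') in HC'.
  assert (HKH : K' ∈ H) by auto.
  apply (choicelessA_iff HH) in HC'; auto.
  (* With [K'] in variable 1 and [x] in variable 2, a successor is sought for variable 3: a vertex
     of [M] with a successor in [H] has one in [M]. *)
  assert (TV : forall x y, x ∈ M -> pr x y ∈ K' -> exists z, z ∈ M /\ pr x z ∈ K').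
  { intros x y Hx Hxy.
    destruct (update_assignment Hs1 (num_om 2) (@num_not_emp V hZF 2 (Nat.neq_succ_0 1)) Hx)
      as (s2 & Hs2 & Ha2 & Hv2).
    assert (Hr2 := realizes_update Hs1 Hs2 Hr1 Ha2 Hv2).
    destruct (tarski_vaught (n := 3) HE coded_edge (Nat.neq_succ_0 2) Hs2 Hr2)
      as (z & s3 & Hz & HR & _).
    - exists y. destruct (edge_in HT HKH Hxy). split; auto.
      change (edgeA H K' x y). now apply edgeA_iff.
    - change (edgeA H K' x z) in HR. apply edgeA_iff in HR; eauto. }
  apply (@countable_serial M K' HM); auto.
  - destruct HC' as [[(x & y & Hxy) _] _].
    (* An initial edge is found in two moves: first a vertex of [M] with some successor in [H], then
       by [TV] a successor in [M]. *)
    destruct (tarski_vaught (n := 2) (R := fun A e => exists y, y ∈ A /\ edgeA A (e 1) (e 2) y)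
      HE ltac:(unfold edgeA, pairA, upairA; cd 3) (Nat.neq_succ_0 1) Hs1 Hr1)
      as (x' & s2 & Hx' & HR & _).
    + exists x. destruct (edge_in HT HKH Hxy). split; auto.
      change (exists y, y ∈ H /\ edgeA H K' x y). exists y. split; auto. now apply edgeA_iff.
    + change (exists y, y ∈ H /\ edgeA H K' x' y) in HR. destruct HR as (y' & Hy' & HR).
      apply edgeA_iff in HR; auto. destruct (TV x' y' Hx' HR) as (z & Hz & Hxz). eauto.
  - intros x y Hx Hy Hxy. destruct HC' as [[_ S] _]. destruct (S _ _ Hxy) as [z Hz]. eauto.
Qed.

(** ** Recursion along a function *)

(** [ord_rec] supplies only the set of earlier values, from which the last one cannot be read off.
    Instead [f] is the least set that contains [(0, x0)] and is closed under following [g]; removing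
    stray pairs leaves a closed set, so leastness gives uniqueness at 0 and a predecessor for each
    later value. *)
Lemma iterate g x0 y0 :
  single_valued g -> pr x0 y0 ∈ g -> (forall x y, pr x y ∈ g -> exists z, pr y z ∈ g) ->
  exists f, is_function f om (dom g) /\
    forall n x y, n ∈ om -> pr n x ∈ f -> pr (sc n) y ∈ f -> pr x y ∈ g.
Proof.
  intros F H0 S.
  set (cl := fun Z => pr emp x0 ∈ Z /\
    forall n x y, n ∈ om -> pr n x ∈ Z -> pr x y ∈ g -> pr (sc n) y ∈ Z).
  assert (D : def1 cl) by (unfold cl; df).
  destruct (separation (prod om (dom g)) (P := fun p => forall Z, cl Z -> p ∈ Z)) as [f Hf]; [df|].
  assert (Sf : forall n x, pr n x ∈ f -> n ∈ om /\ exists y, pr x y ∈ g).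
  { intros n x H. apply Hf in H. destruct H as [H _]. now rewrite pr_in_prod, in_dom in H. }
  assert (C : cl f).
  { split.
    - apply Hf. rewrite pr_in_prod, in_dom. split; [split; [exact emp_om|eauto]|].
      intros Z HZ. apply HZ.
    - intros n x y Hn Hx Hxy. apply Hf. rewrite pr_in_prod, in_dom.
      split; [split; [now apply sc_om | eauto]|].
      intros Z HZ. apply Hf in Hx. destruct Hx as [_ Hx]. destruct HZ as [HZ1 HZ2].
      apply (HZ2 n x y); auto. apply Hx. split; auto. }
  assert (I0 : forall x, pr emp x ∈ f -> x = x0).
  { intros x Hx.
    destruct (separation f (P := fun p => forall x, p = pr emp x -> x = x0)) as [Z HZ]; [df|].
    assert (CZ : cl Z).
    { split.
      - apply HZ. split; [apply C|]. intros x' E. apply pr_inj in E. now destruct E.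
      - intros n y z Hn Hy Hyz. apply HZ. apply HZ in Hy. destruct Hy as [Hy _].
        split; [now apply (proj2 C n y z)|]. intros x' E. apply pr_inj in E.
        destruct E as [E _]. exfalso. apply (@in_emp V hZF n). rewrite <- E. apply in_sc. auto. }
    apply Hf in Hx. destruct Hx as [_ Hx]. specialize (Hx Z CZ). apply HZ in Hx.
    now apply Hx. }
  assert (I1 : forall n y, n ∈ om -> pr (sc n) y ∈ f -> exists x, pr n x ∈ f /\ pr x y ∈ g).
  { intros n y Hn Hy.
    destruct (separation f (P := fun p => forall n y, n ∈ om -> p = pr (sc n) y ->
      exists x, pr n x ∈ f /\ pr x y ∈ g)) as [Z HZ]; [df|].
    assert (CZ : cl Z).
    { split.
      - apply HZ. split; [apply C|]. intros n' x' Hn' E. apply pr_inj in E. destruct E as [E _].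
        exfalso. apply (@in_emp V hZF n'). rewrite E. apply in_sc. auto.
      - intros m u v Hm Hu Huv. apply HZ. apply HZ in Hu. destruct Hu as [Hu _].
        split; [now apply (proj2 C m u v)|]. intros n' y' Hn' E. apply pr_inj in E.
        destruct E as [E ->]. apply sc_inj in E; auto. subst. eauto. }
    apply Hf in Hy. destruct Hy as [_ Hy]. specialize (Hy Z CZ). apply HZ in Hy.
    now apply Hy. }
  assert (U : forall n, n ∈ om -> forall x x', pr n x ∈ f -> pr n x' ∈ f -> x = x').
  { apply (@om_ind V hZF (fun n => forall x x', pr n x ∈ f -> pr n x' ∈ f -> x = x')); [df | |].
    - intros x x' H H'. now rewrite (I0 _ H), (I0 _ H').
    - intros n Hn IH y y' H H'. destruct (I1 _ _ Hn H) as (x & Hx & Hxy), (I1 _ _ Hn H') as (x' & Hx' & Hxy').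
      rewrite (IH _ _ Hx' Hx) in Hxy'. eauto. }
  exists f. split.
  - apply is_function_iff. split; [|split].
    + intros p Hp. now apply Hf in Hp.
    + intros n x x' H H'. destruct (Sf _ _ H). now apply (U n).
    + apply (@om_ind V hZF (fun n => exists x, pr n x ∈ f)); [df | |].
      * exists x0. apply C.
      * intros n Hn [x Hx]. destruct (Sf _ _ Hx) as [_ [y Hy]]. exists y. now apply (proj2 C n x y).
  - intros n x y Hn Hx Hy. destruct (I1 _ _ Hn Hy) as (x' & Hx' & H).
    now rewrite (U n Hn _ _ Hx Hx').
Qed.

(** * Chains of type ω and the failure of DC *)

Lemma strictly_below_trans T L x y z :
  is_poset T L -> strictly_below L x y -> strictly_below L y z -> strictly_below L x z.
Proof.
  intros (_ & _ & A & Tr) [H1 N1] [H2 N2]. split; [eauto|]. intros <-. eauto.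
Qed.

Lemma def_strictly_below : def3 (@strictly_below V).
Proof. unfold strictly_below. df. Qed.
Hint Resolve def_strictly_below : zfdef.

Lemma increasing_chain T L f :
  is_poset T L -> is_function f om T ->
  (forall n x y, n ∈ om -> pr n x ∈ f -> pr (sc n) y ∈ f -> strictly_below L x y) ->
  exists C, is_chain C T L /\ has_order_type C L om.
Proof.
  intros HP Hf HS. assert (Hf' := Hf). apply is_function_iff in Hf'.
  destruct Hf' as (Sf & Ff & Tf).
  assert (Rf : forall n x, pr n x ∈ f -> n ∈ om /\ x ∈ T).
  { intros n x H. now apply Sf, pr_in_prod in H. }
  assert (I : forall n, n ∈ om -> forall m x y, m ∈ n -> pr m x ∈ f -> pr n y ∈ f -> strictly_below L x y).
  { apply (@om_ind V hZF (fun n => forall m x y, m ∈ n -> pr m x ∈ f -> pr n y ∈ f -> strictly_below L x y)); [df | |].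
    - intros m x y Hm. now apply in_emp in Hm.
    - intros n Hn IH m x y Hm Hx Hy. apply in_sc in Hm. destruct Hm as [Hm | ->]; [|eauto].
      destruct (Tf n Hn) as [z Hz]. apply (strictly_below_trans HP (y := z)); eauto. }
  assert (HR : forall x, related L x x \/ ~ x ∈ T).
  { intro x. destruct (classic (x ∈ T)); auto. left. now apply HP. }
  exists (rng f). split; [split|].
  - intros x Hx. apply in_rng in Hx. destruct Hx as [n Hn]. now apply Rf in Hn.
  - intros x y Hx Hy. apply in_rng in Hx, Hy. destruct Hx as [n Hn], Hy as [m Hm].
    destruct (Rf _ _ Hn), (Rf _ _ Hm).
    destruct (@nat_trichotomy V hZF n m) as [K|[->|K]]; auto.
    + left. exact (proj1 (I m ltac:(assumption) n x y K Hn Hm)).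
    + rewrite (Ff _ _ _ Hn Hm). destruct (HR y); tauto.
    + right. exact (proj1 (I n ltac:(assumption) m y x K Hm Hn)).
  - exists f. split.
    + apply is_bijection_iff. split; [|split; [|split; [|split]]]; auto.
      * intros p Hp. assert (Hp' := Hp). apply Sf, in_prod in Hp'.
        destruct Hp' as (n & x & Hn & Hx & ->). apply pr_in_prod. rewrite in_rng. eauto.
      * intros n m x Hn Hm. destruct (Rf _ _ Hn), (Rf _ _ Hm).
        destruct (@nat_trichotomy V hZF n m) as [K|[K|K]]; auto; exfalso;
          [assert (Q : strictly_below L x x) by exact (I m ltac:(auto) n x x K Hn Hm)
          |assert (Q : strictly_below L x x) by exact (I n ltac:(auto) m x x K Hm Hn)];
          now apply Q.
      * intros x Hx. now apply in_rng.
    + setoid_rewrite related_iff. intros n m x y Hn Hm Hx Hy. split; [eauto|]. intro Q.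
      destruct (nat_trichotomy Hn Hm) as [K|[->|K]]; auto; exfalso.
      * apply Q. eauto.
      * assert (Q' := I n Hn m y x K Hy Hx).
        destruct (strictly_below_trans HP Q Q') as [_ N]. now apply N.
Qed.

(** For a tree that refutes DC, the strict order itself serves as [K]: a single-valued serial part
    of it could be iterated to a chain of type ω. *)
Lemma choiceless_of_not_DC : ~ DC V -> exists K, choiceless K.
Proof.
  intro N. apply NNPP. intro NK. apply N. intros w T L Hw HT HC HM.
  apply is_omega_iff in Hw. subst. apply NNPP. intro NC. apply NK.
  destruct (separation (prod T T) (P := fun p => exists x y, p = pr x y /\ strictly_below L x y))
    as [K HK]; [df|].
  assert (E : forall x y, pr x y ∈ K <-> x ∈ T /\ y ∈ T /\ strictly_below L x y).
  { intros x y. rewrite HK, pr_in_prod. split.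
    - intros [[Hx Hy] (x' & y' & E & H)]. apply pr_inj in E. destruct E; subst. auto.
    - intros (Hx & Hy & H). eauto 6. }
  exists K. split; [split|].
  (* An upper bound of the empty sequence provides a first node. *)
  - destruct (HC emp emp) as (u & Hu & _).
    + exact emp_om.
    + split.
      * apply is_function_iff. repeat split; [intros p Hp|intros x y y' Hp|intros x Hp]; now apply in_emp in Hp.
      * intros b d x y Hd. now apply in_emp in Hd.
    + destruct (HM u Hu) as (v & Hv & Huv). exists u, v. apply E. auto.
  - intros x y Hxy. apply E in Hxy. destruct Hxy as (_ & Hy & _).
    destruct (HM y Hy) as (z & Hz & Hyz). exists z. apply E. auto.
  - intros (g & Hg & [(x0 & y0 & H0) S] & F). apply NC.
    destruct (iterate F H0 S) as (f & Hf & Hstep).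
    apply (@increasing_chain T L f); [apply HT | |].
    + apply is_function_iff in Hf. destruct Hf as (Sf & Ff & Tf). apply is_function_iff.
      repeat split; auto. intros p Hp. apply Sf, in_prod in Hp.
      destruct Hp as (n & x & Hn & Hx & ->). apply pr_in_prod. split; auto.
      apply in_dom in Hx. destruct Hx as [y Hy]. apply Hg, E in Hy. tauto.
    + intros n x y Hn Hx Hy. apply (E x y), Hg. eauto.
Qed.

Lemma proper_of_not_DC (PP : V) : ~ DC V -> notion_of_forcing PP -> proper PP.
Proof.
  intros N (P & L & o & HP). destruct (choiceless_of_not_DC N) as [K HK].
  destruct (transitive_superset K) as (t & Ht & Tt).
  (* For [k] including this cardinal, the transitive set [t ⊇ K] does not map onto [k], so [K]
     belongs to H(k). *)
  exists P, L, o. split; auto. exists (lindenbaum t). split; [apply cardinal_lind|].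
  intros k H M _ Hk HH HM HE. exfalso.
  apply (@no_countable_elementary H k M PP K HH); auto.
  apply (in_H K HH). exists t. split; [|split]; auto. intro Q.
  apply (@lind_not_le_star V hZF t). apply (le_star_mono (k' := k) (t := t)); auto.
  intros z Hz. exact Hz.
Qed.

End Reflection.
#[global] Hint Resolve def_strictly_below : zfdef.

(** * Dependent choice along a relation *)

Section DependentChoice.
Context {V : structure} {hZF : ZF V}.
Implicit Types (x y z a b c f g h i j t u v w n m s q p A C F G K M H L P X R T : V).

Lemma function_subset s t u n m X :
  is_function s n X -> is_function t m X -> single_valued u -> s ⊆ u -> t ⊆ u ->
  n ⊆ m -> s ⊆ t.
Proof.
  intros Hs Ht Hu Su Tu Hnm p Hp. assert (Hs' := Hs). apply is_function_iff in Hs'.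
  destruct Hs' as (S & _ & _). assert (Hp' := Hp). apply S, in_prod in Hp'.
  destruct Hp' as (i & x & Hi & Hx & ->).
  destruct (function_value Ht (Hnm i Hi)) as (x' & _ & Hx').
  now rewrite (Hu i x x' (Su _ Hp) (Tu _ Hx')).
Qed.

Lemma function_extend s n X y :
  n ∈ om -> is_function s n X -> y ∈ X -> is_function (adj s (pr n y)) (sc n) X.
Proof.
  intros Hn Hs Hy. apply is_function_iff in Hs. destruct Hs as (S & Fs & T).
  assert (D : forall i x, pr i x ∈ s -> i ∈ n).
  { intros i x H. apply S, pr_in_prod in H. tauto. }
  assert (E : forall i x, pr i x ∈ adj s (pr n y) <-> pr i x ∈ s \/ (i = n /\ x = y)).
  { intros i x. rewrite in_adj. split; intros [H|H]; auto.
    - right. now apply pr_inj in H.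
    - destruct H; subst; auto. }
  apply is_function_iff. setoid_rewrite E. split; [|split].
  - intros p Hp. apply in_adj in Hp. destruct Hp as [Hp | ->].
    + apply S, in_prod in Hp. destruct Hp as (i & x & Hi & Hx & ->).
      apply pr_in_prod. rewrite in_sc. auto.
    + apply pr_in_prod. rewrite in_sc. auto.
  - intros i x x' [H|[-> ->]] [H'|[? ->]]; subst; eauto; exfalso.
    + exact (mem_irrefl (D _ _ H)).
    + exact (mem_irrefl (D _ _ H')).
  - intros i Hi. apply in_sc in Hi. destruct Hi as [Hi | ->]; [|eauto].
    destruct (T i Hi) as [x Hx]. eauto.
Qed.

Lemma function_dom s n X i : is_function s n X -> (i ∈ n <-> exists x, pr i x ∈ s).
Proof.
  intro H. assert (H' := H). apply is_function_iff in H'. destruct H' as (S & _ & T).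
  split; [apply T|]. intros [x Hx]. apply S, pr_in_prod in Hx. tauto.
Qed.

Lemma function_single_valued s n X : is_function s n X -> single_valued s.
Proof. rewrite is_function_iff. intros (_ & H & _). exact H. Qed.

Lemma nat_subset n m : n ∈ om -> m ∈ om -> n ⊆ m -> n = m \/ n ∈ m.
Proof.
  intros Hn Hm H. destruct (nat_trichotomy Hn Hm) as [K|[K|K]]; auto.
  exfalso. apply (@mem_irrefl V hZF m). auto.
Qed.

Definition walk R s n X : Prop :=
  is_function s n X /\ forall i x y, pr i x ∈ s -> pr (sc i) y ∈ s -> pr x y ∈ R.

(** The tree consists of the finite walks along [R], ordered by extension. *)
Lemma DC_relation X R :
  DC V -> (exists x, x ∈ X) -> (forall x, x ∈ X -> exists y, y ∈ X /\ pr x y ∈ R) ->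
  exists f, walk R f om X.
Proof.
  intros hDC [x0 Hx0] HR.
  destruct (separation (Pw (prod om X)) (P := fun s => exists n, n ∈ om /\ walk R s n X))
    as [T HT]; [unfold walk; df|].
  assert (ET : forall s, s ∈ T <-> exists n, n ∈ om /\ walk R s n X).
  { intro s. rewrite HT. split; [tauto|]. intro H. split; auto. apply in_Pw.
    destruct H as (n & Hn & Hs & _). apply is_function_iff in Hs. destruct Hs as (S & _ & _).
    intros p Hp. apply S, in_prod in Hp. destruct Hp as (i & x & Hi & Hx & ->).
    apply pr_in_prod. split; auto. eapply nat_mem; eauto. }
  clear HT.
  destruct (separation (prod T T) (P := fun p => exists s t, p = pr s t /\ s ⊆ t)) as [L HL]; [df|].
  assert (EL : forall s t, related L s t <-> s ∈ T /\ t ∈ T /\ s ⊆ t).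
  { intros s t. rewrite related_iff, HL, pr_in_prod. split.
    - intros [[Hs Ht] (s' & t' & E & H)]. apply pr_inj in E. destruct E; subst. auto.
    - intros (Hs & Ht & H). eauto 6. }
  assert (HP : is_poset T L).
  { split; [|split; [|split]].
    - apply is_relation_iff. intros p Hp. now apply HL in Hp.
    - intros s Hs. apply EL. split; auto. split; auto. intros z Hz. exact Hz.
    - intros s t H1 H2. apply EL in H1, H2. apply ext. intro z. split; [apply H1 | apply H2].
    - intros s t u H1 H2. apply EL in H1, H2. apply EL. split; [tauto|]. split; [tauto|].
      intros z Hz. apply H2, H1, Hz. }
  clear HL.
  (* Two walks inside a common one are comparable by their lengths; this gives both the tree
     property and the equality of nested walks of the same length. *)
  assert (Cmp : forall s t u n m, u ∈ T -> s ⊆ u -> t ⊆ u -> n ∈ om -> m ∈ om ->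
    is_function s n X -> is_function t m X -> n ⊆ m -> s ⊆ t).
  { intros s t u n m Hu Su Tu Hn Hm Hs Ht Hnm. apply ET in Hu.
    destruct Hu as (k & _ & Hu & _).
    exact (function_subset Hs Ht (function_single_valued Hu) Su Tu Hnm). }
  assert (Sub : forall s t n m, s ⊆ t -> is_function s n X -> is_function t m X -> n ⊆ m).
  { intros s t n m Hst Hs Ht i Hi. apply (function_dom i Ht).
    apply (function_dom i Hs) in Hi. destruct Hi as [x Hx]. eauto. }
  assert (Self : forall s, s ⊆ s) by (intros s z Hz; exact Hz).
  destruct (hDC om T L) as (C & [CT CL] & f & Hf & Hord).
  - now apply is_omega_iff.
  - split; [exact HP|split].
    + intros Y HY [s0 Hs0].
      (* A walk of least length in [Y] is minimal. *)
      destruct (@foundation_on V hZF (fun n => exists s, s ∈ Y /\ is_function s n X) om)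
        as (n & Hn & (s & Hs & Hsn) & Hmin); [df| |].
      { destruct (proj1 (ET s0) (HY s0 Hs0)) as (n & Hn & Hw & _). eauto. }
      exists s. split; auto. intros t Ht [Hts N]. apply N. apply EL in Hts.
      destruct Hts as (HtT & HsT & Hts).
      destruct (proj1 (ET t) HtT) as (m & Hm & Htm & _).
      destruct (nat_subset Hm Hn (Sub _ _ _ _ Hts Htm Hsn)) as [E|Hmn].
      * subst. apply ext. intro z. split; [apply Hts|].
        apply (Cmp s t s n n); auto.
      * exfalso. apply (Hmin m Hm); eauto.
    + intros u s t Hs Ht. apply EL in Hs, Ht.
      destruct Hs as (Hs & Hu & Hsu), Ht as (Ht & _ & Htu).
      destruct (proj1 (ET s) Hs) as (n & Hn & Hsn & _), (proj1 (ET t) Ht) as (m & Hm & Htm & _).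
      rewrite !EL. destruct (nat_trichotomy Hn Hm) as [K|[K|K]].
      * left. split; [|split]; auto. apply (Cmp s t u n m); auto.
        intros z Hz. exact (nat_trans Hm Hz K).
      * subst. left. split; [|split]; auto. apply (Cmp s t u m m); auto.
      * right. split; [|split]; auto. apply (Cmp t s u m n); auto.
        intros z Hz. exact (nat_trans Hn Hz K).
  (* A sequence of finite length is bounded by its last term, or by the empty walk if it has no
     terms. *)
  - intros a u Ha [Hu Hinc]. destruct (om_cases Ha) as [->|(k & Hk & ->)].
    + exists emp. split.
      * apply ET. exists emp. split; [exact emp_om|]. split.
        -- apply is_function_iff. repeat split; [intros p Hp|intros x y y' Hp|intros x Hp];
             now apply in_emp in Hp.
        -- intros i x y Hi. now apply in_emp in Hi.
      * intros b x Hb. apply related_iff in Hb. assert (Hb' : b ∈ emp).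
        { apply (function_dom b Hu). eauto. }
        now apply in_emp in Hb'.
    + assert (Hks : k ∈ sc k) by (apply in_sc; auto).
      destruct (function_value Hu Hks) as (v & Hv & Hkv). exists v. split; auto.
      intros b x Hb. assert (Hb' := Hb). apply related_iff in Hb'.
      assert (Hbk : b ∈ sc k) by (apply (function_dom b Hu); eauto).
      apply in_sc in Hbk. destruct Hbk as [Hbk | ->].
      * apply (Hinc b k x v); auto. now apply related_iff.
      * rewrite (function_single_valued Hu Hb' Hkv). now apply HP.
  - intros s Hs. assert (Hs' := Hs). apply ET in Hs'. destruct Hs' as (n & Hn & Hsn & Hw).
    (* The next vertex follows the last one; for the empty walk any starting point such as [x0] will
       do. *)
    assert (Q : exists y, y ∈ X /\ forall k x, n = sc k -> pr k x ∈ s -> pr x y ∈ R).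
    { destruct (om_cases Hn) as [->|(k & Hk & ->)].
      - exists x0. split; auto. intros k x E. exfalso. apply (@in_emp V hZF k).
        rewrite E. apply in_sc. auto.
      - destruct (@function_value V hZF s (sc k) X k Hsn) as (x & Hx & Hkx); [apply in_sc; auto|].
        destruct (HR x Hx) as (y & Hy & Hxy). exists y. split; auto.
        intros k' x' E Hx'. apply sc_inj in E; auto. subst k'.
        now rewrite (function_single_valued Hsn Hx' Hkx). }
    destruct Q as (y & Hy & Hstep). exists (adj s (pr n y)).
    assert (Hext := function_extend Hn Hsn Hy).
    assert (HT' : adj s (pr n y) ∈ T).
    { apply ET. exists (sc n). split; [now apply sc_om|]. split; auto.
      assert (E : forall i x, pr i x ∈ adj s (pr n y) <-> pr i x ∈ s \/ (i = n /\ x = y)).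
      { intros i x. rewrite in_adj. split; intros [H|H]; auto.
        - right. now apply pr_inj in H.
        - destruct H; subst; auto. }
      intros i x z H1 H2. apply E in H1, H2.
      assert (D : forall i x, pr i x ∈ s -> i ∈ n) by (intros i' x' H; apply (function_dom i' Hsn); eauto).
      destruct H1 as [H1|[-> ->]], H2 as [H2|[E2 ->]].
      - eauto.
      - symmetry in E2. eauto.
      - exfalso. apply D in H2. apply (mem_asym H2). apply in_sc. auto.
      - exfalso. apply (@mem_irrefl V hZF n). rewrite <- E2 at 2. apply in_sc. auto. }
    split; auto. split.
    + apply EL. split; [|split]; auto. intros z Hz. apply in_adj. auto.
    + intro E. apply (@mem_irrefl V hZF n). apply (function_dom n Hsn). exists y.
      rewrite E. apply in_adj. auto.
  - apply is_bijection_iff in Hf. destruct Hf as (Sf & Ff & Tf & If & Of).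
    setoid_rewrite related_iff in Hord.
    assert (FT : forall n s, pr n s ∈ f -> n ∈ om /\ s ∈ C /\ exists m, m ∈ om /\ walk R s m X).
    { intros n s H. apply Sf, pr_in_prod in H. destruct H as [Hn Hs].
      split; auto. split; auto. apply ET, CT, Hs. }
    (* The chain may skip lengths, but lengths increase strictly along it, so its [n]-th walk has
       length at least [n] and the union is total on ω. *)
    assert (Long : forall n, n ∈ om -> forall s m, pr n s ∈ f -> m ∈ om -> is_function s m X -> n ⊆ m).
    { apply (@om_ind V hZF (fun n => forall s m, pr n s ∈ f -> m ∈ om -> is_function s m X -> n ⊆ m)); [df | |].
      - intros s m _ _ _ z Hz. now apply in_emp in Hz.
      - intros n Hn IH s m Hs Hm Hsm. destruct (Tf n Hn) as [s' Hs'].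
        destruct (FT _ _ Hs') as (_ & Hs'C & m' & Hm' & Hsm' & _).
        assert (B : strictly_below L s' s).
        { apply (Hord n (sc n)); auto using sc_om. apply in_sc; auto. }
        destruct B as [B N]. apply EL in B. destruct B as (HT1 & HT2 & B).
        assert (K : m' ∈ m).
        { destruct (nat_subset Hm' Hm (Sub _ _ _ _ B Hsm' Hsm)) as [E|]; auto.
          exfalso. apply N. subst. apply ext. intro z. split; [apply B|].
          apply (Cmp s s' s m m); auto. }
        specialize (IH s' m' Hs' Hm' Hsm').
        intros z Hz. apply in_sc in Hz. destruct Hz as [Hz | ->].
        + exact (nat_trans Hm (IH z Hz) K).
        + destruct (nat_subset Hn Hm' IH) as [->|K']; auto. exact (nat_trans Hm K' K). }
    assert (Dir : forall s t, s ∈ C -> t ∈ C -> exists u, u ∈ C /\ s ⊆ u /\ t ⊆ u).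
    { intros s t Hs Ht. destruct (CL s t Hs Ht) as [H|H]; apply EL in H;
        destruct H as (_ & _ & H); [exists t | exists s]; auto. }
    assert (InC : forall s, s ∈ C -> exists m, m ∈ om /\ walk R s m X).
    { intros s Hs. apply ET, CT, Hs. }
    exists (Un C). split.
    + apply is_function_iff. split; [|split].
      * intros p Hp. apply in_Un in Hp. destruct Hp as (s & Hs & Hp).
        destruct (InC s Hs) as (m & Hm & Hsm & _). apply is_function_iff in Hsm.
        destruct Hsm as (S & _). apply S, in_prod in Hp.
        destruct Hp as (i & x & Hi & Hx & ->). apply pr_in_prod. split; auto.
        eapply nat_mem; eauto.
      * intros i x x' H1 H2. apply in_Un in H1, H2.
        destruct H1 as (s & Hs & H1), H2 as (t & Ht & H2).
        destruct (Dir s t Hs Ht) as (u & Hu & Hsu & Htu).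
        destruct (InC u Hu) as (m & Hm & Hum & _).
        exact (function_single_valued Hum (Hsu _ H1) (Htu _ H2)).
      * intros i Hi. destruct (Tf (sc i) (sc_om Hi)) as [s Hs].
        destruct (FT _ _ Hs) as (_ & HsC & m & Hm & Hsm & _).
        assert (Him : i ∈ m) by (apply (Long _ (sc_om Hi) s m Hs Hm Hsm), in_sc; auto).
        destruct (function_value Hsm Him) as (x & _ & Hx). exists x. apply in_Un. eauto.
    + intros i x y H1 H2. apply in_Un in H1, H2.
      destruct H1 as (s & Hs & H1), H2 as (t & Ht & H2).
      destruct (Dir s t Hs Ht) as (u & Hu & Hsu & Htu).
      destruct (InC u Hu) as (m & Hm & _ & Hw). eauto.
Qed.

End DependentChoice.

(** * The downward Löwenheim–Skolem theorem from dependent choice *)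

Section Skolem.
Context {V : structure} {hZF : ZF V}.
Implicit Types (x y z a b f g h i j k t u v w n m s q p A C F G M X R T : V).
Context (H c : V).
Context (Hc : c ∈ H).

Lemma common_value A B s t i x :
  is_assignment om A c s -> is_assignment om B c t -> pr i x ∈ s -> pr i x ∈ t ->
  forall y, pr i y ∈ s <-> pr i y ∈ t.
Proof.
  intros Hs Ht H1 H2 y. split; intro H3.
  - now rewrite (assignment_functional Hs H3 H1).
  - now rewrite (assignment_functional Ht H3 H2).
Qed.

Lemma nat_max n m : n ∈ om -> m ∈ om -> exists k, k ∈ om /\ n ⊆ k /\ m ⊆ k.
Proof.
  assert (Self : forall x, x ⊆ x) by (intros x z Hz; exact Hz).
  intros Hn Hm. destruct (nat_trichotomy Hn Hm) as [K|[->|K]].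
  - exists m. split; [|split]; auto. intros z Hz. exact (nat_trans Hm Hz K).
  - exists m. auto.
  - exists n. split; [|split]; auto. intros z Hz. exact (nat_trans Hn Hz K).
Qed.

(** The bound [N] is a natural number of [V], possibly nonstandard. Only finitely many values of an
    assignment matter, which is what lets a requirement be coded by a hereditarily finite set. *)
Lemma finite_support f : f ∈ FF ->
  exists N, N ∈ om /\ forall s t, is_assignment om H c s -> is_assignment om H c t ->
    (forall i, i ∈ N -> forall x, pr i x ∈ s <-> pr i x ∈ t) ->
    (satisfies H c f s <-> satisfies H c f t).
Proof.
  assert (Two : forall i j, i ∈ om -> j ∈ om -> exists k, k ∈ om /\ i ∈ k /\ j ∈ k).
  { intros i j Hi Hj. destruct (nat_max (sc_om Hi) (sc_om Hj)) as (k & Hk & H1 & H2).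
    exists k. split; [|split]; auto; [apply H1 | apply H2]; apply in_sc; auto. }
  revert f. apply FF_ind; [df | | | | |].
  - intros i j Hi Hj. destruct (Two i j Hi Hj) as (N & HN & HiN & HjN). exists N. split; auto.
    intros s t Hs Ht E. rewrite !sat_mem by auto.
    setoid_rewrite (E i HiN). setoid_rewrite (E j HjN). reflexivity.
  - intros i j Hi Hj. destruct (Two i j Hi Hj) as (N & HN & HiN & HjN). exists N. split; auto.
    intros s t Hs Ht E. rewrite !sat_eq by auto.
    setoid_rewrite (E i HiN). setoid_rewrite (E j HjN). reflexivity.
  - intros f Hf (N & HN & IH). exists N. split; auto. intros s t Hs Ht E.
    rewrite !sat_not by auto. now rewrite (IH s t).
  - intros f g Hf Hg (N1 & HN1 & IH1) (N2 & HN2 & IH2).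
    destruct (nat_max HN1 HN2) as (N & HN & S1 & S2). exists N. split; auto.
    intros s t Hs Ht E. rewrite !sat_and by auto.
    rewrite (IH1 s t), (IH2 s t); auto; reflexivity.
  - intros n f Hn Nn Hf (N & HN & IH). exists N. split; auto.
    assert (Q : forall s t, is_assignment om H c s -> is_assignment om H c t ->
      (forall i, i ∈ N -> forall x, pr i x ∈ s <-> pr i x ∈ t) ->
      satisfies H c (cex n f) s -> satisfies H c (cex n f) t).
    { intros s t Hs Ht E S. apply sat_ex in S; auto. destruct S as (s' & Hs' & Ha & S).
      destruct (assignment_value Hs' Hn) as (x & Hx & Hnx).
      destruct (update_assignment Ht Hn Nn Hx) as (t' & Ht' & Hb & Hnx').
      apply sat_ex; auto. exists t'. split; auto. split; auto. apply (IH s' t'); auto.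
      intros i Hi y. destruct (classic (i = n)) as [->|Ni].
      - now apply (common_value Hs' Ht' Hnx Hnx').
      - assert (Hio : i ∈ om) by (eapply nat_mem; eauto).
        rewrite agree_off_iff in Ha, Hb. rewrite <- (Ha i y), <- (Hb i y) by auto. auto. }
    intros s t Hs Ht E. split; apply Q; auto. intros i Hi x. symmetry. auto.
Qed.

(** [p] maps the variables [i ≠ n] of [f] to the indices [j] of their values
    [a(j)]. *)
Definition witness f n p a s : Prop :=
  is_assignment om H c s /\ satisfies H c f s /\
  forall i j x, pr i j ∈ p -> i <> n -> pr j x ∈ a -> pr i x ∈ s.

Section Hull.
Context (h : V).
Context (Hh : is_function h om H).

(** Requirements are hereditarily finite sets [q], so each stage has only the
    finitely many [q ∈ W (dom a)] to handle: finite choice suffices for a single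
    step, and DC is needed only to iterate. *)
Definition handled q a b : Prop :=
  (forall x, pr q x ∈ h -> exists j, pr j x ∈ b) /\
  forall f n p, q = pr f (pr n p) -> n ∈ om -> (exists s, witness f n p a s) ->
    exists s x j, witness f n p a s /\ pr n x ∈ s /\ pr j x ∈ b.

(** The condition [dom a ∈ dom b] makes the domain at stage [n] include [n], so every hereditarily
    finite requirement lies in [W (dom a)] from some stage on. *)
Definition step a b : Prop :=
  a ⊆ b /\ (forall q, q ∈ W (dom a) -> handled q a b) /\ dom a ∈ dom b /\
  exists j, pr j c ∈ b.

Definition fseq a : Prop := exists n, n ∈ om /\ is_function a n H.

Lemma def_witness : def5 witness.
Proof. unfold witness. df. Qed.
Hint Resolve def_witness : zfdef.
Lemma def_handled : def3 handled.
Proof. unfold handled. df. Qed.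
Hint Resolve def_handled : zfdef.
Lemma def_step : def2 step.
Proof. unfold step. df. Qed.
Lemma def_fseq : def1 fseq.
Proof. unfold fseq. df. Qed.
Hint Resolve def_step def_fseq : zfdef.

Lemma handled_mono q a b b' : b ⊆ b' -> handled q a b -> handled q a b'.
Proof.
  intros Hb [H1 H2]. split.
  - intros x Hx. destruct (H1 x Hx) as [j Hj]. eauto.
  - intros f n p E Hn S. destruct (H2 f n p E Hn S) as (s & x & j & Hw & Hx & Hj).
    exists s, x, j. auto.
Qed.

Lemma function_dom_eq a n : is_function a n H -> dom a = n.
Proof.
  intro Ha. apply ext. intro i. rewrite in_dom. symmetry. now apply (function_dom i Ha).
Qed.

Lemma fseq_extend b x : fseq b -> x ∈ H ->
  exists b' j, fseq b' /\ b ⊆ b' /\ pr j x ∈ b' /\ dom b ∈ dom b'.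
Proof.
  intros (n & Hn & Hb) Hx. exists (adj b (pr n x)), n.
  assert (Hb' := function_extend Hn Hb Hx).
  rewrite (function_dom_eq Hb), (function_dom_eq Hb').
  split; [|split; [|split]].
  - exists (sc n). split; auto using sc_om.
  - intros z Hz. apply in_adj. auto.
  - apply in_adj. auto.
  - apply in_sc. auto.
Qed.

(** At most two entries are appended: the value of [h] at [q], and the value at [n] of one witness
    if there is any. *)
Lemma handle_one q a b : fseq b -> exists b', fseq b' /\ b ⊆ b' /\ handled q a b'.
Proof.
  intro Hb.
  assert (Self : b ⊆ b) by (intros z Hz; exact Hz).
  assert (Q1 : exists b', fseq b' /\ b ⊆ b' /\ forall x, pr q x ∈ h -> exists j, pr j x ∈ b').
  { destruct (classic (exists x, pr q x ∈ h)) as [[x Hx]|N].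
    - assert (HxH : x ∈ H).
      { assert (Hh' := Hh). apply is_function_iff in Hh'. destruct Hh' as [S _].
        apply S, pr_in_prod in Hx. tauto. }
      destruct (fseq_extend Hb HxH) as (b' & j & H1 & H2 & H3 & _).
      exists b'. split; auto. split; auto. intros y Hy.
      rewrite (function_single_valued Hh Hy Hx). eauto.
    - exists b. split; auto. split; auto. intros x Hx. exfalso. eauto. }
  destruct Q1 as (b1 & Hb1 & Hbb1 & Hq1).
  destruct (classic (exists f n p s, q = pr f (pr n p) /\ n ∈ om /\ witness f n p a s))
    as [(f & n & p & s & E & Hn & Hw)|N].
  - destruct (assignment_value (proj1 Hw) Hn) as (x & Hx & Hnx).
    destruct (fseq_extend Hb1 Hx) as (b' & j & H1 & H2 & H3 & _).
    exists b'. split; auto. split; [intros z Hz; auto|]. split.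
    + intros y Hy. destruct (Hq1 y Hy) as [j' Hj']. eauto.
    + intros f' n' p' E' _ _. rewrite E in E'. apply pr_inj in E'. destruct E' as [<- E'].
      apply pr_inj in E'. destruct E' as [<- <-]. exists s, x, j. auto.
  - exists b1. split; auto. split; auto. split; auto.
    intros f n p E Hn [s Hs]. exfalso. apply N. exists f, n, p, s. auto.
Qed.

Lemma step_exists a : fseq a -> exists b, fseq b /\ step a b.
Proof.
  intro Ha.
  assert (Self : a ⊆ a) by (intros z Hz; exact Hz).
  assert (Q : forall Q, finite Q -> exists b, fseq b /\ a ⊆ b /\ forall q, q ∈ Q -> handled q a b).
  { apply (@fin_ind V hZF (fun Q => exists b, fseq b /\ a ⊆ b /\ forall q, q ∈ Q -> handled q a b)); [df | |].
    - exists a. split; auto. split; auto. intros q Hq. now apply in_emp in Hq.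
    - intros Q q _ (b & Hb & Hab & HQ).
      destruct (handle_one q a Hb) as (b' & Hb' & Hbb' & Hq).
      exists b'. split; auto. split; [intros z Hz; auto|].
      intros r Hr. apply in_adj in Hr. destruct Hr as [Hr | ->]; auto.
      apply (handled_mono Hbb'). auto. }
  assert (Ha' := Ha). destruct Ha' as (n & Hn & Han).
  destruct (Q (W n) (finite_W Hn)) as (b & Hb & Hab & HW).
  (* Appending [c], even if it is already present, also makes the sequence strictly longer. *)
  destruct (fseq_extend Hb Hc) as (b' & j & Hb' & Hbb' & Hj & Hd).
  exists b'. split; auto. split; [intros z Hz; auto|].
  destruct Hb as (m & Hm & Hbm), Hb' as (m' & Hm' & Hbm').
  rewrite (function_dom_eq Hbm), (function_dom_eq Hbm') in Hd.
  rewrite (function_dom_eq Han), (function_dom_eq Hbm').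
  split; [|split; [|eauto]].
  - intros q Hq. apply (handled_mono Hbb'). auto.
  - assert (S : n ⊆ m).
    { intros i Hi. apply (function_dom i Hbm). apply (function_dom i Han) in Hi.
      destruct Hi as [x Hx]. eauto. }
    destruct (nat_subset Hn Hm S) as [->|K]; auto. exact (nat_trans Hm' K Hd).
Qed.

Lemma stages : DC V -> exists F,
  (forall n, n ∈ om -> exists a, pr n a ∈ F) /\ single_valued F /\
  (forall n a, pr n a ∈ F -> n ∈ om /\ fseq a) /\
  forall n a b, pr n a ∈ F -> pr (sc n) b ∈ F -> step a b.
Proof.
  intro hDC.
  destruct (separation (Pw (prod om H)) (P := fseq)) as [X HX]; [df|].
  assert (EX : forall a, a ∈ X <-> fseq a).
  { intro a. rewrite HX. split; [tauto|]. intro Ha. split; auto. apply in_Pw.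
    destruct Ha as (n & Hn & Ha). apply is_function_iff in Ha. destruct Ha as [S _].
    intros p Hp. apply S, in_prod in Hp. destruct Hp as (i & x & Hi & Hx & ->).
    apply pr_in_prod. split; auto. eapply nat_mem; eauto. }
  destruct (separation (prod X X) (P := fun p => exists a b, p = pr a b /\ step a b)) as [R HR]; [df|].
  assert (ER : forall a b, pr a b ∈ R <-> a ∈ X /\ b ∈ X /\ step a b).
  { intros a b. rewrite HR, pr_in_prod. split.
    - intros [[Ha Hb] (a' & b' & E & S)]. apply pr_inj in E. destruct E; subst. auto.
    - intros (Ha & Hb & S). eauto 6. }
  destruct (@DC_relation V hZF X R hDC) as (F & HF & HS).
  - exists emp. apply EX. exists emp. split; [exact emp_om|]. apply is_function_iff.
    repeat split; [intros p Hp|intros x y y' Hp|intros x Hp]; now apply in_emp in Hp.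
  - intros a Ha. destruct (step_exists (proj1 (EX a) Ha)) as (b & Hb & S).
    exists b. apply EX in Hb. split; auto. apply ER. auto.
  - apply is_function_iff in HF. destruct HF as (SF & FF' & TF). exists F.
    split; [|split; [|split]]; auto.
    + intros n a Hn. apply SF, pr_in_prod in Hn. destruct Hn. split; auto. now apply EX.
    + intros n a b Ha Hb. assert (K := HS n a b Ha Hb). now apply ER in K.
Qed.

(** [M] is the range of the union of the stages. The last clause is the Tarski-Vaught test: the
    relevant part of [s] is replaced by a finite map into indices, so that the demand becomes a
    requirement dealt with at some late stage. *)
Lemma hull_exists : DC V -> exists M, countable M /\ M ⊆ H /\ c ∈ M /\
  (forall n x, pr n x ∈ h -> x ∈ M) /\
  forall f n s t, f ∈ FF -> n ∈ om -> n <> emp -> is_assignment om M c s ->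
    is_assignment om H c t -> agree_off om n s t -> satisfies H c f t ->
    exists u, is_assignment om M c u /\ agree_off om n s u /\ satisfies H c f u.
Proof.
  intro hDC. destruct (stages hDC) as (F & TF & FF' & RF & SF).
  assert (Mono : forall n, n ∈ om -> forall m a b, m ∈ n -> pr m a ∈ F -> pr n b ∈ F -> a ⊆ b).
  { apply (@om_ind V hZF (fun n => forall m a b, m ∈ n -> pr m a ∈ F -> pr n b ∈ F -> a ⊆ b)); [df | |].
    - intros m a b Hm. now apply in_emp in Hm.
    - intros n Hn IH m a b Hm Ha Hb. apply in_sc in Hm. destruct Hm as [Hm | ->].
      + destruct (TF n Hn) as [d Hd]. destruct (SF _ _ _ Hd Hb) as [S _].
        intros z Hz. apply S. exact (IH m a d Hm Ha Hd z Hz).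
      + exact (proj1 (SF _ _ _ Ha Hb)). }
  assert (Dir : forall n m a b, pr n a ∈ F -> pr m b ∈ F -> a ⊆ b \/ b ⊆ a).
  { intros n m a b Ha Hb. destruct (RF _ _ Ha) as [Hn _], (RF _ _ Hb) as [Hm _].
    destruct (nat_trichotomy Hn Hm) as [K|[->|K]].
    - left. eauto.
    - left. rewrite (FF' _ _ _ Ha Hb). intros z Hz. exact Hz.
    - right. eauto. }
  assert (Long : forall n, n ∈ om -> forall a, pr n a ∈ F -> n ⊆ dom a).
  { apply (@om_ind V hZF (fun n => forall a, pr n a ∈ F -> n ⊆ dom a)); [df | |].
    - intros a _ z Hz. now apply in_emp in Hz.
    - intros n Hn IH b Hb. destruct (TF n Hn) as [a Ha].
      destruct (SF _ _ _ Ha Hb) as (_ & _ & K & _). specialize (IH a Ha).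
      destruct (RF _ _ Ha) as (_ & m & Hm & Ham), (RF _ _ Hb) as (_ & m' & Hm' & Hbm').
      rewrite (function_dom_eq Hbm') in *. rewrite (function_dom_eq Ham) in *.
      intros z Hz. apply in_sc in Hz. destruct Hz as [Hz | ->].
      + exact (nat_trans Hm' (IH z Hz) K).
      + destruct (nat_subset Hn Hm IH) as [->|K']; auto. exact (nat_trans Hm' K' K). }
  set (inG := fun j x => exists n a, pr n a ∈ F /\ pr j x ∈ a).
  assert (DG : def2 inG) by (unfold inG; df).
  assert (FG : forall j x y, inG j x -> inG j y -> x = y).
  { intros j x y (n & a & Ha & Hx) (m & b & Hb & Hy).
    destruct (RF _ _ Ha) as (_ & k & _ & Hak), (RF _ _ Hb) as (_ & l & _ & Hbl).
    destruct (Dir _ _ _ _ Ha Hb) as [S|S].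
    - exact (function_single_valued Hbl (S _ Hx) Hy).
    - exact (function_single_valued Hak Hx (S _ Hy)). }
  assert (RG : forall j x, inG j x -> j ∈ om /\ x ∈ H).
  { intros j x (n & a & Ha & Hx). destruct (RF _ _ Ha) as (_ & k & Hk & Hak).
    apply is_function_iff in Hak. destruct Hak as [S _]. apply S, pr_in_prod in Hx.
    destruct Hx. split; auto. eapply nat_mem; eauto. }
  destruct (separation H (P := fun x => exists j, inG j x)) as [M HM]; [df|].
  assert (EM : forall x, x ∈ M <-> exists j, inG j x).
  { intro x. rewrite HM. split; [tauto|]. intros [j Hj]. split; [|eauto]. now apply RG in Hj. }
  assert (HMH : M ⊆ H) by (intros x Hx; now apply HM in Hx).
  (* A requirement of rank bounded by [m] is handled at stage [m] and again at all later ones, which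
     allows waiting until its indices are in use. *)
  assert (Late : forall q, q ∈ Vom -> exists m, m ∈ om /\ forall n a b, m = n \/ m ∈ n ->
    pr n a ∈ F -> pr (sc n) b ∈ F -> handled q a b).
  { intros q Hq. apply in_Vom in Hq. destruct Hq as (m & Hm & Hq). exists m. split; auto.
    intros n a b Hmn Ha Hb. destruct (RF _ _ Ha) as (Hn & k & Hk & Hak).
    destruct (SF _ _ _ Ha Hb) as (_ & S & _). apply S.
    assert (L := Long n Hn a Ha). rewrite (function_dom_eq Hak) in *.
    assert (Hmk : m = k \/ m ∈ k).
    { destruct (nat_subset Hn Hk L) as [<-|K]; auto. right.
      destruct Hmn as [->|K']; auto. }
    destruct Hmk as [<-|K]; auto. exact (W_mono (ord_nat Hk) K Hq). }
  exists M. split; [|split; [|split; [|split]]]; auto.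
  - apply (@countable_intro V hZF inG); auto.
    + intros x Hx. apply EM in Hx. destruct Hx as [j Hj]. exists j. split; auto. now apply RG in Hj.
    + intros n y y' _ _ _. apply FG.
  - destruct (TF emp emp_om) as [a Ha], (TF (sc emp) (sc_om emp_om)) as [b Hb].
    destruct (SF _ _ _ Ha Hb) as (_ & _ & _ & j & Hj). apply EM. exists j, (sc emp), b. auto.
  - intros n x Hx.
    assert (Hn : n ∈ om) by (apply (function_dom n Hh); eauto).
    destruct (Late n (nat_in_Vom Hn)) as (m & Hm & HL).
    destruct (TF m Hm) as [a Ha], (TF (sc m) (sc_om Hm)) as [b Hb].
    destruct (HL m a b (or_introl eq_refl) Ha Hb) as [K _].
    destruct (K x Hx) as [j Hj]. apply EM. exists j, (sc m), b. auto.
  - intros f n s t Hf Hn Nn Hs Ht Hst Hsat.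
    destruct (finite_support Hf) as (N & HN & Supp).
    (* [p] records, for each variable in the support, the least index of its value; leastness makes
       this a function without choice. *)
    destruct (@partial_function_intro V hZF N om (fun i j => exists x, pr i x ∈ s /\ inG j x /\
      forall j', j' ∈ j -> ~ inG j' x)) as (p & Hp & Ep); [df| |].
    { intros i j j' _ Hj Hj' (x & H1 & H2 & H3) (x' & H1' & H2' & H3').
      rewrite (assignment_functional Hs H1' H1) in *.
      destruct (nat_trichotomy Hj Hj') as [K|[K|K]]; auto; exfalso.
      - exact (H3' j K H2).
      - exact (H3 j' K H2'). }
    assert (Tp : forall i, i ∈ N -> exists x j, pr i x ∈ s /\ pr i j ∈ p /\ inG j x).
    { intros i Hi. destruct (assignment_value Hs (nat_mem HN Hi)) as (x & Hx & Hix).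
      apply EM in Hx. destruct Hx as [j0 Hj0].
      destruct (@om_least V hZF (fun j => inG j x)) as (j & Hj & Hjx & Hmin); [df| |].
      - exists j0. split; auto. now apply RG in Hj0.
      - exists x, j. split; [|split]; auto. apply Ep. split; [|split]; auto. exists x. auto. }
    assert (Fp : finite p).
    { apply (@finite_image V hZF (fun i q => exists j, q = pr i j) N).
      - df.
      - now apply finite_nat.
      - intros q Hq. apply is_partial_function_iff in Hp. apply Hp, in_prod in Hq.
        destruct Hq as (i & j & Hi & Hj & ->). eauto.
      - intros i q q' Hq Hq' [j ->] [j' ->]. apply is_partial_function_iff in Hp. f_equal.
        eapply Hp; eauto. }
    assert (Vp : p ∈ Vom).
    { apply finite_in_Vom; auto. intros q Hq. apply is_partial_function_iff in Hp.
      apply Hp, in_prod in Hq. destruct Hq as (i & j & Hi & Hj & ->).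
      apply pr_in_Vom; apply nat_in_Vom; auto. exact (nat_mem HN Hi). }
    assert (Vq : pr f (pr n p) ∈ Vom).
    { repeat apply pr_in_Vom; auto using FF_in_Vom, nat_in_Vom. }
    destruct (Late _ Vq) as (m & Hm & HL).
    (* As [p] is finite, one stage already contains all the entries to which it refers. *)
    destruct (@finite_bounded V hZF (fun k q => exists i j x a, q = pr i j /\ pr i x ∈ s /\ pr k a ∈ F /\
      pr j x ∈ a) p) as (k & Hk & Hkp); auto; [df | | |].
    { intros k' m' q Hk' Hm' (i & j & x & a & -> & Hx & Ha & Hj).
      destruct (TF k' Hk') as [b Hb]. exists i, j, x, b. repeat split; auto.
      exact (Mono k' Hk' m' a b Hm' Ha Hb _ Hj). }
    { intros q Hq. assert (Hq' := Hq). apply is_partial_function_iff in Hp.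
      apply Hp, in_prod in Hq'. destruct Hq' as (i & j & Hi & Hj & ->).
      destruct (Tp i Hi) as (x & j' & Hx & Hj' & Hjx). 
      assert (E : j' = j) by (eapply Hp; eauto). subst j'.
      destruct Hjx as (k & a & Ha & Hja). exists k. split; [now apply RF in Ha|].
      exists i, j, x, a. auto. }
    assert (QK : exists K, K ∈ om /\ (m = K \/ m ∈ K) /\ (k = K \/ k ∈ K)).
    { destruct (nat_trichotomy Hm Hk) as [?|[?|?]]; [exists k | exists k | exists m]; auto. }
    destruct QK as (K & HK & HmK & HkK).
    destruct (TF K HK) as [a Ha], (TF (sc K) (sc_om HK)) as [b Hb].
    assert (Hka : forall i j, pr i j ∈ p -> exists x, pr i x ∈ s /\ pr j x ∈ a).
    { intros i j Hij. destruct (Hkp _ Hij) as (i' & j' & x & a' & E & Hx & Ha' & Hj).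
      apply pr_inj in E. destruct E; subst i' j'. exists x. split; auto.
      destruct HkK as [->|L].
      - now rewrite (FF' _ _ _ Ha Ha').
      - exact (Mono K HK k a' a L Ha' Ha _ Hj). }
    rewrite agree_off_iff in Hst.
    destruct (HL K a b HmK Ha Hb) as [_ Hd].
    (* The assignment [t] shows that the requirement can be met. The witness [u] met at this stage
       may differ from [t], but its value at [n] has been put into [M]. *)
    destruct (Hd f n p eq_refl Hn) as (u & x & j & (Hu & Hsu & Hup) & Hnx & Hjx).
    { exists t. split; [|split]; auto. intros i j x Hij Ni Hjx.
      destruct (Hka i j Hij) as (y & Hy & Hjy).
      destruct (RF _ _ Ha) as (_ & l & _ & Hal).
      rewrite (function_single_valued Hal Hjx Hjy).
      apply Hst; auto. now apply (assignment_range Hs Hy). }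
    assert (HxM : x ∈ M) by (apply EM; exists j, (sc K), b; auto).
    destruct (update_assignment Hs Hn Nn HxM) as (s' & Hs' & Hss' & Hnx').
    exists s'. split; auto. split; auto.
    rewrite agree_off_iff in Hss'.
    (* [u] is prescribed only on the variables in [p], and may leave [M] elsewhere. It agrees with
       [s'] on the support, which is enough. *)
    apply (Supp u s'); auto; [exact (assignment_mono HMH Hs')|].
    intros i Hi. destruct (classic (i = n)) as [->|Ni].
    + apply (common_value Hu Hs' Hnx Hnx').
    + destruct (Tp i Hi) as (y & j' & Hy & Hj' & _).
      destruct (Hka i j' Hj') as (y' & Hy' & Hjy').
      apply (common_value (x := y') Hu Hs').
      * eapply Hup; eauto.
      * apply Hss'; auto. exact (nat_mem HN Hi).
Qed.

(** Induction over all codes of [V], nonstandard ones included, turns the Tarski-Vaught property of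
    the hull into elementarity. The function [h] serves to place a prescribed countable family in
    [M]. *)
Lemma lowenheim_skolem : DC V -> exists M, countable M /\ elementary_submodel M H c /\
  forall n x, pr n x ∈ h -> x ∈ M.
Proof.
  intro hDC. destruct (hull_exists hDC) as (M & HM & HMH & HcM & Hhm & TV).
  exists M. split; auto. split; auto. split; auto. split; auto.
  intros w F f s Hw HF Hf. apply is_omega_iff in Hw. subst w.
  apply is_formula_set_iff in HF. subst F. revert f Hf s.
  assert (MH : forall s, is_assignment om M c s -> is_assignment om H c s).
  { intros s. apply assignment_mono, HMH. }
  apply (@FF_ind V hZF (fun f => forall s, is_assignment om M c s ->
    (satisfies M c f s <-> satisfies H c f s))); [df | | | | |].
  - intros i j Hi Hj s Hs. rewrite !sat_mem by auto. reflexivity.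
  - intros i j Hi Hj s Hs. rewrite !sat_eq by auto. reflexivity.
  - intros f Hf IH s Hs. rewrite !sat_not by auto. now rewrite IH.
  - intros f g Hf Hg IH1 IH2 s Hs. rewrite !sat_and by auto. now rewrite IH1, IH2.
  - intros n f Hn Nn Hf IH s Hs. rewrite !sat_ex by auto. split.
    + intros (s' & Hs' & Ha & S). exists s'. split; auto. split; auto. now apply IH.
    + intros (t & Ht & Ha & S). destruct (TV f n s t Hf Hn Nn Hs Ht Ha S) as (u & Hu & Hb & S').
      exists u. split; auto. split; auto. now apply IH.
Qed.

End Hull.
End Skolem.

(** * The collapse of [ω₁] *)

Section Collapse.
Context {V : structure} {hZF : ZF V}.

Lemma is_Col_iff (C : V) :
  is_Col_omega_omega1 C <-> exists w1 P L, is_omega1 w1 /\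
    (forall p, p ∈ P <-> is_partial_function p om w1 /\ finite p) /\
    (forall q p, related L q p <-> q ∈ P /\ p ∈ P /\ p ⊆ q) /\
    L ⊆ prod P P /\ is_triple C P L emp.
Proof.
  unfold is_Col_omega_omega1. split.
  - intros (w & w1 & P & L & o & Hw & Hw1 & HP & HL & Ho & HC).
    apply is_omega_iff in Hw. apply is_empty_iff in Ho. subst.
    exists w1, P, L. split; auto. split; auto. split; [|split]; auto.
    + intros q p. rewrite related_iff, HL. setoid_rewrite is_pair_iff. split.
      * intros (q' & p' & Hq & Hp & H & E). apply pr_inj in E. destruct E; subst. auto.
      * intros (Hq & Hp & H). exists q, p. auto.
    + intros z Hz. apply HL in Hz. destruct Hz as (q & p & Hq & Hp & _ & E).
      apply is_pair_iff in E. subst. now apply pr_in_prod.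
  - intros (w1 & P & L & Hw1 & HP & HL & SL & HC). exists om, w1, P, L, emp.
    rewrite is_omega_iff, is_empty_iff. split; auto. split; auto. split; auto. split; auto.
    setoid_rewrite is_pair_iff. setoid_rewrite related_iff in HL. intro z. split.
    + intro Hz. assert (Hz' := SL z Hz). apply in_prod in Hz'.
      destruct Hz' as (q & p & _ & _ & ->). apply HL in Hz. exists q, p. tauto.
    + intros (q & p & Hq & Hp & H & ->). apply HL. auto.
Qed.

Lemma Col_exists : exists C : V, is_Col_omega_omega1 C.
Proof.
  destruct (separation (Pw (prod om (lindenbaum om)))
    (P := fun p => is_partial_function p om (lindenbaum om) /\ finite p)) as [P HP]; [df|].
  destruct (separation (prod P P) (P := fun z => exists q p, z = pr q p /\ p ⊆ q)) as [L HL]; [df|].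
  exists (pr (pr P L) emp). apply is_Col_iff. exists (lindenbaum om), P, L.
  split; [exact omega1_lind|]. split; [|split; [|split]].
  - intro p. rewrite HP. split; [tauto|]. intro H. split; auto. apply in_Pw.
    destruct H as [H _]. now apply is_partial_function_iff in H.
  - intros q p. rewrite related_iff, HL, pr_in_prod. split.
    + intros [[Hq Hp] (q' & p' & E & H)]. apply pr_inj in E. destruct E; subst. auto.
    + intros (Hq & Hp & H). eauto 6.
  - intros z Hz. now apply HL in Hz.
  - now apply is_triple_iff.
Qed.

Lemma empty_condition (w1 : V) : is_partial_function emp om w1 /\ finite (@emp V hZF).
Proof.
  split; [|exact finite_emp]. apply is_partial_function_iff.
  split; [intros p Hp | intros x y y' Hp]; now apply in_emp in Hp.
Qed.

Lemma Col_forcing (C : V) : is_Col_omega_omega1 C -> notion_of_forcing C.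
Proof.
  intro HC. apply is_Col_iff in HC. destruct HC as (w1 & P & L & Hw1 & HP & HL & SL & HC).
  assert (He : emp ∈ P) by apply HP, empty_condition.
  exists P, L, emp. split; auto. split; [|split]; auto.
  - split; [|split; [|split]].
    + now apply is_relation_iff.
    + intros p Hp. apply HL. split; auto. split; auto. intros z Hz. exact Hz.
    + intros p q H1 H2. apply HL in H1, H2. apply ext. intro z. split; [apply H2 | apply H1].
    + intros p q r H1 H2. apply HL in H1, H2. apply HL. split; [tauto|]. split; [tauto|].
      intros z Hz. apply H1, H2, Hz.
  - intros p Hp. apply HL. split; auto. split; auto. intros z Hz. now apply in_emp in Hz.
Qed.

Lemma transitive_pr (H a b : V) : transitive_set H -> pr a b ∈ H -> a ∈ H /\ b ∈ H.
Proof.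
  intros HT Hp. assert (Ht : upair a b ∈ H) by (apply (HT _ Hp), in_upair; auto).
  split; apply (HT _ Ht), in_upair; auto.
Qed.

(** The Lindenbaum number of [t ∪ k0], with [t] a transitive set including [C], meets both demands:
    it includes [k0], and [t] cannot be mapped onto it. *)
Lemma large_H (k0 C : V) : is_cardinal k0 ->
  exists k H, is_cardinal k /\ k0 ⊆ k /\ is_H H k /\ C ∈ H.
Proof.
  intros [Hk0 _]. destruct (transitive_superset C) as (t & Ht & Tt).
  set (t' := bun t k0).
  assert (Tt' : transitive_set t').
  { intros x Hx z Hz. apply in_bun. apply in_bun in Hx. destruct Hx as [Hx|Hx].
    - left. exact (Tt x Hx z Hz).
    - right. exact (ord_transitive Hk0 Hx Hz). }
  destruct (H_exists (ord_lind t')) as [H HH].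
  exists (lindenbaum t'), H. split; [apply cardinal_lind|]. split; [|split]; auto.
  - apply subset_lind; auto. intros z Hz. apply in_bun. auto.
  - apply (in_H C HH). exists t'. split; [|split]; auto using lind_not_le_star.
    intros z Hz. apply in_bun. auto.
Qed.

(** Otherwise each ordinal below ω₁ is the value at [n] of some condition in [M], and numbering the
    conditions of [M] would number ω₁. *)
Lemma unused_value (w1 P M n : V) :
  is_omega1 w1 -> countable M ->
  (forall p, p ∈ P -> is_partial_function p om w1) ->
  exists a, a ∈ w1 /\ forall d, d ∈ M -> d ∈ P -> ~ pr n a ∈ d.
Proof.
  intros (_ & Hw1 & _) HM HP. apply NNPP. intro N. apply Hw1.
  apply countable_iff in HM. destruct HM as [j Hj]. apply is_injection_iff in Hj.
  destruct Hj as [Hj Ij].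
  apply (@countable_intro V hZF (fun k a => exists d, pr d k ∈ j /\ d ∈ P /\ pr n a ∈ d)); [df | |].
  - intros a Ha. apply NNPP. intro N'. apply N. exists a. split; auto.
    intros d Hd HdP Hna. apply N'. destruct (function_value Hj Hd) as (k & Hk & Hdk).
    exists k. split; auto. exists d. auto.
  - intros k a a' _ _ _ (d & Hd & HdP & Ha) (d' & Hd' & _ & Ha').
    rewrite (Ij _ _ _ Hd' Hd) in Ha'. specialize (HP d HdP).
    apply is_partial_function_iff in HP. eapply HP; eauto.
Qed.

Lemma Col_not_proper (C : V) : DC V -> is_Col_omega_omega1 C -> ~ proper C.
Proof.
  intros hDC HC (P' & L' & o' & (HC' & _) & k0 & Hk0 & Hprop).
  apply is_Col_iff in HC. destruct HC as (w1 & P & L & Hw1 & HP & HL & SL & HC).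
  (* A triple determines its components, so the order given by properness is that of the
     collapse. *)
  apply is_triple_iff in HC, HC'. rewrite HC' in HC. apply pr_inj in HC.
  destruct HC as [HC _]. apply pr_inj in HC. destruct HC as [-> ->].
  destruct (large_H C Hk0) as (k & H & Hk & Hk0k & HH & HCH).
  assert (HT := H_transitive HH).
  assert (HPH : P ∈ H).
  { rewrite HC' in HCH. destruct (transitive_pr HT HCH) as [HCH' _].
    now destruct (transitive_pr HT HCH'). }
  set (isD := fun n d => forall p, p ∈ d <-> p ∈ P /\ exists a, pr n a ∈ p).
  assert (DD : def2 isD) by (unfold isD; df).
  assert (ExD : forall n, exists d, d ∈ H /\ isD n d).
  { intro n. destruct (separation P (P := fun p => exists a, pr n a ∈ p)) as [d Hd]; [df|].
    exists d. split; auto. apply (H_subset HH HPH). intros p Hp. now apply Hd in Hp. }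
  (* The family to be placed in [M]: 0 is sent to the empty condition, at which properness will be
     tested, and [n + 1] to the dense set of conditions defined at [n]. *)
  destruct (@partial_function_intro V hZF om H (fun n d =>
    (n = emp /\ d = emp) \/ exists m, m ∈ om /\ n = sc m /\ isD m d)) as (h & Hh & Eh); [df| |].
  { assert (N : forall m : V, emp <> sc m).
    { intros m E. apply (@in_emp V hZF m). rewrite E. apply in_sc. auto. }
    intros n d d' _ _ _ [[-> ->]|(m & Hm & -> & H1)] [[E ->]|(m' & Hm' & E & H2)]; auto.
    - destruct (N _ E).
    - destruct (N _ (eq_sym E)).
    - apply sc_inj in E; auto. subst. apply ext. intro z. now rewrite (H1 z), (H2 z). }
  assert (Fh : is_function h om H).
  { split; auto. setoid_rewrite related_iff. intros n Hn.
    destruct (om_cases Hn) as [->|(m & Hm & ->)].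
    - exists emp. apply Eh. split; [exact emp_om|]. split; auto.
      apply (H_subset HH HPH). intros z Hz. now apply in_emp in Hz.
    - destruct (ExD m) as (d & Hd & HD). exists d. apply Eh. split; [now apply sc_om|].
      split; auto. right. exists m. auto. }
  destruct (lowenheim_skolem HCH Fh hDC) as (M & HM & HE & HhM).
  assert (HeP : emp ∈ P) by apply HP, empty_condition.
  assert (HeM : emp ∈ M).
  { apply (HhM emp), Eh. split; [exact emp_om|]. split; auto.
    apply (H_subset HH HPH). intros z Hz. now apply in_emp in Hz. }
  destruct (Hprop k H M Hk Hk0k HH HM HE emp HeP HeM) as (q & Hq & _ & Hgen).
  assert (Pf : forall p, p ∈ P -> is_partial_function p om w1) by (intros p Hp; now apply HP in Hp).
  assert (Sing : forall p, p ∈ P -> single_valued p).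
  { intros p Hp. apply Pf, is_partial_function_iff in Hp. exact (proj2 Hp). }
  assert (Qn : exists n, n ∈ om /\ forall x, ~ pr n x ∈ q).
  { assert (Hq' := Pf q Hq). apply is_partial_function_iff in Hq'. destruct Hq' as [Sq Fq].
    destruct (@finite_nat_bounded V hZF (dom q)) as (n & Hn & Hqn).
    - apply (@finite_image V hZF (fun p i => exists x, p = pr i x) q).
      + df.
      + now apply HP.
      + intros i Hi. apply in_dom in Hi. destruct Hi as [x Hx]. eauto.
      + intros p i i' _ _ [x ->] [x' E]. now apply pr_inj in E.
    - intros i Hi. apply in_dom in Hi. destruct Hi as [x Hx]. apply Sq, pr_in_prod in Hx. tauto.
    - exists n. split; auto. intros x Hx. apply (@mem_irrefl V hZF n). apply Hqn, in_dom. eauto. }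
  destruct Qn as (n & Hn & Hnq).
  assert (Ext : forall p a, p ∈ P -> a ∈ w1 -> (forall x, ~ pr n x ∈ p) -> adj p (pr n a) ∈ P).
  { intros p a Hp Ha N. apply HP in Hp. destruct Hp as [Hp Fp]. apply HP.
    split; [|now apply finite_adj]. apply is_partial_function_iff in Hp. destruct Hp as [S F].
    apply is_partial_function_iff. split.
    - intros z Hz. apply in_adj in Hz. destruct Hz as [Hz | ->]; auto. now apply pr_in_prod.
    - intros x y y' H1 H2. apply in_adj in H1, H2. destruct H1 as [H1|H1], H2 as [H2|H2]; eauto.
      + apply pr_inj in H2. destruct H2; subst. destruct (N _ H1).
      + apply pr_inj in H1. destruct H1; subst. destruct (N _ H2).
      + apply pr_inj in H1, H2. destruct H1, H2. now subst. }
  (* The ordinal 0 is the default value by which a condition undefined at [n] is extended into the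
     dense set. *)
  assert (Hew1 : emp ∈ w1).
  { destruct Hw1 as (Ow1 & Nw1 & _).
    destruct (@transitive_subset_ord V hZF w1 emp) as [E|E]; auto.
    - apply ord_emp.
    - intros z Hz. now apply in_emp in Hz.
    - exfalso. apply Nw1. rewrite <- E. apply (@countable_intro V hZF (fun n y => n = y)); [df | |].
      + intros y Hy. now apply in_emp in Hy.
      + intros; congruence. }
  destruct (ExD n) as (D & HDH & HD).
  assert (HDM : D ∈ M).
  { apply (HhM (sc n)), Eh. split; [now apply sc_om|]. split; auto. right. exists n. auto. }
  assert (Self : forall x : V, x ⊆ x) by (intros x z Hz; exact Hz).
  assert (Dense : open_dense D P L).
  { split; [|split].
    - intros p Hp. now apply HD in Hp.
    - intros d p Hd Hpd. apply HL in Hpd. destruct Hpd as (Hp & _ & Hpd).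
      apply HD in Hd. destruct Hd as [_ [a Ha]]. apply HD. eauto.
    - intros p Hp. destruct (classic (exists a, pr n a ∈ p)) as [Ha|Ha].
      + exists p. split; [now apply HD|]. apply HL. auto.
      + exists (adj p (pr n emp)). assert (Hp' : adj p (pr n emp) ∈ P) by (apply Ext; eauto).
        split.
        * apply HD. split; auto. exists emp. apply in_adj. auto.
        * apply HL. split; auto. split; auto. intros z Hz. apply in_adj. auto. }
  destruct (separation D (P := fun p => p ∈ M)) as [A HA]; [df|].
  destruct (unused_value n Hw1 HM Pf) as (a & Ha & Na).
  assert (Hr : adj q (pr n a) ∈ P) by auto.
  destruct (Hgen D A Dense HDM HA (adj q (pr n a))) as (d & Hd & e & He & Her & Hed).
  - apply HL. split; auto. split; auto. intros z Hz. apply in_adj. auto.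
  - apply HA in Hd. destruct Hd as [HdD HdM]. apply HD in HdD. destruct HdD as [HdP [b Hb]].
    apply HL in Her, Hed. destruct Her as (_ & _ & Her), Hed as (_ & _ & Hed).
    apply (Na d HdM HdP). replace a with b; auto.
    apply (Sing e He n); auto. apply Her, in_adj. auto.
Qed.

End Collapse.

(** * The equivalences *)

Theorem proposition4p2 (V : structure) (hZF : ZF V) :
  (DC V <->
   exists C : V, is_Col_omega_omega1 C /\ ~ proper C) /\
  ((exists C : V, is_Col_omega_omega1 C /\ ~ proper C) <->
   exists PP : V, notion_of_forcing PP /\ ~ proper PP).
Proof.
  assert (H12 : DC V -> exists C : V, is_Col_omega_omega1 C /\ ~ proper C).
  { intro hDC. destruct Col_exists as [C HC]. exists C. auto using Col_not_proper. }
  assert (H23 : (exists C : V, is_Col_omega_omega1 C /\ ~ proper C) ->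
                exists PP : V, notion_of_forcing PP /\ ~ proper PP).
  { intros (C & HC & N). exists C. auto using Col_forcing. }
  assert (H31 : (exists PP : V, notion_of_forcing PP /\ ~ proper PP) -> DC V).
  { intros (PP & HPP & N). apply NNPP. intro M. apply N. now apply proper_of_not_DC. }
  tauto.
Qed.
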